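(* Given a finite Markov chain $\mathcal{M}$ with rational transition probabilities in which every state is reachable from the initial state, and a nonempty set $\mathsf{Eff}$ of terminal non-initial states, such that $\mathsf{Eff}$ has an SPR cause in $\mathcal{M}$, an f-score-optimal SPR cause for $\mathsf{Eff}$ can be computed in polynomial time.
   Context: A Markov chain is an MDP with a single action, so there is essentially one scheduler and $\mathrm{Pr}_{\mathcal{M}}$ is the induced probability measure on maximal paths from the initial state. $\Diamond T$: eventually visiting $T$; $(\neg X)\,\mathrm{U}\,c$: visiting $c$ with no state of $X$ visited before. SPR cause: a nonempty set $\mathsf{Cause}$ of non-effect states such that each $c\in\mathsf{Cause}$ has $\mathrm{Pr}_{\mathcal{M}}((\neg\mathsf{Cause})\,\mathrm{U}\,c)>0$ and $\mathrm{Pr}_{\mathcal{M}}(\Diamond\mathsf{Eff}\mid(\neg\mathsf{Cause})\,\mathrm{U}\,c)>\mathrm{Pr}_{\mathcal{M}}(\Diamond\mathsf{Eff})$. With $\mathsf{tp}=\mathrm{Pr}(\Diamond\mathsf{Cause}\wedge\Diamond\mathsf{Eff})$, $\mathsf{fp}=\mathrm{Pr}(\Diamond\mathsf{Cause}\wedge\neg\Diamond\mathsf{Eff})$, $\mathsf{fn}=\mathrm{Pr}(\neg\Diamond\mathsf{Cause}\wedge\Diamond\mathsf{Eff})$, the f-score is $\mathit{fscore}(\mathsf{Cause})=2\mathsf{tp}/(2\mathsf{tp}+\mathsf{fp}+\mathsf{fn})$ (the harmonic mean of precision and recall). An SPR cause is f-score-optimal if its f-score is maximal among all SPR causes for $\mathsf{Eff}$.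 *)

(* Defs.v *)
From HB Require Import structures.
From mathcomp Require Import all_boot all_order all_algebra.
From mathcomp Require Import all_classical all_reals all_analysis.
From mathcomp Require Import measurable_realfun.
From mathcomp Require Import ring lra.

Set Implicit Arguments.
Unset Strict Implicit.
Unset Printing Implicit Defensive.

Import Order.TTheory GRing.Theory Num.Theory.

Local Open Scope classical_set_scope.
Local Open Scope ring_scope.

(* A row of sum 0 belongs to a terminal state, i.e. one without an enabled
   action. *)
Record markov_chain (n : nat) := MarkovChain {
  init : 'I_n;
  trans : 'M[rat]_n;
  trans_ge0 : forall s t, 0 <= trans s t;
  trans_sum : forall s, \sum_t trans s t = 0 \/ \sum_t trans s t = 1 }.

Definition terminal n (M : markov_chain n) (s : 'I_n) : bool :=
  [forall t, trans M s t == 0].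

Definition reachable n (M : markov_chain n) (s : 'I_n) : bool :=
  connect (fun s t => 0 < trans M s t) (init M) s.

(* A maximal path that ends in a terminal state is padded with [None], so that
   finite and infinite maximal paths are all sequences over [option 'I_n]. *)
Definition path_step n (M : markov_chain n) (x y : option 'I_n) : rat :=
  match x, y with
  | Some s, Some t => trans M s t
  | Some s, None => (terminal M s)%:R
  | None, Some _ => 0
  | None, None => 1
  end.

Fixpoint path_weight n (M : markov_chain n) (x : option 'I_n)
    (u : seq (option 'I_n)) : rat :=
  if u is y :: u' then path_step M x y * path_weight M y u' else 1.

Definition cylinder n (u : seq (option 'I_n)) : set (nat -> option 'I_n) :=
  [set w | mkseq w (size u) = u].

Definition path_space n : measurableType (range (@cylinder n)).-sigma :=
  g_sigma_algebraType (range (@cylinder n)).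

(* These equations determine [P]; they give probability 0 to the sequences that
   are not (padded) maximal paths from the initial state. *)
Definition is_path_measure (R : realType) n (M : markov_chain n)
    (P : probability (path_space n) R) : Prop :=
  forall u : seq (option 'I_n),
    P (cylinder (Some (init M) :: u)) = (ratr (path_weight M (Some (init M)) u))%:E.

(* Chain trajectories as functions of a point of [0, 1[: split the interval into
   pieces of lengths [K s t], move to the [t] whose piece contains the point, and
   rescale that piece to [0, 1[. *)
Section coding.
Variables (R : realType) (A : finType) (K : A -> A -> R).
Hypothesis K_ge0 : forall s t, 0 <= K s t.
Hypothesis K_sum : forall s, \sum_t K s t = 1.

Let cum s (t : A) := \sum_(v | (enum_rank v < enum_rank t)%N) K s v.

Let in_piece s (u : R) t := (cum s t <= u) && (u < cum s t + K s t).

Let nxt s u := odflt s [pick t | in_piece s u t].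

Let next_pos (x : A * R) :=
  let t := nxt x.1 x.2 in (t, (x.2 - cum x.1 t) / K x.1 t).

Let traj s u k := (iter k next_pos (s, u)).1.

Let cum_ge0 s t : 0 <= cum s t.
Proof. by apply: sumr_ge0. Qed.

Let cumS s t : cum s t + K s t = \sum_(v | (enum_rank v <= enum_rank t)%N) K s v.
Proof.
rewrite [RHS](bigD1 t) //= addrC; congr (_ + _).
apply: eq_bigl => v; rewrite ltn_neqAle andbC; congr (_ && _).
by rewrite (inj_eq (@ord_inj _)) (inj_eq enum_rank_inj).
Qed.

Let cumS_le1 s t : cum s t + K s t <= 1.
Proof.
rewrite cumS -(K_sum s) [leRHS](bigID (fun v => enum_rank v <= enum_rank t)%N) /=.
by rewrite lerDl; apply: sumr_ge0.
Qed.

Let cum_lt s t t' : (enum_rank t < enum_rank t')%N -> cum s t + K s t <= cum s t'.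
Proof.
move=> tt'; rewrite cumS /cum.
rewrite [leRHS](bigID (fun v => enum_rank v <= enum_rank t)%N) /=.
rewrite [X in _ <= X + _](eq_bigl (fun v => (enum_rank v <= enum_rank t)%N)).
  by rewrite lerDl; apply: sumr_ge0.
move=> v; have [H|H] := ssrnat.leqP (enum_rank v) (enum_rank t).
  by rewrite (leq_ltn_trans H tt').
by rewrite andbF.
Qed.

Let piece_unique s u t t' : in_piece s u t -> in_piece s u t' -> t = t'.
Proof.
move=> /andP[a b] /andP[c d].
have [H|H|H] := ssrnat.ltngtP (enum_rank t) (enum_rank t').
- by exfalso; have := cum_lt s H; lra.
- by exfalso; have := cum_lt s H; lra.
- exact/enum_rank_inj/ord_inj.
Qed.

Let nxtP s u t : in_piece s u t -> nxt s u = t.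
Proof.
move=> H; rewrite /nxt; case: pickP => [t' H'|/(_ t)]; last by rewrite H.
exact: piece_unique H' H.
Qed.

Let piece_ex s u : 0 <= u < 1 -> exists t, in_piece s u t.
Proof.
move=> u01.
have [t0 _] : exists t0 : A, true.
  case: (pickP (fun _ : A => true)) => [t _|H]; first by exists t.
  by have := K_sum s; rewrite big_pred0 // => /esym/eqP; rewrite oner_eq0.
pose P (t : A) := u < cum s t + K s t.
have [t1 Pt1] : exists t, P t.
  case: (@arg_maxnP A t0 xpredT (fun v => nat_of_ord (enum_rank v)) isT) => t _ tmax.
  exists t; rewrite /P cumS (eq_bigl xpredT) ?K_sum; first by case/andP: u01.
  by move=> v; apply: (tmax v isT).
case: (arg_minnP (fun t => nat_of_ord (enum_rank t)) Pt1) => t Pt tmin.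
exists t; rewrite /in_piece [X in _ && X]Pt andbT leNgt; apply/negP => ut.
case: (posnP (enum_rank t)) => [t0'|tpos].
  move: ut; rewrite /cum big_pred0 => [|v]; last by rewrite t0' ltn0.
  by rewrite ltNge; case/andP: u01 => ->.
pose t' := enum_val (Ordinal (leq_ltn_trans (leq_pred _) (ltn_ord (enum_rank t)))).
have : P t'.
  rewrite /P cumS enum_valK /=; apply: lt_le_trans ut _.
  rewrite /cum le_eqVlt; apply/orP; left; apply/eqP; apply: eq_bigl => v.
  by rewrite -[RHS]ltnS prednK.
by move/tmin; rewrite enum_valK /= leqNgt ltn_predL tpos.
Qed.

Let nxt_piece s u : 0 <= u < 1 -> in_piece s u (nxt s u).
Proof. by move=> /(piece_ex s)[t H]; rewrite (nxtP H). Qed.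

Fixpoint kernel_weight s (w : seq A) : R :=
  if w is t :: w' then K s t * kernel_weight t w' else 1.

Let kw_ge0 s w : 0 <= kernel_weight s w.
Proof. by elim: w s => //= t w IH s; rewrite mulr_ge0. Qed.

Let trajS s u k : traj s u k.+1 =
  traj (nxt s u) ((u - cum s (nxt s u)) / K s (nxt s u)) k.
Proof. by rewrite /traj iterSr. Qed.

Let coding_itv w s : exists a, [/\ 0 <= a, a + kernel_weight s w <= 1 &
  forall u, 0 <= u < 1 ->
    (mkseq (traj s u) (size w).+1 == s :: w) = (a <= u < a + kernel_weight s w)].
Proof.
elim: w s => [|t w IH] s.
  by exists 0; rewrite add0r; split => //= u -> ; rewrite eqxx.
have [a [a0 a1 H]] := IH t.
have W0 := kw_ge0 t w.
have shift u : mkseq (traj s u) (size w).+2 =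
    s :: mkseq (traj (nxt s u) ((u - cum s (nxt s u)) / K s (nxt s u))) (size w).+1.
  rewrite /mkseq -[LHS]/(s :: [seq traj s u i | i <- iota (1 + 0) (size w).+1]).
  by rewrite iotaDl -map_comp; congr (_ :: _); apply: eq_map => k; exact: trajS.
have hd v u : mkseq (traj v u) (size w).+1 == t :: w -> v = t.
  by rewrite /mkseq /= eqseq_cons => /andP[/eqP].
have [K0|Kn0] := eqVneq (K s t) 0.
  exists 0; rewrite /= K0 mul0r addr0; split=> // u u01.
  rewrite shift eqseq_cons eqxx /=.
  rewrite [RHS](_ : _ = false); last by apply/negbTE; lra.
  apply/negbTE/negP => /hd Ht; have := nxt_piece s u01.
  by rewrite /in_piece Ht K0; lra.
have Kp : 0 < K s t by rewrite lt_neqAle eq_sym Kn0 K_ge0.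
have C0 := cum_ge0 s t; have C1 := cumS_le1 s t.
exists (cum s t + K s t * a) => /=; split.
- by rewrite addr_ge0 // mulr_ge0.
- have := ler_wpM2l (K_ge0 s t) a1; lra.
move=> u u01; rewrite shift eqseq_cons eqxx /=.
have E : (cum s t + K s t * a <= u < cum s t + K s t * a + K s t * kernel_weight t w)
       = (a <= (u - cum s t) / K s t < a + kernel_weight t w).
  rewrite ler_pdivlMr // ltr_pdivrMr // lerBrDl ltrBlDl.
  by rewrite [a * _]mulrC [(a + _) * _]mulrC mulrDr addrA.
rewrite E; apply/idP/idP.
  move=> m; have Ht := hd _ _ m; move: m; rewrite Ht H //.
  have := nxt_piece s u01; rewrite Ht /in_piece => /andP[p q].
  by rewrite divr_ge0 ?subr_ge0 //= ltr_pdivrMr // mul1r ltrBlDl.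
move=> m; have mm := m; move: mm => /andP[m1 m2].
have h : 0 <= (u - cum s t) / K s t < 1 by lra.
have -> : nxt s u = t.
  apply: nxtP; move: h; rewrite /in_piece ler_pdivlMr // mul0r ltr_pdivrMr // mul1r.
  by rewrite subr_ge0 ltrBlDl.
by rewrite H.
Qed.

Lemma kernel_coding s : exists X : R -> nat -> A,
  forall w, exists a : R, [/\ 0 <= a, a + kernel_weight s w <= 1 &
    forall u : R, 0 <= u < 1 ->
      (mkseq (X u) (size w).+1 == s :: w) = (a <= u < a + kernel_weight s w)].
Proof. by exists (traj s) => w; exact: coding_itv. Qed.

End coding.


Section path_measure_existence.
Variables (R : realType) (n : nat) (M : markov_chain n).

Let K x y : R := ratr (path_step M x y).

Let K_ge0 x y : 0 <= K x y.
Proof.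
rewrite ler0q; case: x y => [s|] [t|] //=; first exact: trans_ge0.
Qed.

Let K_sum x : \sum_y K x y = 1.
Proof.
rewrite -rmorph_sum -[RHS](rmorph1 (@ratr R)); congr ratr.
rewrite (bigD1 None) //= (reindex_omap Some id) /=; last by case.
rewrite (eq_bigl xpredT); last by move=> s; rewrite /= eqxx.
case: x => [s|] /=; last by rewrite big1 ?addr0.
have [/forallP st|/forallPn[t nt]] := boolP (terminal M s).
  by rewrite big1 ?addr0 // => t _; exact/eqP.
rewrite add0r; case: (trans_sum M s) => // /eqP.
rewrite psumr_eq0 => [|t' _]; last exact: trans_ge0.
by move=> /allP/(_ t); rewrite mem_index_enum (negbTE nt) => /(_ isT).
Qed.

Let K_weight x u : kernel_weight K x u = ratr (path_weight M x u).
Proof. by elim: u x => [|y u IH] x /=; rewrite ?rmorph1 // rmorphM IH. Qed.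

Let weight_ge0 x u : 0 <= ratr (path_weight M x u) :> R.
Proof.
rewrite -K_weight; elim: u x => [|y u IH] x //=; exact: mulr_ge0.
Qed.

Lemma path_measure_exists :
  exists P : probability (path_space n) R, is_path_measure M P.
Proof.
have [X XP] := kernel_coding K_ge0 K_sum (Some (init M)).
pose g (u : measurableTypeR R) : measurableTypeR R := if 0 <= u < 1 then u else 0.
have g01 u : 0 <= g u < 1 by rewrite /g; case: ifP => //; rewrite lexx ltr01.
pose f (u : measurableTypeR R) : path_space n := X (g u).
have mg : measurable_fun setT g.
  apply: measurable_fun_if => //.
  by apply: measurable_and => //; [exact: measurable_fun_ler|exact: measurable_fun_ltr].
have X0 u : 0 <= u < 1 -> X u 0%N = Some (init M).
  move=> u01; have [a [a0 /= a1 /(_ _ u01)]] := XP [::].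
  rewrite /= /mkseq /= => H; have : [:: X u 0%N] == [:: Some (init M)].
    by rewrite H; move: u01; lra.
  by rewrite eqseq_cons => /andP[/eqP].
have cylE w : exists a, [/\ 0 <= a, a + kernel_weight K (Some (init M)) w <= 1 &
    f @^-1` cylinder (Some (init M) :: w) =
    g @^-1` `[a, a + kernel_weight K (Some (init M)) w[%classic].
  have [a [a0 a1 H]] := XP w; exists a; split=> //.
  apply/seteqP; split => u /=; rewrite /cylinder /= in_itv /= -(H _ (g01 u)).
    by move/eqP.
  by move/eqP.
have mf : measurable_fun setT f.
  apply: (@measurability _ _ _ (path_space n) setT f (range (@cylinder n))) => // _ [_ [v _ <-] <-].
  case: v => [|x w].
    by rewrite (_ : cylinder [::] = setT) ?preimage_setT ?setIT //; apply/seteqP.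
  have [->|xi] := eqVneq x (Some (init M)).
    by have [a [_ _ ->]] := cylE w; apply: mg.
  rewrite (_ : f @^-1` _ = set0) ?setI0 //; apply/seteqP; split => // u /=.
  by rewrite /cylinder /mkseq /= => -[]; rewrite /f X0 // => /eqP; rewrite eq_sym (negbTE xi).
pose f' : {mfun measurableTypeR R >-> path_space n} := mfun_Sub (mem_set mf).
pose mu := mrestr (@lebesgue_measure R) (measurable_itv `[0, 1[).
have muT : mu setT = 1%E.
  by rewrite /mu /mrestr setTI lebesgue_measure_itv /= lte_fin ltr01 oppr0 adde0.
exists (distribution (mnormalize mu (\d_(0 : measurableTypeR R))) f') => u.
have [a [a0 a1 E]] := cylE u.
have nE B : mnormalize mu (\d_(0 : measurableTypeR R)) B = mu B.
  rewrite /mnormalize /= (_ : mrestr _ _ _ = 1%E) ?onee_eq0 /= ?invr1 ?mule1 //; exact: muT.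
transitivity (mu (f @^-1` cylinder (Some (init M) :: u))); first exact: nE.
rewrite E -K_weight /mu /mrestr.
set W := kernel_weight _ _ _ in a1 *.
have W0 : 0 <= W by rewrite /W K_weight; exact: weight_ge0.
rewrite (_ : _ `&` _ = `[a, a + W[%classic).
  rewrite lebesgue_measure_itv /= lte_fin ltrDl.
  move: W0; rewrite le_eqVlt => /orP[/eqP<-|->]; first by rewrite ltxx.
  by rewrite -EFinB addrAC subrr add0r.
apply/seteqP; split=> v /=; rewrite !in_itv /= /g.
  by move=> [+ vI]; rewrite vI.
by move=> H; rewrite (_ : (0 <= v < 1) = true) //; lra.
Qed.

End path_measure_existence.

Definition path_measure (R : realType) n (M : markov_chain n) :
    probability (path_space n) R :=
  projT1 (cid (path_measure_exists R M)).

Lemma path_measureP (R : realType) n (M : markov_chain n) :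
  is_path_measure M (path_measure R M).
Proof. exact: (projT2 (cid (path_measure_exists R M))). Qed.

Definition Pr (R : realType) n (M : markov_chain n)
    (A : set (nat -> option 'I_n)) : R :=
  fine (path_measure R M A).

Definition condPr (R : realType) n (M : markov_chain n)
    (A B : set (nat -> option 'I_n)) : R :=
  Pr R M (A `&` B) / Pr R M B.

Definition eventually n (T : {set 'I_n}) : set (nat -> option 'I_n) :=
  [set w | exists k, exists2 s, w k = Some s & s \in T].

Definition not_until n (X : {set 'I_n}) (c : 'I_n) : set (nat -> option 'I_n) :=
  [set w | exists2 k, w k = Some c &
           forall j s, (j < k)%N -> w j = Some s -> s \notin X].

Definition SPR_cause (R : realType) n (M : markov_chain n)
    (Eff Cause : {set 'I_n}) : Prop :=
  [/\ exists c, c \in Cause,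
      forall c, c \in Cause -> c \notin Eff &
      forall c, c \in Cause ->
        0 < Pr R M (not_until Cause c) /\
        condPr R M (eventually Eff) (not_until Cause c)
          > Pr R M (eventually Eff)].

Definition tp (R : realType) n (M : markov_chain n) (Eff Cause : {set 'I_n}) : R :=
  Pr R M (eventually Cause `&` eventually Eff).

Definition fp (R : realType) n (M : markov_chain n) (Eff Cause : {set 'I_n}) : R :=
  Pr R M (eventually Cause `&` ~` eventually Eff).

Definition fn (R : realType) n (M : markov_chain n) (Eff Cause : {set 'I_n}) : R :=
  Pr R M (~` eventually Cause `&` eventually Eff).

Definition fscore (R : realType) n (M : markov_chain n)
    (Eff Cause : {set 'I_n}) : R :=
  2 * tp R M Eff Cause /
    (2 * tp R M Eff Cause + fp R M Eff Cause + fn R M Eff Cause).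

Definition fscore_optimal (R : realType) n (M : markov_chain n)
    (Eff Cause : {set 'I_n}) : Prop :=
  SPR_cause R M Eff Cause /\
  forall Cause', SPR_cause R M Eff Cause' ->
    fscore R M Eff Cause' <= fscore R M Eff Cause.

(* Random access machine with integer registers and an integer memory, under
   the logarithmic cost criterion: a step costs 1 plus the bit lengths of its
   operands, addresses included.  Programs are structured (no jumps); each one
   mentions finitely many registers, and the memory is accessed only through
   addresses held in registers. *)
Inductive arith_op := Add | Sub | Mul | Div.

Inductive program :=
  | Skip
  | Const of nat & int
  | Arith of arith_op & nat & nat & nat
  | MemRead of nat & nat
  | MemWrite of nat & nat
  | Seq of program & program
  | IfPos of nat & program & program
  | WhilePos of nat & program.

Record ram_state := RamState { regs : nat -> int; memory : nat -> int }.

Definition update (f : nat -> int) (i : nat) (v : int) : nat -> int :=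
  fun j => if j == i then v else f j.

Definition eval_op (o : arith_op) (x y : int) : int :=
  match o with
  | Add => x + y
  | Sub => x - y
  | Mul => x * y
  | Div => (x %/ y)%Z
  end.

Definition bit_length (z : int) : nat := (trunc_log 2 `|z|%N).+1.

(* [exec p st st' c]: [p] halts from [st] in [st'] at total cost [c].  A memory
   access at a negative address has no transition. *)
Inductive exec : program -> ram_state -> ram_state -> nat -> Prop :=
  | exec_skip st : exec Skip st st 1
  | exec_const st r z :
      exec (Const r z) st (RamState (update (regs st) r z) (memory st))
        (1 + bit_length z)%N
  | exec_arith st o r a b :
      exec (Arith o r a b) st
        (RamState (update (regs st) r (eval_op o (regs st a) (regs st b)))
           (memory st))
        (1 + bit_length (regs st a) + bit_length (regs st b))%N
  | exec_read st r a (i : nat) :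
      regs st a = i%:Z ->
      exec (MemRead r a) st
        (RamState (update (regs st) r (memory st i)) (memory st))
        (1 + bit_length i + bit_length (memory st i))%N
  | exec_write st a r (i : nat) :
      regs st a = i%:Z ->
      exec (MemWrite a r) st
        (RamState (regs st) (update (memory st) i (regs st r)))
        (1 + bit_length i + bit_length (regs st r))%N
  | exec_seq p1 p2 st1 st2 st3 c1 c2 :
      exec p1 st1 st2 c1 -> exec p2 st2 st3 c2 ->
      exec (Seq p1 p2) st1 st3 (c1 + c2)%N
  | exec_if_pos r p1 p2 st st' c :
      0 < regs st r -> exec p1 st st' c ->
      exec (IfPos r p1 p2) st st' (1 + bit_length (regs st r) + c)%N
  | exec_if_npos r p1 p2 st st' c :
      regs st r <= 0 -> exec p2 st st' c ->
      exec (IfPos r p1 p2) st st' (1 + bit_length (regs st r) + c)%N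
  | exec_while_stop r p st :
      regs st r <= 0 ->
      exec (WhilePos r p) st st (1 + bit_length (regs st r))%N
  | exec_while_step r p st1 st2 st3 c1 c2 :
      0 < regs st1 r -> exec p st1 st2 c1 -> exec (WhilePos r p) st2 st3 c2 ->
      exec (WhilePos r p) st1 st3 (1 + bit_length (regs st1 r) + c1 + c2)%N.

Definition initial_state (x : seq int) : ram_state :=
  RamState (fun=> 0) (fun i => nth 0 x i).

Definition word_size (x : seq int) : nat := (\sum_(z <- x) bit_length z)%N.

Definition computes_within (p : program) (x y : seq int) (c : nat) : Prop :=
  exists st c', [/\ exec p (initial_state x) st c', (c' <= c)%N &
    forall i, (i < size y)%N -> memory st i = nth 0 y i].

Definition encode_set n (T : {set 'I_n}) : seq int :=
  [seq (s \in T)%:Z | s <- enum 'I_n].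

(* Probabilities enter in lowest terms, as binary numerator and denominator. *)
Definition encode_instance n (M : markov_chain n) (Eff : {set 'I_n}) : seq int :=
  [:: n%:Z, (val (init M))%:Z
    & flatten [seq [:: numq (trans M s t); denq (trans M s t)]
              | s <- enum 'I_n, t <- enum 'I_n]
      ++ encode_set Eff].

(* Main.v *)
(** The first state of a cause [X] that is visited determines everything: with [h]
    the probability of reaching [Eff], [a_X] the expectation of [h] at the first
    visit of [X] and [b_X] the probability of visiting [X], all taken at the initial
    state, the f-score is [2 a_X / (b_X + h)], and the SPR causes are the nonempty
    sets of states [c] with [h c > h], trimmed to the states that a path can visit
    first.  Maximising this ratio is a parametric optimal stopping problem with
    reward [2 h - l] on stopping, where [l] is the optimal f-score.  As [l] grows
    stopping becomes less attractive, so starting from all candidates one may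
    discard, for [l] the f-score of the current set [X], every state where going on
    to the next visit of [X] beats stopping: such a state does not belong to the
    optimal stopping set for the optimal [l] either.  After at most [n] rounds
    nothing is discarded and stopping at [X] is superharmonic, hence optimal.

    Each round solves linear systems [D (I - Q)] with integer entries.  The
    Faddeev-LeVerrier recursion does this with matrix products and exact divisions
    only, without pivoting, and the bit lengths grow linearly along the recursion. *)

Require Import Defs.
From mathcomp Require Import all_boot all_order all_algebra.
From mathcomp Require Import all_classical all_reals all_analysis.
From mathcomp Require Import zify ring lra.

Set Implicit Arguments.
Unset Strict Implicit.
Unset Printing Implicit Defensive.

Import Order.TTheory GRing.Theory Num.Theory.
Import numFieldNormedType.Exports.

Local Open Scope ring_scope.

(** * Random access machines *)

(** The machine charges for bit lengths, so counting operations is not enough: a multiplication may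
    double the length of a number, and repeating it [n] times would be exponential. The cost of a
    command is therefore computed from the numbers actually stored, whose sizes are then bounded by
    the mathematics. Each step of the recursion adds a fixed number of bits, and from one pruning
    round to the next only a set of zeros and ones changes; the multiplier is never stored, and [h]
    is computed once. As one polynomial has to serve all chains, bounds are stated for families of
    instances and, inside a loop, for families of pairs of an instance and a round. On the
    probabilistic side, the Markov property turns the conditional probability of the effect, given
    that [c] is visited first, into [h c], whatever the rest of the cause. Expectations at a first
    visit are characterised by harmonicity off the target together with the value 0 where the target
    cannot be reached. A maximum principle then gives their uniqueness, the invertibility of the
    linear systems and the optional stopping inequality. *)

Definition small (W : nat) (z : int) : Prop := (`|z| < 2 ^ W)%N.

Lemma small_leq V W z : (V <= W)%N -> small V z -> small W z.
Proof. by move=> VW zV; apply: leq_trans zV _; rewrite leq_exp2l. Qed.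

Lemma bit_length_small z : small (bit_length z) z.
Proof. exact: trunc_log_ltn. Qed.

Lemma small_bit_length W z : (0 < W)%N -> small W z -> (bit_length z <= W)%N.
Proof.
move=> W0 zW; rewrite /bit_length; case: (posnP `|z|%N) => [->|z0]; first by rewrite trunc_log0.
by rewrite -(@ltn_exp2l 2) //; apply: leq_ltn_trans zW; apply: trunc_logP.
Qed.

Lemma small_nat W (m : nat) : (m <= W)%N -> small W m%:Z.
Proof. by move=> mW; apply: leq_ltn_trans mW (ltn_expl _ _). Qed.

Lemma small_add V W x y : small V x -> small W y -> small (maxn V W).+1 (x + y).
Proof.
rewrite /small => xV yW; have : (absz (x + y)%R <= absz x + absz y)%N by lia.
have := leq_pexp2l (isT : (0 < 2)%N) (leq_maxl V W).
have := leq_pexp2l (isT : (0 < 2)%N) (leq_maxr V W).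
rewrite expnS; lia.
Qed.

Lemma small_mul V W x y : small V x -> small W y -> small (V + W) (x * y).
Proof.
rewrite /small => xV yW; rewrite abszM expnD.
case: (posnP `|y|%N) => [->|y0]; first by rewrite muln0 muln_gt0 !expn_gt0.
apply: (@leq_trans (2 ^ V * `|y|)%N); first by rewrite ltn_pmul2r.
by rewrite leq_mul2l (ltnW yW) orbT.
Qed.

(** Rounding keeps the remainder nonnegative, so that [-1] divided by [2] gives [-1]; even so the
    quotient never exceeds the dividend in absolute value, and division by 0 gives 0. *)
Lemma small_div V x y : small V x -> small V (x %/ y)%Z.
Proof.
move=> xV; apply: leq_ltn_trans xV; have [->|y0] := eqVneq y 0; first by rewrite divz0.
have E := divz_eq x y; have := modz_ge0 x y0; have := ltz_mod x y0.
move: E; set q := (x %/ y)%Z; set r := (x %% y)%Z => E rlt r0.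
case: (ltgtP y 0) y0 => // ys _.
  have {}rlt : r < - y by lia.
  case: (ltgtP q 0) => qs; [|by nia|by rewrite qs; lia].
  have : x >= - q by nia.
  lia.
have {}rlt : r < y by lia.
case: (ltgtP q 0) => qs; [|by nia|by rewrite qs; lia].
have : x <= q by nia.
lia.
Qed.

(** One bound for all four operations, so that size estimates need not distinguish them. *)
Lemma small_op o V W x y : small V x -> small W y -> small (V + W).+1 (eval_op o x y).
Proof.
move=> xV yW; case: o => /=.
- by apply: small_leq (small_add xV yW); rewrite ltnS geq_max leq_addr leq_addl.
- apply: small_leq (small_add xV (_ : small W (- y))); last by rewrite /small abszN.
  by rewrite ltnS geq_max leq_addr leq_addl.
- exact: small_leq (leqnSn _) (small_mul xV yW).
- by apply: small_leq (small_div y xV); rewrite leqW // leq_addr.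
Qed.

(** * Total correctness of machine programs with cost bounds *)

Definition runs (p : program) (st : ram_state) (Q : ram_state -> Prop) (c : nat) : Prop :=
  exists st' c', [/\ exec p st st' c', (c' <= c)%N & Q st'].

Lemma runs_weaken p st (Q Q' : ram_state -> Prop) c c' :
  runs p st Q c -> (c <= c')%N -> (forall st', Q st' -> Q' st') -> runs p st Q' c'.
Proof.
move=> [st' [d [H dc q]]] cc' QQ'; exists st', d; split => //; last exact: QQ'.
exact: leq_trans cc'.
Qed.

Lemma runs_seq p1 p2 st Q1 Q2 c1 c2 c :
  runs p1 st Q1 c1 -> (forall st1, Q1 st1 -> runs p2 st1 Q2 c2) ->
  (c1 + c2 <= c)%N -> runs (Seq p1 p2) st Q2 c.
Proof.
move=> [st1 [d1 [H1 dc1 q1]]] H cc; have [st2 [d2 [H2 dc2 q2]]] := H _ q1.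
exists st2, (d1 + d2)%N; split => //; first exact: exec_seq H1 H2.
by apply: leq_trans cc; apply: leq_add.
Qed.

Definition set_reg (st : ram_state) r z := RamState (update (regs st) r z) (memory st).

Lemma runs_const r z st (Q : ram_state -> Prop) W c :
  (0 < W)%N -> small W z -> (W.+1 <= c)%N -> Q (set_reg st r z) -> runs (Const r z) st Q c.
Proof.
move=> W0 zW Wc q; eexists _, _; split; [exact: exec_const| |exact: q].
by rewrite add1n; apply: leq_trans Wc; rewrite ltnS; apply: small_bit_length.
Qed.

Lemma runs_arith o r a b st (Q : ram_state -> Prop) V W c :
  (0 < V)%N -> (0 < W)%N -> small V (regs st a) -> small W (regs st b) ->
  ((V + W).+1 <= c)%N ->
  Q (set_reg st r (eval_op o (regs st a) (regs st b))) -> runs (Arith o r a b) st Q c.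
Proof.
move=> V0 W0 aV bW Wc q; eexists _, _; split; [exact: exec_arith| |exact: q].
apply: leq_trans Wc; rewrite -addnA add1n ltnS.
by apply: leq_add; apply: small_bit_length.
Qed.

Lemma runs_read r a st (i : nat) (Q : ram_state -> Prop) V W c :
  (0 < V)%N -> (0 < W)%N -> regs st a = i%:Z -> small V i%:Z -> small W (memory st i) ->
  ((V + W).+1 <= c)%N ->
  Q (set_reg st r (memory st i)) -> runs (MemRead r a) st Q c.
Proof.
move=> V0 W0 ai aV bW Wc q; eexists _, _; split; [exact: exec_read ai| |exact: q].
apply: leq_trans Wc; rewrite -addnA add1n ltnS.
by apply: leq_add; apply: small_bit_length.
Qed.

Lemma runs_write r a st (i : nat) (Q : ram_state -> Prop) V W c :
  (0 < V)%N -> (0 < W)%N -> regs st a = i%:Z -> small V i%:Z -> small W (regs st r) ->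
  ((V + W).+1 <= c)%N ->
  Q (RamState (regs st) (update (memory st) i (regs st r))) -> runs (MemWrite a r) st Q c.
Proof.
move=> V0 W0 ai aV bW Wc q; eexists _, _; split; [exact: exec_write ai| |exact: q].
apply: leq_trans Wc; rewrite -addnA add1n ltnS.
by apply: leq_add; apply: small_bit_length.
Qed.

Lemma runs_if r p1 p2 st (Q : ram_state -> Prop) W c c' :
  (0 < W)%N -> small W (regs st r) -> ((W + c).+1 <= c')%N ->
  runs (if 0 < regs st r then p1 else p2) st Q c -> runs (IfPos r p1 p2) st Q c'.
Proof.
move=> W0 rW cc'; case: (ltP 0 (regs st r)) => r0 [st' [d [H dc q]]];
  exists st', (1 + bit_length (regs st r) + d)%N; split => //.
- exact: exec_if_pos.
- by apply: leq_trans cc'; rewrite add1n addSn ltnS; apply: leq_add => //; apply: small_bit_length.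
- exact: exec_if_npos.
- by apply: leq_trans cc'; rewrite add1n addSn ltnS; apply: leq_add => //; apply: small_bit_length.
Qed.

(* Register 0 holds the dimension [n]; [v] runs through [0, ..., n - 1] and [t]
   is scratch, holding [n - v] whenever the guard is tested. *)
Definition for_loop (v t : nat) (body : program) : program :=
  Seq (Const v 0) (Seq (Arith Defs.Sub t 0 v)
    (WhilePos t (Seq body (Seq (Const t 1) (Seq (Arith Defs.Add v v t) (Arith Defs.Sub t 0 v)))))).

Lemma updateE f i v j : update f i v j = if j == i then v else f j.
Proof. by []. Qed.

(** At most [W] rounds, each with [W + 1] for the test and [3 * W + 5] for the update of counter and
    guard; then [2 * W + 3] for the initialisation and [W + 1] for the last test. *)
Definition loop_overhead (W : nat) : nat := (W * (4 * W + 6) + 3 * W + 4)%N.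

(** The loop itself writes [v] and [t] between two runs of the body, so the invariant has to survive
    such writes. The body must preserve [v] and register 0 but may destroy [t], which is
    recomputed. *)
Lemma runs_for (n W v t : nat) body (c : nat -> nat) (I : nat -> ram_state -> Prop) st :
  (0 < W)%N -> (n <= W)%N -> v != t -> (0 < v)%N -> (0 < t)%N ->
  (forall i st r z, r = v \/ r = t -> I i st -> I i (set_reg st r z)) ->
  (forall i st, (i < n)%N -> I i st -> regs st 0 = n -> regs st v = i ->
     runs body st (fun st' => [/\ I i.+1 st', regs st' 0 = n & regs st' v = i]) (c i)) ->
  I 0%N st -> regs st 0 = n ->
  runs (for_loop v t body) st (fun st' => I n st' /\ regs st' 0 = n)
    (\sum_(i < n) c i + loop_overhead W)%N.
Proof.
move=> W0 nW vt v0 t0 stab Hb I0 R0.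
have one : small W 1 by apply: (@small_nat _ 1).
have [ntv n0v n0t] : [/\ (t == v) = false, (0%N == v) = false & (0%N == t) = false].
  by split; apply/negbTE; rewrite eq_sym // -lt0n.
pose J i st := [/\ I i st, regs st 0 = n, regs st v = i & regs st t = n%:Z - i%:Z].
have loop m i st1 : (i + m = n)%N -> J i st1 ->
    runs (WhilePos t (Seq body (Seq (Const t 1) (Seq (Arith Defs.Add v v t) (Arith Defs.Sub t 0 v)))))
      st1 (fun st' => I n st' /\ regs st' 0 = n)
      (\sum_(i <= k < n) c k + (m * (4 * W + 6) + W.+1))%N.
  elim: m i st1 => [|m IH] i st1 im [Ii Hn Hv Ht].
    have {}im : i = n by rewrite -im addn0.
    subst i; eexists _, _; split; [apply: exec_while_stop| |by split; [exact: Ii|]].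
      by rewrite Ht subrr.
    rewrite Ht subrr big_geq // mul0n !add0n add1n ltnS.
  have ilt : (i < n)%N by rewrite -im addnS ltnS leq_addr.
  have [st2 [d1 [E1 dc1 [I2 N2 V2]]]] := Hb i st1 ilt Ii Hn Hv.
  have : runs (Seq (Const t 1) (Seq (Arith Defs.Add v v t) (Arith Defs.Sub t 0 v))) st2
      (J i.+1) (3 * W + 5)%N.
    apply: (runs_seq (c1 := 2) (c2 := (3 * W + 3)%N)
              (Q1 := fun st => [/\ I i.+1 st, regs st 0 = n, regs st v = i & regs st t = 1])).
    - apply: (runs_const (W := 1)) => //; split.
      + by apply: stab I2; right.
      + by rewrite /= updateE n0t.
      + by rewrite /= updateE (negbTE vt).
      + by rewrite /= updateE eqxx.
    - move=> st3 [I3 N3 V3 T3].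
      apply: (runs_seq (c1 := W.+2) (c2 := (2 * W + 1)%N)
              (Q1 := fun st => [/\ I i.+1 st, regs st 0 = n & regs st v = i.+1])).
      + apply: (runs_arith (V := W) (W := 1)) => //.
        * by rewrite V3; apply: small_nat; apply: ltnW; apply: leq_trans nW.
        * by rewrite T3.
        * by rewrite addn1.
        * split; first by apply: stab I3; left.
            by rewrite /= updateE n0v.
          by rewrite /= updateE eqxx V3 T3 -PoszD addn1.
      + move=> st4 [I4 N4 V4]; apply: (runs_arith (V := W) (W := W)) => //.
        * by rewrite N4; apply: small_nat.
        * by rewrite V4; apply: small_nat; apply: leq_trans nW.
        * lia.
        * split; first by apply: stab I4; right.
          - by rewrite /= updateE n0t.
          - by rewrite /= updateE (negbTE vt).
          - by rewrite /= updateE eqxx N4 V4.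
      + lia.
    - lia.
  move=> [st3 [d2 [E2 dc2 J3]]].
  have [] := IH i.+1 st3 _ J3; first by rewrite addSnnS.
  move=> st4 [d3 [E3 dc3 Q4]]; exists st4; eexists; split; last exact: Q4.
    apply: exec_while_step E3; last exact: exec_seq E1 E2.
    by rewrite Ht subr_gt0 ltz_nat.
  have : (bit_length (regs st1 t) <= W)%N.
    apply: small_bit_length => //; rewrite Ht subzn ?(ltnW ilt) //.
    by apply: small_nat; apply: leq_trans nW; rewrite leq_subr.
  rewrite big_ltn //; lia.
apply: (runs_seq (c1 := 2) (c2 := (\sum_(i < n) c i + (n * (4 * W + 6) + W.+1) + (2 * W + 1))%N)
              (Q1 := fun st => [/\ I 0%N st, regs st 0 = n & regs st v = 0])).
- apply: (runs_const (W := 1)) => //; split.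
  + by apply: stab I0; left.
  + by rewrite /= updateE n0v.
  + by rewrite /= updateE eqxx.
- move=> st1 [I1 N1 V1].
  apply: (runs_seq (c1 := (2 * W + 1)%N) (c2 := (\sum_(i < n) c i + (n * (4 * W + 6) + W.+1))%N)
              (Q1 := J 0%N)).
  + apply: (runs_arith (V := W) (W := W)) => //.
    * by rewrite N1; apply: small_nat.
    * by rewrite V1; apply: (@small_nat _ 0).
    * lia.
    * split; first by apply: stab I1; right.
      - by rewrite /= updateE n0t.
      - by rewrite /= updateE (negbTE vt).
      - by rewrite /= updateE eqxx N1 V1.
  + move=> st2 J2; rewrite -(big_mkord xpredT c); exact: loop.
  + lia.
- rewrite /loop_overhead; have := leq_mul nW (leqnn (4 * W + 6)); lia.
Qed.

(** * A language of matrix programs and its compilation *)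

(** Address arithmetic is kept apart from [expr]: its values are natural numbers, as memory accesses
    demand, and do not depend on the data. *)
Inductive iexp :=
  | ICst of nat
  | IDim
  | IVar of nat
  | IAdd of iexp & iexp
  | IMul of iexp & iexp.

(* Variables are de Bruijn levels: [EBig] binds the variable whose number is the
   current depth. *)
Inductive expr :=
  | ECst of int
  | EIdx of nat
  | EIn of iexp
  | ERead of nat & nat & nat
  | EOp of arith_op & expr & expr
  | EIf of expr & expr & expr
  | EBig of bool & expr.

(** The only loop makes exactly [n] rounds. This is enough for reachability, for the
    Faddeev-LeVerrier recursion and for pruning, and it makes termination automatic. *)
Inductive cmd :=
  | CSet of nat & expr
  | CSeq of cmd & cmd
  | CIter of cmd.

Fixpoint ieval (n : nat) (v : nat -> nat) (e : iexp) : nat :=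
  match e with
  | ICst m => m
  | IDim => n
  | IVar l => v l
  | IAdd a b => (ieval n v a + ieval n v b)%N
  | IMul a b => (ieval n v a * ieval n v b)%N
  end.

Definition bind T (env : nat -> T) (d : nat) (x : T) : nat -> T :=
  fun l => if l == d then x else env l.

Definition store n := nat -> 'M[int]_n.

Section semantics.
Variables (n : nat) (inp : nat -> int).

Fixpoint eval (s : store n) (env : nat -> 'I_n) (d : nat) (e : expr) : int :=
  match e with
  | ECst z => z
  | EIdx l => (env l : nat)%:Z
  | EIn ie => inp (ieval n (fun l => env l) ie)
  | ERead k x y => s k (env x) (env y)
  | EOp o a b => eval_op o (eval s env d a) (eval s env d b)
  | EIf c a b => if 0 < eval s env d c then eval s env d a else eval s env d b
  | EBig o a => if o then \prod_(v < n) eval s (bind env d v) d.+1 a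
                else \sum_(v < n) eval s (bind env d v) d.+1 a
  end.

(** Levels 0 and 1 are the row and the column; under [wf 2] a higher level is read only below its
    binder, so its default value is harmless. *)
Definition ij_env (i j : 'I_n) : nat -> 'I_n := fun l => if l is 0 then i else j.

Definition set_array (s : store n) k M : store n := fun k' => if k' == k then M else s k'.

Definition eval_mx (s : store n) (e : expr) : 'M[int]_n :=
  \matrix_(i, j) eval s (ij_env i j) 2 e.

Fixpoint run (c : cmd) (s : store n) : store n :=
  match c with
  | CSet k e => set_array s k (eval_mx s e)
  | CSeq c1 c2 => run c2 (run c1 s)
  | CIter c1 => iter n (run c1) s
  end.

End semantics.

(** * Memory layout and compilation *)

Definition input_size (n : nat) : nat := (2 + 2 * (n * n) + n)%N.

Definition num_arrays : nat := 16.

(** The arrays are interleaved behind the input: the offset modulo [num_arrays] is the number of the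
    array, the quotient is the position in row-major order. *)
Definition array_cell (n k i j : nat) : nat :=
  (k + (input_size n + num_arrays * (i * n + j)))%N.

Definition array_iexp (k x y : nat) : iexp :=
  IAdd (ICst k)
    (IAdd (IAdd (IAdd (ICst 2) (IMul (ICst 2) (IMul IDim IDim))) IDim)
       (IMul (ICst num_arrays) (IAdd (IMul (IVar x) IDim) (IVar y)))).

(** Register 0 is reserved for the dimension, odd registers hold bound variables, and positive even
    ones form a stack of temporaries. *)
Definition vreg (l : nat) : nat := (2 * l + 1)%N.
Definition treg (r : nat) : nat := (2 * r + 2)%N.

Fixpoint icompile (r : nat) (e : iexp) : program :=
  match e with
  | ICst m => Const (treg r) m
  | IDim => Seq (Const (treg r) 0) (Arith Defs.Add (treg r) (treg r) 0)
  | IVar l => Seq (Const (treg r) 0) (Arith Defs.Add (treg r) (treg r) (vreg l))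
  | IAdd a b => Seq (icompile r a)
      (Seq (icompile r.+1 b) (Arith Defs.Add (treg r) (treg r) (treg r.+1)))
  | IMul a b => Seq (icompile r a)
      (Seq (icompile r.+1 b) (Arith Defs.Mul (treg r) (treg r) (treg r.+1)))
  end.

Definition big_op (o : bool) : arith_op := if o then Defs.Mul else Defs.Add.

(** The value lands in [treg r]; only bound variables from level [d] on and temporaries from [r] on
    are overwritten. In the case [EBig], reading [o] as 0 or 1 gives the neutral element of the sum
    or product. *)
Fixpoint compile (d r : nat) (e : expr) : program :=
  match e with
  | ECst z => Const (treg r) z
  | EIdx l => icompile r (IVar l)
  | EIn ie => Seq (icompile r ie) (MemRead (treg r) (treg r))
  | ERead k x y => Seq (icompile r (array_iexp k x y)) (MemRead (treg r) (treg r))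
  | EOp o a b => Seq (compile d r a)
      (Seq (compile d r.+1 b) (Arith o (treg r) (treg r) (treg r.+1)))
  | EIf c a b => Seq (compile d r c) (IfPos (treg r) (compile d r a) (compile d r b))
  | EBig o a => Seq (Const (treg r) (o : nat))
      (for_loop (vreg d) (treg r.+1)
         (Seq (compile d.+1 r.+2 a) (Arith (big_op o) (treg r) (treg r) (treg r.+2))))
  end.

(** Iteration counters live among the temporaries, because every assignment inside the loop
    overwrites [vreg 0] and [vreg 1]. *)
Fixpoint compile_cmd (r : nat) (c : cmd) : program :=
  match c with
  | CSet k e => for_loop (vreg 0) (treg r) (for_loop (vreg 1) (treg r.+1)
      (Seq (compile 2 r.+2 e)
         (Seq (icompile r.+3 (array_iexp k 0 1)) (MemWrite (treg r.+3) (treg r.+2)))))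
  | CSeq c1 c2 => Seq (compile_cmd r c1) (compile_cmd r c2)
  | CIter c1 => for_loop (treg r) (treg r.+1) (compile_cmd r.+2 c1)
  end.

Fixpoint iwf (d : nat) (e : iexp) : bool :=
  match e with
  | IVar l => (l < d)%N
  | IAdd a b | IMul a b => iwf d a && iwf d b
  | _ => true
  end.

Definition input_iexp (e : iexp) : Prop :=
  forall n v, (forall l, v l < n)%N -> (ieval n v e < input_size n)%N.

Fixpoint wf (d : nat) (e : expr) : Prop :=
  match e with
  | ECst _ => True
  | EIdx l => (l < d)%N
  | EIn ie => iwf d ie /\ input_iexp ie
  | ERead k x y => [/\ k < num_arrays, x < d & y < d]%N
  | EOp _ a b => wf d a /\ wf d b
  | EIf c a b => [/\ wf d c, wf d a & wf d b]
  | EBig _ a => wf d.+1 a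
  end.

Fixpoint reads (e : expr) : seq nat :=
  match e with
  | ERead k _ _ => [:: k]
  | EOp _ a b => reads a ++ reads b
  | EIf c a b => reads c ++ reads a ++ reads b
  | EBig _ a => reads a
  | _ => [::]
  end.

(** An assignment is compiled to writes in place, entry by entry. If the right-hand side read the
    target array, it would see a mixture of old and new entries. *)
Fixpoint wf_cmd (c : cmd) : Prop :=
  match c with
  | CSet k e => [/\ (k < num_arrays)%N, k \notin reads e & wf 2 e]
  | CSeq c1 c2 => wf_cmd c1 /\ wf_cmd c2
  | CIter c1 => wf_cmd c1
  end.

(* Bounds on the bit length of values and on running times, when all data read
   have at most [W] bits and the dimension is at most [W]. *)
Fixpoint ibits (W : nat) (e : iexp) : nat :=
  match e with
  | ICst m => m.+1
  | IDim | IVar _ => W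
  | IAdd a b | IMul a b => (ibits W a + ibits W b).+1
  end.

Fixpoint icost (W : nat) (e : iexp) : nat :=
  match e with
  | ICst m => m.+2
  | IDim | IVar _ => (W + 4)%N
  | IAdd a b | IMul a b => (icost W a + (icost W b + (ibits W a + ibits W b).+1))%N
  end.

Fixpoint bits (W : nat) (e : expr) : nat :=
  match e with
  | ECst z => bit_length z
  | EIdx _ | EIn _ | ERead _ _ _ => W
  | EOp _ a b => (bits W a + bits W b).+1
  | EIf c a b => (bits W a + bits W b)%N
  | EBig _ a => (W * (bits W a).+1).+1
  end.

Fixpoint cost (W : nat) (e : expr) : nat :=
  match e with
  | ECst z => (bit_length z).+1
  | EIdx l => (W + 4)%N
  | EIn ie => (icost W ie + (ibits W ie + W).+1)%N
  | ERead k x y => (icost W (array_iexp k x y) + (ibits W (array_iexp k x y) + W).+1)%N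
  | EOp _ a b => (cost W a + (cost W b + (bits W a + bits W b).+1))%N
  | EIf c a b => (cost W c + (bits W c + (cost W a + cost W b)).+1)%N
  | EBig _ a =>
      (2 + (W * (cost W a + ((W * (bits W a).+1).+1 + bits W a).+1) + loop_overhead W))%N
  end.

Lemma ieval_array n v k x y : ieval n v (array_iexp k x y) = array_cell n k (v x) (v y).
Proof. by []. Qed.

Lemma small_ieval n W v e : (n <= W)%N -> (forall l, v l < n)%N ->
  small (ibits W e) (ieval n v e).
Proof.
move=> nW vn; elim: e => [m||l|a IHa b IHb|a IHa b IHb] /=.
- exact: small_nat.
- exact: small_nat.
- by apply: small_nat; apply: ltnW; apply: leq_trans nW.
- exact: (small_op Defs.Add IHa IHb).
- by rewrite PoszM; apply: (small_op Defs.Mul IHa IHb).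
Qed.

Lemma ibits_gt0 W e : (0 < W)%N -> (0 < ibits W e)%N.
Proof. by case: e. Qed.

Lemma bits_gt0 W e : (0 < W)%N -> (0 < bits W e)%N.
Proof.
by move=> W0; elim: e => //= c _ a IHa b _; rewrite addn_gt0 IHa.
Qed.

Definition agree (d r : nat) (st st' : ram_state) : Prop :=
  [/\ regs st' 0 = regs st 0,
      forall l, (l < d)%N -> regs st' (vreg l) = regs st (vreg l),
      forall l, (l < r)%N -> regs st' (treg l) = regs st (treg l) &
      memory st' = memory st].

Lemma agree_trans d r st1 st2 st3 : agree d r st1 st2 -> agree d r st2 st3 -> agree d r st1 st3.
Proof.
move=> [a1 b1 c1 m1] [a2 b2 c2 m2]; split; [by rewrite a2| | |by rewrite m2].
  by move=> l ld; rewrite b2 ?b1.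
by move=> l lr; rewrite c2 ?c1.
Qed.

Lemma agree_leq d r d' r' st st' : (d <= d')%N -> (r <= r')%N -> agree d' r' st st' -> agree d r st st'.
Proof.
move=> dd rr [a b c m]; split => // l lt; first by apply: b; apply: leq_trans dd.
by apply: c; apply: leq_trans rr.
Qed.

Lemma agree_set_treg d r k st z : (r <= k)%N -> agree d r st (set_reg st (treg k) z).
Proof.
move=> rk; split => //=.
- by rewrite updateE; case: eqP => //; rewrite /treg; lia.
- by move=> l _; rewrite updateE; case: eqP => //; rewrite /treg /vreg; lia.
- by move=> l lr; rewrite updateE; case: eqP => //; rewrite /treg; lia.
Qed.

Lemma agree_set_vreg d r k st z : (d <= k)%N -> agree d r st (set_reg st (vreg k) z).
Proof.
move=> dk; split => //=.
- by rewrite updateE; case: eqP => //; rewrite /vreg; lia.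
- by move=> l ld; rewrite updateE; case: eqP => //; rewrite /vreg; lia.
- by move=> l _; rewrite updateE; case: eqP => //; rewrite /treg /vreg; lia.
Qed.

Lemma treg_set st r z : regs (set_reg st (treg r) z) (treg r) = z.
Proof. by rewrite /= updateE eqxx. Qed.

Lemma runs_icompile n W v d e r st :
  (0 < W)%N -> (n <= W)%N -> (forall l, v l < n)%N -> regs st 0 = n ->
  (forall l, (l < d)%N -> regs st (vreg l) = v l) -> iwf d e ->
  runs (icompile r e) st
    (fun st' => regs st' (treg r) = ieval n v e /\ agree d r st st') (icost W e).
Proof.
move=> W0 nW vn; elim: e r st => [m||l|a IHa b IHb|a IHa b IHb] r st N0 E /=.
- move=> _; apply: (runs_const (W := m.+1)) => //; first exact: small_nat.
  by split; [exact: treg_set|exact: agree_set_treg].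
- move=> _; apply: (runs_seq (c1 := 2) (c2 := W.+2)
    (Q1 := fun st' => regs st' (treg r) = 0 /\ agree d r st st')); last lia.
    by apply: (runs_const (W := 1)) => //; split; [exact: treg_set|exact: agree_set_treg].
  move=> st1 [T1 A1]; have [N1 _ _ _] := A1; apply: (runs_arith (V := 1) (W := W)) => //.
  + by rewrite T1.
  + by rewrite N1 N0; apply: small_nat.
  + split; first by rewrite treg_set /= T1 add0r N1.
    by apply: agree_trans A1 _; apply: agree_set_treg.
- move=> ld; apply: (runs_seq (c1 := 2) (c2 := W.+2)
    (Q1 := fun st' => regs st' (treg r) = 0 /\ agree d r st st')); last lia.
    by apply: (runs_const (W := 1)) => //; split; [exact: treg_set|exact: agree_set_treg].
  move=> st1 [T1 A1]; have [_ V1 _ _] := A1; apply: (runs_arith (V := 1) (W := W)) => //.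
  + by rewrite T1.
  + by rewrite V1 // E //; apply: small_nat; apply: ltnW; apply: leq_trans nW.
  + split; first by rewrite treg_set /= T1 add0r V1 // E.
    by apply: agree_trans A1 _; apply: agree_set_treg.
- move=> /andP[wa wb]; apply: runs_seq (IHa r st N0 E wa) _ (leqnn _) => st1 [T1 A1].
  have [N1 V1 _ _] := A1.
  apply: runs_seq (IHb r.+1 st1 _ _ wb) _ (leqnn _) => [||st2 [T2 A2]].
  + by rewrite N1.
  + by move=> l ld; rewrite V1 // E.
  have [_ _ U2 _] := A2.
  apply: (runs_arith (V := ibits W a) (W := ibits W b)) => //; try exact: ibits_gt0.
  + by rewrite U2 // T1; apply: small_ieval.
  + by rewrite T2; apply: small_ieval.
  + split; first by rewrite treg_set /= U2 // T1 T2.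
    apply: agree_trans A1 (agree_trans (agree_leq _ _ A2) _) => //.
    exact: agree_set_treg.
- move=> /andP[wa wb]; apply: runs_seq (IHa r st N0 E wa) _ (leqnn _) => st1 [T1 A1].
  have [N1 V1 _ _] := A1.
  apply: runs_seq (IHb r.+1 st1 _ _ wb) _ (leqnn _) => [||st2 [T2 A2]].
  + by rewrite N1.
  + by move=> l ld; rewrite V1 // E.
  have [_ _ U2 _] := A2.
  apply: (runs_arith (V := ibits W a) (W := ibits W b)) => //; try exact: ibits_gt0.
  + by rewrite U2 // T1; apply: small_ieval.
  + by rewrite T2; apply: small_ieval.
  + split; first by rewrite treg_set /= U2 // T1 T2 PoszM.
    apply: agree_trans A1 (agree_trans (agree_leq _ _ A2) _) => //.
    exact: agree_set_treg.
Qed.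

(** * Correctness and cost of compiled expressions *)

Section compile_correct.
Variables (n : nat) (inp : nat -> int).

Definition represents (st : ram_state) (s : store n) : Prop :=
  [/\ regs st 0 = n,
      forall k (i j : 'I_n), (k < num_arrays)%N -> memory st (array_cell n k i j) = s k i j &
      forall a, (a < input_size n)%N -> memory st a = inp a].

Lemma represents_agree d r st st' s : agree d r st st' -> represents st s -> represents st' s.
Proof. by move=> [N _ _ M] [a b c]; split; rewrite ?N ?M. Qed.

Lemma represents_ext st s s' : (forall k, s k = s' k) -> represents st s -> represents st s'.
Proof. by move=> ss [a b c]; split => // k i j kK; rewrite b // ss. Qed.

Definition partial_big (o : bool) (F : 'I_n -> int) (i : nat) : int :=
  if o then \prod_(v < n | (v < i)%N) F v else \sum_(v < n | (v < i)%N) F v.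

Lemma partial_big0 o F : partial_big o F 0 = (o : nat)%:Z.
Proof. by case: o; rewrite /partial_big big_pred0. Qed.

Lemma partial_bigS o F (i : 'I_n) :
  partial_big o F i.+1 = eval_op (big_op o) (partial_big o F i) (F i).
Proof.
by case: o; rewrite /partial_big (bigD1 i) //= 1?mulrC 1?addrC; [congr (_ * _)|congr (_ + _)];
  apply: eq_bigl => v; rewrite ltnS ltn_neqAle andbC.
Qed.

Lemma partial_big_full o F :
  partial_big o F n = if o then \prod_v F v else \sum_v F v.
Proof. by case: o; apply: eq_bigl => v; rewrite ltn_ord. Qed.

(** A round adds at most [m + 1] bits, whether it multiplies or adds; the remaining bit is that of
    the neutral element 1. *)
Lemma small_partial_big o F m i : (i <= n)%N -> (forall v, small m (F v)) ->
  small (i * m.+1).+1 (partial_big o F i).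
Proof.
elim: i => [|i IH] lt Fm; first by rewrite partial_big0; case: o.
rewrite (partial_bigS _ _ (Ordinal lt)) /=.
have {}IH := IH (ltnW lt) Fm; have {}Fm := Fm (Ordinal lt).
case: o IH => IH /=; first by apply: small_leq (small_mul IH Fm); lia.
by apply: small_leq (small_add IH Fm); lia.
Qed.

Variable W : nat.
Hypotheses (W_gt0 : (0 < W)%N) (nW : (n <= W)%N).
Hypothesis inpW : forall a, (a < input_size n)%N -> small W (inp a).

Lemma small_eval (s : store n) env d e :
  (forall k i j, k \in reads e -> small W (s k i j)) -> wf d e ->
  small (bits W e) (eval inp s env d e).
Proof.
elim: e d env => [z|l|ie|k x y|o a IHa b IHb|c _ a IHa b IHb|o a IHa] d env sW /=.
- by move=> _; apply: bit_length_small.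
- by move=> _; apply: small_nat; apply: ltnW; apply: leq_trans nW.
- by move=> [_ +]; move=> /(_ n (fun l => env l)) H; apply: inpW; apply: H.
- by move=> _; apply: sW; rewrite /= inE.
- move=> [wa wb]; apply: small_op.
    by apply: IHa wa => k i j kr; apply: sW; rewrite /= mem_cat kr.
  by apply: IHb wb => k i j kr; apply: sW; rewrite /= mem_cat kr orbT.
- move=> [_ wa wb]; case: ifP => _.
    apply: small_leq (leq_addr _ _) _.
    by apply: IHa wa => k i j kr; apply: sW; rewrite /= !mem_cat kr orbT.
  apply: small_leq (leq_addl _ _) _.
  by apply: IHb wb => k i j kr; apply: sW; rewrite /= !mem_cat kr !orbT.
- move=> wa.
  rewrite -(partial_big_full o (fun v => eval inp s (bind env d v) d.+1 a)).
  apply: small_leq (_ : _ <= _)%N (small_partial_big o (leqnn n) (fun v => IHa _ _ sW wa)).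
  by rewrite ltnS leq_mul2r nW orbT.
Qed.

Lemma runs_compile (s : store n) e d r st (env : nat -> 'I_n) :
  (forall k i j, k \in reads e -> small W (s k i j)) -> wf d e ->
  represents st s -> (forall l, (l < d)%N -> regs st (vreg l) = (env l : nat)) ->
  runs (compile d r e) st
    (fun st' => regs st' (treg r) = eval inp s env d e /\ agree d r st st') (cost W e).
Proof.
elim: e d r st env => [z|l|ie|k x y|o a IHa b IHb|c IHc a IHa b IHb|o a IHa] d r st env sW /=.
- move=> _ _ _; apply: (runs_const (W := bit_length z)) => //.
    exact: bit_length_small.
  by split; [exact: treg_set|exact: agree_set_treg].
- move=> wl [N0 _ _] E.
  exact: (runs_icompile (e := IVar l) r W_gt0 nW (fun l => ltn_ord (env l)) N0 E wl).
- move=> [wi ii] R E; have [N0 _ _] := R.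
  have H := runs_icompile r W_gt0 nW (fun l => ltn_ord (env l)) N0 E wi.
  apply: runs_seq H _ (leqnn _).
  move=> st1 [T1 A1]; have [_ _ I1] := represents_agree A1 R.
  have lt := ii n (fun l => env l) (fun l => ltn_ord _).
  apply: (runs_read (V := ibits W ie) (W := W) _ _ T1) => //; first exact: ibits_gt0.
  + exact: small_ieval.
  + by rewrite I1 //; apply: inpW.
  + split; first by rewrite treg_set I1.
    by apply: agree_trans A1 _; apply: agree_set_treg.
- move=> [kK xd yd] R E; have [N0 _ _] := R.
  have wi : iwf d (array_iexp k x y) by rewrite /= xd yd.
  have H := runs_icompile r W_gt0 nW (fun l => ltn_ord (env l)) N0 E wi.
  apply: runs_seq H _ (leqnn _).
  move=> st1 [T1 A1]; have [_ M1 _] := represents_agree A1 R.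
  rewrite ieval_array in T1.
  apply: (runs_read (V := ibits W (array_iexp k x y)) (W := W) _ _ T1) => //.
  + exact: (@small_ieval n W (fun l => env l) (array_iexp k x y)).
  + by rewrite M1 //; apply: sW; rewrite /= inE.
  + split; first by rewrite treg_set M1.
    by apply: agree_trans A1 _; apply: agree_set_treg.
- move=> [wa wb] R E.
  have sWa k i j : k \in reads a -> small W (s k i j).
    by move=> kr; apply: sW; rewrite /= mem_cat kr.
  have sWb k i j : k \in reads b -> small W (s k i j).
    by move=> kr; apply: sW; rewrite /= mem_cat kr orbT.
  apply: runs_seq (IHa d r st env sWa wa R E) _ (leqnn _) => st1 [T1 A1].
  have R1 := represents_agree A1 R; have [N1 V1 _ _] := A1.
  apply: runs_seq (IHb d r.+1 st1 env sWb wb R1 _) _ (leqnn _) => [l ld|st2 [T2 A2]].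
    by rewrite V1 // E.
  have [_ _ U2 _] := A2.
  apply: (runs_arith (V := bits W a) (W := bits W b)) => //; try exact: bits_gt0.
  + by rewrite U2 // T1; apply: small_eval.
  + by rewrite T2; apply: small_eval.
  + split; first by rewrite treg_set /= U2 // T1 T2.
    apply: agree_trans A1 (agree_trans (agree_leq _ _ A2) _) => //.
    exact: agree_set_treg.
- move=> [wc wa wb] R E.
  have sWc k i j : k \in reads c -> small W (s k i j).
    by move=> kr; apply: sW; rewrite /= !mem_cat kr.
  have sWa k i j : k \in reads a -> small W (s k i j).
    by move=> kr; apply: sW; rewrite /= !mem_cat kr orbT.
  have sWb k i j : k \in reads b -> small W (s k i j).
    by move=> kr; apply: sW; rewrite /= !mem_cat kr !orbT.
  apply: runs_seq (IHc d r st env sWc wc R E) _ (leqnn _) => st1 [T1 A1].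
  have R1 := represents_agree A1 R; have [N1 V1 _ _] := A1.
  have E1 l : (l < d)%N -> regs st1 (vreg l) = (env l : nat) by move=> ld; rewrite V1 // E.
  apply: (runs_if (W := bits W c) (c := (cost W a + cost W b)%N)) => //.
  + exact: bits_gt0.
  + by rewrite T1; apply: small_eval.
  rewrite T1 /=; case: ifP => _.
    apply: runs_weaken (IHa d r st1 env sWa wa R1 E1) _ _; first exact: leq_addr.
    by move=> st2 [T2 A2]; split => //; apply: agree_trans A1 A2.
  apply: runs_weaken (IHb d r st1 env sWb wb R1 E1) _ _; first exact: leq_addl.
  by move=> st2 [T2 A2]; split => //; apply: agree_trans A1 A2.
- move=> wa R E; have [N0 _ _] := R.
  pose F v := eval inp s (bind env d v) d.+1 a.
  have FW v : small (bits W a) (F v) by apply: small_eval.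
  apply: (runs_seq (c1 := 2) (Q1 := fun st' => regs st' (treg r) = partial_big o F 0 /\ agree d r st st')).
  + apply: (runs_const (W := 1)) => //; first by case: (o).
    by split; [rewrite treg_set partial_big0|exact: agree_set_treg].
  + move=> st0 I0.
    apply: runs_weaken (runs_for (n := n) (W := W)
      (I := fun i st' => regs st' (treg r) = partial_big o F i /\ agree d r st st')
      (c := fun=> (cost W a + ((W * (bits W a).+1).+1 + bits W a).+1)%N) _ _ _ _ _ _ _ I0 _)
      (leqnn _) _ => //.
    * by rewrite /vreg /treg; apply/eqP; lia.
    * by rewrite /vreg addn1.
    * move=> i st1 q z qE [T1 A1]; case: qE => ->.
        split; last by apply: agree_trans A1 _; apply: agree_set_vreg.
        by rewrite /= updateE -T1; case: eqP => //; rewrite /vreg /treg; lia.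
      split; last by apply: agree_trans A1 _; apply: agree_set_treg.
      by rewrite /= updateE -T1; case: eqP => //; rewrite /treg; lia.
    * move=> i st1 lt [T1 A1] N1 D1.
      have R1 := represents_agree A1 R; have [_ V1 U1 _] := A1.
      apply: runs_seq (IHa d.+1 r.+2 st1 (bind env d (Ordinal lt)) sW wa R1 _) _ (leqnn _).
        move=> l; rewrite ltnS leq_eqVlt /bind => /predU1P[->|ld]; first by rewrite eqxx.
        by rewrite (ltn_eqF ld) V1 // E.
      move=> st2 [T2 A2]; have [N2 V2 U2 _] := A2.
      apply: (runs_arith (V := (W * (bits W a).+1).+1) (W := bits W a)) => //.
      - exact: bits_gt0.
      - rewrite U2 // T1; apply: small_leq (small_partial_big o (ltnW lt) FW).
        by rewrite ltnS leq_mul2r (leq_trans (ltnW lt) nW) orbT.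
      - by rewrite T2; apply: FW.
      - split; last 2 first.
        + by have [-> _ _ _] := agree_set_treg 0 st2 (eval_op (big_op o) (regs st2 (treg r)) (regs st2 (treg r.+2))) (leqnn r); rewrite N2.
        + have [_ -> // _ _] := agree_set_treg d.+1 st2 (eval_op (big_op o) (regs st2 (treg r)) (regs st2 (treg r.+2))) (leqnn r).
          by rewrite V2.
        + split; first by rewrite treg_set (partial_bigS _ _ (Ordinal lt)) U2 // T1 T2.
          apply: agree_trans A1 (agree_trans (agree_leq _ _ A2) (agree_set_treg _ _ _ _)) => //.
          exact: leq_trans (leqnSn _) (leqnSn _).
    * by have [_ [-> _ _ _]] := I0.
    * move=> st1 [[T1 A1] _]; split => //.
      by rewrite T1 partial_big_full.
  + rewrite /= sum_nat_const card_ord !leq_add2l leq_add2r leq_mul2r nW orbT //.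
Qed.

End compile_correct.

(** The residue modulo [num_arrays] determines the array, and Euclidean division of the quotient by
    [n] determines row and column. *)
Lemma array_cell_inj n k k' (i j i' j' : 'I_n) :
  (k < num_arrays)%N -> (k' < num_arrays)%N ->
  array_cell n k i j = array_cell n k' i' j' -> [/\ k = k', i = i' & j = j'].
Proof.
rewrite /array_cell /num_arrays => kK kK' E.
have [kk ij] : k = k' /\ (i * n + j = i' * n + j')%N by split; lia.
have n0 : (0 < n)%N by apply: leq_ltn_trans (ltn_ord i).
split => //; apply/val_inj => /=.
  have := congr1 (divn^~ n) ij; rewrite !divnMDl //.
  by rewrite (divn_small (ltn_ord j)) (divn_small (ltn_ord j')) !addn0.
have := congr1 (modn^~ n) ij; rewrite !modnMDl.
by rewrite (modn_small (ltn_ord j)) (modn_small (ltn_ord j')).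
Qed.

(** * Correctness and cost of compiled commands *)

Section commands.
Variables (n : nat) (inp : nat -> int).

Lemma eq_eval_reads (s s' : store n) env d e :
  (forall k, k \in reads e -> s k = s' k) -> eval inp s env d e = eval inp s' env d e.
Proof.
elim: e d env => [z|l|ie|k x y|o a IHa b IHb|c IHc a IHa b IHb|o a IHa] d env ss //=.
- by rewrite ss // inE.
- by rewrite IHa ?IHb // => k kr; apply: ss; rewrite /= mem_cat kr ?orbT.
- by rewrite IHa ?IHb ?IHc // => k kr; apply: ss; rewrite /= !mem_cat kr ?orbT.
- by case: o ss => ss; apply: eq_bigr => v _; apply: IHa.
Qed.

Definition maxbits (s : store n) (ks : seq nat) : nat :=
  \max_(k <- ks) \max_i \max_j bit_length (s k i j).

Lemma maxbits_small s ks k i j : k \in ks -> small (maxbits s ks) (s k i j).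
Proof.
move=> kks; apply: small_leq (bit_length_small _).
have /bigmax_leqP_seq/(_ k kks isT) := leqnn (maxbits s ks).
by move=> /bigmax_leqP/(_ i isT)/bigmax_leqP/(_ j isT).
Qed.

Definition set_cost (W k : nat) (e : expr) : nat :=
  let body := (cost W e + (icost W (array_iexp k 0 1) +
                (ibits W (array_iexp k 0 1) + bits W e).+1))%N in
  (W * (W * body + loop_overhead W) + loop_overhead W)%N.

(** The bound refers to the contents of the store at the time of each assignment. A bound from the
    syntax alone would compound the growth of the numbers over the rounds of [CIter]. *)
Fixpoint run_cost (W : nat) (c : cmd) (s : store n) : nat :=
  match c with
  | CSet k e => set_cost (W + maxbits s (reads e)) k e
  | CSeq c1 c2 => (run_cost W c1 s + run_cost W c2 (run inp c1 s))%N
  | CIter c1 => (\sum_(i < n) run_cost W c1 (iter i (run inp c1) s) + loop_overhead W)%N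
  end.

Definition keeps (r : nat) (st st' : ram_state) : Prop :=
  forall l, (l < r)%N -> regs st' (treg l) = regs st (treg l).

Lemma keeps_set_reg r st st' q z : keeps r st st' ->
  (forall l, (l < r)%N -> treg l != q) -> keeps r st (set_reg st' q z).
Proof. by move=> K H l lr; rewrite /= updateE (negbTE (H _ lr)) K. Qed.

Lemma represents_set_reg st (s : store n) q z : (0 < q)%N ->
  represents inp st s -> represents inp (set_reg st q z) s.
Proof. by move=> q0 [a b c]; split => //=; rewrite updateE ltn_eqF. Qed.

(** The target array in the middle of an assignment, when the positions before [(i, j)] in row-major
    order already hold their new entries. *)
Definition partial_mx (A B : 'M[int]_n) (i j : nat) : 'M[int]_n :=
  \matrix_(i', j') if (i' < i)%N || ((i' == i :> nat) && (j' < j)%N) then B i' j' else A i' j'.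

Lemma partial_mx0 A B : partial_mx A B 0 0 = A.
Proof. by apply/matrixP => i j; rewrite mxE !ltn0 andbF. Qed.

Lemma partial_mx_row A B i : partial_mx A B i n = partial_mx A B i.+1 0.
Proof.
apply/matrixP => i' j'; rewrite !mxE ltn_ord andbT ltn0 andbF orbF.
by rewrite ltnS [in RHS]leq_eqVlt orbC.
Qed.

Lemma partial_mx_full A B : partial_mx A B n 0 = B.
Proof. by apply/matrixP => i j; rewrite mxE ltn_ord. Qed.

Lemma treg_inj l r : (treg l == treg r) = (l == r).
Proof. by apply/eqP/eqP => [|->//]; rewrite /treg; lia. Qed.

Lemma treg_vreg l r : (treg l == vreg r) = false.
Proof. by apply/eqP; rewrite /treg /vreg; lia. Qed.

Lemma vreg_inj l r : (vreg l == vreg r) = (l == r).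
Proof. by apply/eqP/eqP => [|->//]; rewrite /vreg; lia. Qed.

Lemma treg_gt0 r : (0 < treg r)%N. Proof. by rewrite /treg addn2. Qed.
Lemma vreg_gt0 r : (0 < vreg r)%N. Proof. by rewrite /vreg addn1. Qed.

Variable W : nat.
Hypotheses (W_gt0 : (0 < W)%N) (nW : (n <= W)%N).
Hypothesis inpW : forall a, (a < input_size n)%N -> small W (inp a).

Lemma runs_write_array (s : store n) k e r st (i j : 'I_n) (M : 'M[int]_n) (c := (W + maxbits s (reads e))%N) :
  (k < num_arrays)%N -> k \notin reads e -> wf 2 e ->
  represents inp st (set_array s k M) -> regs st (vreg 0) = i -> regs st (vreg 1) = j ->
  runs (Seq (compile 2 r e)
         (Seq (icompile r.+1 (array_iexp k 0 1)) (MemWrite (treg r.+1) (treg r)))) st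
    (fun st' => [/\ represents inp st' (set_array s k
                      (\matrix_(i', j') if (i' == i) && (j' == j) then eval_mx inp s e i j
                                        else M i' j')),
       regs st' (vreg 0) = i, regs st' (vreg 1) = j & keeps r st st'])
    (cost c e + (icost c (array_iexp k 0 1) + (ibits c (array_iexp k 0 1) + bits c e).+1))%N.
Proof.
move=> kK kr we R V0 V1.
have c0 : (0 < c)%N by rewrite addn_gt0 W_gt0.
have nc : (n <= c)%N by apply: leq_trans nW (leq_addr _ _).
have inpc a : (a < input_size n)%N -> small c (inp a).
  by move/inpW; apply: small_leq; apply: leq_addr.
have sc k' i' j' : k' \in reads e -> small c (s k' i' j').
  by move=> kr'; apply: small_leq (maxbits_small _ _ _ kr'); apply: leq_addl.
(* The expression does not read the target, so it evaluates as in the store before the assignment,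
   whatever part of the target has been rewritten. *)
have sE k' : k' \in reads e -> set_array s k M k' = s k'.
  by move=> kr'; rewrite /set_array; case: eqP kr' => // ->; rewrite (negbTE kr).
have Ev : eval inp (set_array s k M) (ij_env i j) 2 e = eval_mx inp s e i j.
  by rewrite mxE; apply: eq_eval_reads.
have := runs_compile (W := c) c0 nc inpc (s := set_array s k M) r (env := ij_env i j) _ we R.
rewrite Ev => H; apply: runs_seq (H _ _) _ (leqnn _).
- by move=> k' i' j' kr'; rewrite sE //; apply: sc.
- by case=> [|[|]].
move=> st1 [T1 A1]; have R1 := represents_agree A1 R; have [N1 E1 U1 _] := A1.
have [N0 _ _] := R1.
have E1' l : (l < 2)%N -> regs st1 (vreg l) = (ij_env i j l : nat).
  by case: l => [|[|]] // _; rewrite E1.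
have H1 := runs_icompile (e := array_iexp k 0 1) r.+1 c0 nc (fun l => ltn_ord (ij_env i j l)) N0 E1' isT.
apply: runs_seq H1 _ (leqnn _) => st2 [T2 A2].
have R2 := represents_agree A2 R1; have [_ E2 U2 _] := A2.
rewrite ieval_array in T2.
apply: (runs_write (V := ibits c (array_iexp k 0 1)) (W := bits c e) _ _ T2) => //.
- exact: bits_gt0.
- exact: (@small_ieval n c (fun l => ij_env i j l) (array_iexp k 0 1)).
- by rewrite U2 // T1 -Ev; apply: small_eval we => // k' i' j' kr'; rewrite sE //; apply: sc.
have [N2 M2 I2] := R2; split => /=.
- split => //= [k' i' j' kK'|a al]; rewrite updateE; last first.
    by rewrite I2 // ltn_eqF // /array_cell; lia.
  case: eqP => [/array_cell_inj [] // -> -> ->|ne].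
    by rewrite /set_array eqxx [RHS]mxE !eqxx U2 // T1.
  rewrite M2 // /set_array; case: eqP => // kk; subst k'; rewrite [RHS]mxE.
  by case: eqP => // ii; case: eqP => // jj; case: ne; rewrite ii jj.
- by rewrite E2 // E1.
- by rewrite E2 // E1.
- by move=> l lr /=; rewrite U2; [exact: U1|exact: ltnW].
Qed.

Lemma runs_compile_cmd c r st (s : store n) : represents inp st s -> wf_cmd c ->
  runs (compile_cmd r c) st
    (fun st' => represents inp st' (run inp c s) /\ keeps r st st') (run_cost W c s).
Proof.
elim: c r st s => [k e|c1 IH1 c2 IH2|c IH] r st s R.
- move=> /= [kK kr we]; have [N0 _ _] := R.
  pose pm := partial_mx (s k) (eval_mx inp s e).
  set V := (W + maxbits s (reads e))%N.
  have V0 : (0 < V)%N by rewrite addn_gt0 W_gt0.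
  have nV : (n <= V)%N by apply: leq_trans nW (leq_addr _ _).
  set body := (cost V e + (icost V (array_iexp k 0 1) +
                 (ibits V (array_iexp k 0 1) + bits V e).+1))%N.
  pose J i j st' := represents inp st' (set_array s k (pm i j)) /\ keeps r st st'.
  have J0 : J 0%N 0%N st.
    split => //; apply: represents_ext R => k'.
    by rewrite /set_array /pm partial_mx0; case: eqP => // ->.
  apply: runs_weaken (runs_for (n := n) (W := V) (I := fun i => J i 0%N)
    (c := fun=> (V * body + loop_overhead V)%N) V0 nV _ _ _ _ _ J0 N0) _ _.
  + by rewrite eq_sym treg_vreg.
  + exact: vreg_gt0.
  + exact: treg_gt0.
  + move=> i st1 q z qE [R1 K1]; split.
      by apply: represents_set_reg => //; case: qE => ->; rewrite ?vreg_gt0 ?treg_gt0.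
    apply: keeps_set_reg => // l lr.
    by case: qE => ->; rewrite ?treg_vreg ?treg_inj ?ltn_eqF.
  + move=> i st1 lt J1 N1 D1; pose oi := Ordinal lt.
    apply: runs_weaken (runs_for (n := n) (W := V)
      (I := fun j st' => J i j st' /\ regs st' (vreg 0) = i)
      (c := fun=> body) V0 nV _ _ _ _ _ (conj J1 D1) N1) _ _.
    * by rewrite eq_sym treg_vreg.
    * exact: vreg_gt0.
    * exact: treg_gt0.
    * move=> j st2 q z qE [[R2 K2] D2]; split; first split.
      - by apply: represents_set_reg => //; case: qE => ->; rewrite ?vreg_gt0 ?treg_gt0.
      - apply: keeps_set_reg => // l lr.
        by case: qE => ->; rewrite ?treg_vreg ?treg_inj ?ltn_eqF // ltnW.
      - by rewrite /= updateE -D2; case: qE => ->; rewrite ?vreg_inj // eq_sym treg_vreg.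
    * move=> j st2 jt [[R2 K2] D2] N2 E2; pose oj := Ordinal jt.
      apply: runs_weaken (runs_write_array r.+2 (i := oi) (j := oj) kK kr we R2 D2 E2) (leqnn _) _.
      move=> st3 [R3 D3 E3 K3]; split; [split; first split| |] => //.
      - apply: represents_ext R3 => k'; rewrite /set_array; case: eqP => // _.
        apply/matrixP => i' j'; rewrite !mxE -!val_eqE /= ltnS.
        case: (ltngtP i' i) => //= ii; case: (ltngtP j' j) => //= jj.
        have -> : i' = oi by apply: val_inj.
        by have -> : j' = oj by apply: val_inj.
      - by move=> l lr; rewrite K3 ?K2 //; lia.
      - by have [] := R3.
    * by rewrite sum_nat_const card_ord leq_add2r leq_mul2r nV orbT.
    * move=> st2 [[[R2 K2] D2] N2]; split => //; split => //.
      by rewrite /pm -partial_mx_row.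
  + by rewrite sum_nat_const card_ord leq_add2r leq_mul2r nV orbT.
  + move=> st1 [[R1 K1] _]; split => //.
    by rewrite /pm partial_mx_full in R1.
- move=> /= [w1 w2]; apply: runs_seq (IH1 r st s R w1) _ (leqnn _) => st1 [R1 K1].
  apply: runs_weaken (IH2 r st1 _ R1 w2) (leqnn _) _ => st2 [R2 K2]; split => //.
  by move=> l lr; rewrite K2 // K1.
- move=> /= wc; have [N0 _ _] := R.
  apply: runs_weaken (runs_for (n := n) (W := W)
    (I := fun i st' => represents inp st' (iter i (run inp c) s) /\ keeps r st st')
    (c := fun i => run_cost W c (iter i (run inp c) s)) W_gt0 nW _ _ _ _ _ (conj R _) N0)
    (leqnn _) _ => //.
  + by rewrite treg_inj ltn_eqF.
  + exact: treg_gt0.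
  + move=> i st1 q z qE [R1 K1]; split.
      by apply: represents_set_reg => //; case: qE => ->; rewrite treg_gt0.
    by apply: keeps_set_reg => // l lr; case: qE => ->; rewrite treg_inj ltn_eqF // ltnW.
  + move=> i st1 lt [R1 K1] N1 D1.
    apply: runs_weaken (IH r.+2 st1 _ R1 wc) (leqnn _) _ => st2 [R2 K2].
    split; [split=> //| |].
    * by move=> l lr; rewrite K2 ?K1 //; lia.
    * by have [] := R2.
    * by rewrite K2.
  + by move=> st1 [].
Qed.

End commands.

(** * Polynomial bounds *)

(* The input region is overwritten while the result is written to addresses
   [0, ..., n - 1], so the compiler's correctness is applied at each step with the
   current memory as input. *)
Definition ram_program (c : cmd) (k : nat) : program :=
  Seq (Seq (Const (treg 0) 0) (MemRead 0 (treg 0)))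
    (Seq (compile_cmd 0 c)
      (for_loop (vreg 0) (treg 0)
        (Seq (compile 1 1 (ERead k 0 0)) (MemWrite (vreg 0) (treg 1))))).

Definition output_cost (W k : nat) : nat :=
  (W * (cost W (ERead k 0 0) + (W + W).+1) + loop_overhead W)%N.

Lemma runs_ram_program n W (x : seq int) c k (s := run (nth 0%R x) c (fun=> 0%R : 'M[int]_n)) :
  (0 < W)%N -> (n <= W)%N -> (forall a, small W (nth 0%R x a)) ->
  nth 0 x 0%N = n%:Z -> size x = input_size n -> wf_cmd c -> (k < num_arrays)%N ->
  runs (ram_program c k) (initial_state x)
    (fun st => forall i : 'I_n, memory st i = s k i i)
    (2 * W + 4 + (run_cost (nth 0%R x) W c (fun=> 0%R : 'M[int]_n) + output_cost (W + maxbits s [:: k]) k))%N.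
Proof.
move=> W0 nW xW x0 sx wc kK.
have one : small 1 0 by [].
apply: (runs_seq (c1 := (W + 4)%N)
  (c2 := (run_cost (nth 0%R x) W c (fun=> 0%R : 'M[int]_n) + output_cost (W + maxbits s [:: k]) k)%N)
  (Q1 := fun st => represents (nth 0%R x) st (fun=> 0%R : 'M[int]_n))).
- apply: (runs_seq (c1 := 2) (c2 := W.+2)
    (Q1 := fun st => regs st (treg 0) = 0%N /\ memory st = nth 0%R x)).
  + by apply: (runs_const (W := 1)).
  + move=> st1 [T1 M1]; apply: (runs_read (V := 1) (W := W) _ _ T1) => //.
      by rewrite M1.
    split => /= [|a i j aK|a al]; first by rewrite M1.
      (* Cells behind the input hold the default value 0, so all arrays start as zero matrices. *)
      by rewrite M1 mxE nth_default // sx /array_cell addnCA leq_addr.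
    by rewrite M1.
  + lia.
- move=> st1 R1; apply: runs_seq (runs_compile_cmd W0 nW (fun a _ => xW a) 0 R1 wc) _ (leqnn _).
  move=> st2 [R2 _]; rewrite -/s in R2; have [N2 A2 I2] := R2.
  set V := (W + maxbits s [:: k])%N.
  have V0 : (0 < V)%N by rewrite addn_gt0 W0.
  have nV : (n <= V)%N by apply: leq_trans nW (leq_addr _ _).
  have sV i j : small V (s k i j).
    by apply: small_leq (maxbits_small _ _ _ _); [exact: leq_addl|rewrite inE].
  pose J i st := [/\ forall k (i j : 'I_n), (k < num_arrays)%N -> memory st (array_cell n k i j) = s k i j,
    forall a, (a < input_size n)%N -> small V (memory st a) &
    forall i' : 'I_n, (i' < i)%N -> memory st i' = s k i' i'].
  have J2 : J 0%N st2.
    by split => // a al; rewrite I2 //; apply: small_leq (leq_addr _ _) (xW a).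
  apply: runs_weaken (runs_for (n := n) (W := V) (I := J)
    (c := fun=> (cost V (ERead k 0 0) + (V + V).+1)%N) V0 nV _ _ _ _ _ J2 N2) _ _ => //.
  + by move=> i st3 lt [A3 I3 O3] N3 E3; pose oi := Ordinal lt;
    have R3 : represents (memory st3) st3 s by [];
    apply: runs_seq (runs_compile V0 nV I3 (s := s) (e := ERead k 0 0) (d := 1) 1 (env := fun=> oi) _ _ R3 _) _ (leqnn _);
      [move=> k' i' j'; rewrite inE => /eqP->; exact: sV|by []|by case|];
    move=> st4 [T4 A4]; have R4 := represents_agree A4 R3; have [N4 B4 I4] := R4;
    have [_ E4 _ M4] := A4;
    apply: (runs_write (V := V) (W := V) (i := i)) => //;
      [by rewrite E4|by apply: small_nat; apply: ltnW; apply: leq_trans nV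
      |by rewrite T4; apply: sV|];
    split; [split|exact: N4|by rewrite /= E4];
      [move=> k' i' j' kK'; rewrite /= updateE gtn_eqF ?B4 // /array_cell /input_size; lia
      |move=> a al; rewrite /= updateE; case: eqP => _; [rewrite T4; exact: sV|rewrite M4; exact: I3]
      |move=> i' i'i; rewrite /= updateE T4; case: eqP => [ii|ne];
        [by rewrite (_ : i' = oi) //; apply: val_inj
        |by rewrite M4 O3 // ltn_neqAle -ltnS i'i andbT; apply/eqP]].
  + by rewrite /output_cost sum_nat_const card_ord leq_add2r leq_mul2r nV orbT.
  + by move=> st3 [[_ _ O3] _] i; apply: O3.
- lia.
Qed.

(** A polynomial bound concerns infinitely many instances at once; dimension, input and weight are
    therefore functions of an index. The weight bounds the dimension as well as the bit length of
    every input cell. *)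
Record family := Family {
  idx : Type;
  weight : idx -> nat;
  dim : idx -> nat;
  input : idx -> nat -> int;
  weight_gt0 : forall x, (0 < weight x)%N;
  dim_weight : forall x, (dim x <= weight x)%N;
  input_weight : forall x a, (a < input_size (dim x))%N -> small (weight x) (input x a) }.

Definition reindex_family (F : family) (J : Type) (f : J -> idx F) : family :=
  @Family J (fun x => weight (f x)) (fun x => dim (f x)) (fun x => input (f x))
    (fun x => weight_gt0 (f x)) (fun x => dim_weight (f x)) (fun x => @input_weight _ (f x)).

(** The base is at least 2, even at weight 0, so constants, sums and products are absorbed by
    raising the exponent. *)
Definition poly_bounded (I : Type) (w f : I -> nat) : Prop :=
  exists k, forall x, (f x <= (w x + 2) ^ k)%N.

Section poly_bounded.
Variables (I : Type) (w : I -> nat).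

Lemma poly_bounded_leq f g : (forall x, f x <= g x)%N -> poly_bounded w g -> poly_bounded w f.
Proof. by move=> fg [k H]; exists k => x; apply: leq_trans (fg x) (H x). Qed.

Lemma poly_bounded_const c : poly_bounded w (fun=> c).
Proof.
exists c => x; apply: leq_trans (ltnW (ltn_expl c (isT : 1 < 2)%N)) _.
by case: c => // c; rewrite leq_exp2r // leq_addl.
Qed.

Lemma poly_bounded_weight : poly_bounded w w.
Proof. by exists 1%N => x; rewrite expn1 leq_addr. Qed.

Lemma poly_bounded_mul f g :
  poly_bounded w f -> poly_bounded w g -> poly_bounded w (fun x => f x * g x)%N.
Proof.
by move=> [k fk] [l gl]; exists (k + l)%N => x; rewrite expnD leq_mul.
Qed.

Lemma poly_bounded_add f g :
  poly_bounded w f -> poly_bounded w g -> poly_bounded w (fun x => f x + g x)%N.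
Proof.
move=> [k fk] [l gl]; exists (maxn k l).+1 => x.
apply: leq_trans (leq_add (fk x) (gl x)) _.
have H m : (m <= maxn k l)%N -> ((w x + 2) ^ m <= (w x + 2) ^ maxn k l)%N.
  by move=> mk; rewrite leq_pexp2l // addn2.
rewrite expnS; have := H k (leq_maxl _ _); have := H l (leq_maxr _ _); nia.
Qed.

Lemma poly_bounded_succ f : poly_bounded w f -> poly_bounded w (fun x => (f x).+1).
Proof.
move=> /poly_bounded_add/(_ (poly_bounded_const 1)).
by apply: poly_bounded_leq => x; rewrite addn1.
Qed.

Lemma poly_bounded_comp (g : nat -> nat) f :
  poly_bounded id g -> poly_bounded w f -> poly_bounded w (fun x => g (f x)).
Proof.
(* The exponent comes from [f x + 2 <= (w x + 2) ^ l + 2 <= (w x + 2) ^ (l + 2)]. *)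
move=> [k gk] [l fl]; exists ((l + 2) * k)%N => x; apply: leq_trans (gk _) _.
rewrite expnM; case: k {gk} => // k; rewrite leq_exp2r // expnD.
have := fl x; have : (0 < (w x + 2) ^ l)%N by rewrite expn_gt0 addn2.
have : (4 <= (w x + 2) ^ 2)%N by rewrite -mulnn; apply: (@leq_mul 2 2); rewrite leq_addl.
nia.
Qed.

End poly_bounded.

Lemma poly_bounded_reindex I J (w f : I -> nat) (h : J -> I) :
  poly_bounded w f -> poly_bounded (fun x => w (h x)) (fun x => f (h x)).
Proof. by move=> [k H]; exists k => x. Qed.

Ltac poly := repeat first [ assumption | apply: poly_bounded_succ | apply: poly_bounded_add
  | apply: poly_bounded_mul | exact: poly_bounded_weight | exact: poly_bounded_const ].

Lemma poly_bounded_ibits e : poly_bounded id (ibits^~ e).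
Proof. by elim: e => [m||l|a IHa b IHb|a IHa b IHb] /=; poly. Qed.

Lemma poly_bounded_icost e : poly_bounded id (icost^~ e).
Proof.
by elim: e => [m||l|a IHa b IHb|a IHa b IHb] /=; have pb := poly_bounded_ibits; poly; exact: pb.
Qed.

Lemma poly_bounded_bits e : poly_bounded id (bits^~ e).
Proof. by elim: e => [z|l|i|k x y|o a IHa b IHb|c _ a IHa b IHb|o a IHa] /=; poly. Qed.

Lemma poly_bounded_loop_overhead : poly_bounded id loop_overhead.
Proof. rewrite /loop_overhead; poly. Qed.

Lemma poly_bounded_cost e : poly_bounded id (cost^~ e).
Proof.
have pb := poly_bounded_ibits; have pc := poly_bounded_icost; have p := poly_bounded_bits; have lo := poly_bounded_loop_overhead.
elim: e => [z|l|i|k x y|o a IHa b IHb|c IHc a IHa b IHb|o a IHa]; rewrite /cost -/cost;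
  poly; first [exact: pb | exact: pc | exact: p].
Qed.

Lemma poly_bounded_set_cost k e : poly_bounded id (fun W => set_cost W k e).
Proof.
have pb := poly_bounded_ibits; have pc := poly_bounded_icost; have p := poly_bounded_bits; have lo := poly_bounded_loop_overhead.
have c := poly_bounded_cost; rewrite /set_cost; poly; first [exact: pb | exact: pc | exact: p | exact: c].
Qed.

Lemma poly_bounded_output_cost k : poly_bounded id (output_cost^~ k).
Proof.
have lo := poly_bounded_loop_overhead; have c := poly_bounded_cost; rewrite /output_cost; poly; exact: c.
Qed.

Definition poly_bits (F : family) (A : forall x : idx F, 'M[int]_(dim x)) : Prop :=
  exists2 f, poly_bounded (@weight F) f & forall x i j, small (f x) (A x i j).
Arguments poly_bits : clear implicits.

Definition poly_cost_run (F : family) (c : cmd) (s : forall x : idx F, store (dim x)) : Prop :=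
  poly_bounded (@weight F) (fun x => run_cost (input x) (weight x) c (s x)).
Arguments poly_cost_run : clear implicits.

(** The number of the round becomes part of the index while the weight stays that of the instance: a
    polynomial bound over this family is uniform in the rounds. *)
Definition iter_family (F : family) : family :=
  reindex_family (fun x : {x : idx F & 'I_(dim x)} => projT1 x).

Section families.
Variable F : family.
Implicit Type s : forall x : idx F, store (dim x).

Lemma poly_bits_seq s (ks : seq nat) : (forall k, k \in ks -> poly_bits F (fun x => s x k)) ->
  exists2 f, poly_bounded (@weight F) f &
    forall k x i j, k \in ks -> small (f x) (s x k i j).
Proof.
elim: ks => [|k ks IH] H; first by exists (fun=> 0%N) => //; exact: poly_bounded_const.
have [f pf fs] := H k (mem_head _ _).
have [g pg gs] := IH (fun k' k'ks => H k' (mem_behead (s := k :: ks) k'ks)).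
exists (fun x => f x + g x)%N; first exact: poly_bounded_add.
move=> k' x i j; rewrite inE => /predU1P[->|k'ks].
  by apply: small_leq (fs x i j); apply: leq_addr.
by apply: small_leq (gs k' x i j k'ks); apply: leq_addl.
Qed.

Lemma poly_bits_eval s e : wf 2 e -> (forall k, k \in reads e -> poly_bits F (fun x => s x k)) ->
  poly_bits F (fun x => eval_mx (input x) (s x) e).
Proof.
move=> we /poly_bits_seq[f pf fs].
exists (fun x => bits (weight x + f x)%N e).
  apply: (poly_bounded_comp (g := bits^~ e)); first exact: poly_bounded_bits.
  by apply: poly_bounded_add => //; exact: poly_bounded_weight.
move=> x i j; rewrite mxE; apply: (small_eval (inp := input x)) we.
- exact: leq_trans (dim_weight x) (leq_addr _ _).
- by move=> a al; apply: small_leq (input_weight al); apply: leq_addr.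
- by move=> k i' j' kr; apply: small_leq (fs _ _ _ _ kr); apply: leq_addl.
Qed.

Lemma poly_bounded_maxbits s (ks : seq nat) : (forall k, k \in ks -> poly_bits F (fun x => s x k)) ->
  poly_bounded (@weight F) (fun x => maxbits (s x) ks).
Proof.
move=> /poly_bits_seq[f pf fs].
apply: (@poly_bounded_leq _ _ _ (fun x => (f x).+1)); last exact: poly_bounded_succ.
move=> x; apply/bigmax_leqP_seq => k kks _; apply/bigmax_leqP => i _.
apply/bigmax_leqP => j _; apply: small_bit_length => //.
by apply: small_leq (fs k x i j kks).
Qed.

Lemma poly_cost_set s k e : (forall k, k \in reads e -> poly_bits F (fun x => s x k)) ->
  poly_cost_run F (CSet k e) s.
Proof.
move=> H; apply: (poly_bounded_comp (g := fun W => set_cost W k e)).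
  exact: poly_bounded_set_cost.
by apply: poly_bounded_add; [exact: poly_bounded_weight|exact: poly_bounded_maxbits].
Qed.

Lemma poly_cost_seq s c1 c2 : poly_cost_run F c1 s ->
  poly_cost_run F c2 (fun x => run (input x) c1 (s x)) -> poly_cost_run F (CSeq c1 c2) s.
Proof. exact: poly_bounded_add. Qed.

(** A bound uniform in the rounds is multiplied by the number of rounds, which the weight
    dominates. *)
Lemma poly_cost_iter s c :
  poly_cost_run (iter_family F) c (fun y => iter (projT2 y) (run (input (projT1 y)) c) (s (projT1 y))) ->
  poly_cost_run F (CIter c) s.
Proof.
move=> [k H]; apply: poly_bounded_add; last first.
  by apply: (poly_bounded_comp (g := loop_overhead)); [exact: poly_bounded_loop_overhead|exact: poly_bounded_weight].
apply: (@poly_bounded_leq _ _ _ (fun x => weight x * (weight x + 2) ^ k)%N).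
  move=> x; apply: (@leq_trans (\sum_(i < dim x) (weight x + 2) ^ k)%N).
    by apply: leq_sum => i _; apply: (H (existT _ x i)).
  by rewrite sum_nat_const card_ord leq_mul2r dim_weight orbT.
apply: poly_bounded_mul; first exact: poly_bounded_weight.
by exists k.
Qed.

Lemma ram_program_poly (xs : idx F -> seq int) c k :
  (forall x : idx F, input x = nth 0 (xs x)) ->
  (forall (x : idx F) a, small (weight x) (input x a)) ->
  (forall x : idx F, nth 0 (xs x) 0%N = (dim x)%:Z) -> (forall x : idx F, size (xs x) = input_size (dim x)) ->
  wf_cmd c -> (k < num_arrays)%N ->
  poly_cost_run F c (fun (x : idx F) _ => 0) ->
  poly_bits F (fun x : idx F => run (input x) c (fun=> 0) k) ->
  exists q : {poly nat}, forall x : idx F,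
    runs (ram_program c k) (initial_state (xs x))
      (fun st => forall i : 'I_(dim x), memory st i = run (input x) c (fun=> 0) k i i)
      q.[weight x].
Proof.
move=> xsE xW x0 sx wc kK pc pk.
have [d H] : poly_bounded (@weight F) (fun x => 2 * weight x + 4 +
    (run_cost (input x) (weight x) c (fun=> 0%R : 'M[int]_(dim x)) +
     output_cost (weight x + maxbits (run (input x) c (fun=> 0%R : 'M[int]_(dim x))) [:: k]) k))%N.
  apply: poly_bounded_add; first by poly.
  apply: poly_bounded_add pc _; apply: (poly_bounded_comp (g := output_cost^~ k)).
    exact: poly_bounded_output_cost.
  apply: poly_bounded_add; first exact: poly_bounded_weight.
  by apply: poly_bounded_maxbits => k'; rewrite inE => /eqP->.
exists (('X + 2%:P) ^+ d) => x; rewrite horner_exp hornerD hornerX hornerC natrXE natrDE.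
have := runs_ram_program (W := weight x) (x := xs x) (weight_gt0 x) (dim_weight x) _ (x0 x) (sx x) wc kK.
rewrite -xsE => /(_ (xW x)) H'; apply: runs_weaken H' _ _ => //; exact: H.
Qed.

End families.

(** * The Faddeev-LeVerrier algorithm *)

Lemma deriv_prod (R : comNzRingType) (I : eqType) (r : seq I) (f : I -> {poly R}) :
  uniq r ->
  (\prod_(i <- r) f i)^`() = \sum_(i <- r) (f i)^`() * \prod_(j <- r | j != i) f j.
Proof.
elim: r => [|a r IH] /=; first by rewrite !big_nil derivC.
move=> /andP[ar ur]; rewrite !big_cons derivM IH // eqxx; congr (_ + _).
  congr (_ * _); rewrite [RHS]big_seq_cond [LHS]big_seq; apply: eq_bigl => j.
  by case: (boolP (j \in r)) => //= jr; apply/esym/eqP => E; rewrite -E jr in ar.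
rewrite mulr_sumr [LHS]big_seq [RHS]big_seq; apply: eq_bigr => i ir.
rewrite big_cons ifT; first by rewrite mulrCA.
by apply/eqP => E; rewrite E ir in ar.
Qed.

(** The product rule is applied to each term of the Leibniz expansion; the factor that is
    differentiated selects the row. *)
Lemma deriv_det (R : comNzRingType) n (M : 'M[{poly R}]_n) :
  (\det M)^`() = \sum_i \det (\matrix_(k, j) if k == i then (M k j)^`() else M k j).
Proof.
rewrite /determinant raddf_sum exchange_big /=; apply: eq_bigr => s _.
rewrite -mulr_sumr; set e := _ ^+ _; have -> : e = ((-1) ^+ perm.odd_perm s)%:P.
  by rewrite rmorphXn rmorphN rmorph1.
rewrite derivM derivC mul0r add0r deriv_prod ?index_enum_uniq //; congr (_ * _).
apply: eq_bigr => i _; rewrite [RHS](bigD1 i) //= mxE eqxx; congr (_ * _).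
by apply: eq_bigr => j ji; rewrite mxE (negbTE ji).
Qed.

Lemma deriv_char_poly (R : comNzRingType) n (A : 'M[R]_n) :
  (char_poly A)^`() = \tr (\adj (char_poly_mx A)).
Proof.
rewrite /char_poly deriv_det; apply: eq_bigr => i _.
(* In the differentiated row only the diagonal entry survives, with derivative 1; expansion along
   that row leaves the diagonal cofactor. *)
set M := char_poly_mx A; rewrite (expand_det_row _ i) (bigD1 i) //= big1 => [|j ji].
  rewrite addr0 [\adj _ _ _]mxE !mxE !eqxx mulr1n derivB derivX derivC subr0 mul1r.
  rewrite /cofactor; congr (_ * \det _); apply/matrixP => a b; rewrite !mxE.
  by rewrite eq_sym (negbTE (neq_lift i a)).
by rewrite !mxE eqxx (eq_sym i) (negbTE ji) mulr0n derivB !derivC subr0 mul0r.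
Qed.

Section coefficients.
Variables (R : comNzRingType) (n : nat) (A : 'M[R]_n).

(** The adjugate of [X - A], read as a polynomial with matrix coefficients. *)
Definition adj_coef k : 'M[R]_n := \matrix_(i, j) (\adj (char_poly_mx A) i j)`_k.

(** Comparison of the coefficients of degree [k + 1] in the identity saying that [X - A] times its
    adjugate is the scalar matrix of [char_poly A]. *)
Lemma adj_coefP k :
  adj_coef k = A *m adj_coef k.+1 + ((char_poly A)`_k.+1)%:M.
Proof.
apply/matrixP => i j; have /matrixP/(_ i j) := mul_mx_adj (char_poly_mx A).
rewrite /char_poly_mx mulmxBl mul_scalar_mx !mxE.
move/(congr1 (fun p : {poly R} => p`_k.+1)).
rewrite coefB coefXM /= coefMn -/(char_poly A) coef_sum => /eqP.
rewrite subr_eq => /eqP ->; rewrite addrC; congr (_ + _); apply: eq_bigr => l _.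
by rewrite !mxE coefCM.
Qed.

Lemma adj_coef0 : A *m adj_coef 0 = - ((char_poly A)`_0)%:M.
Proof.
apply/matrixP => i j; have /matrixP/(_ i j) := mul_mx_adj (char_poly_mx A).
rewrite /char_poly_mx mulmxBl mul_scalar_mx !mxE.
move/(congr1 (fun p : {poly R} => p`_0)).
rewrite coefB coefXM /= coefMn -/(char_poly A) coef_sum sub0r => <-.
by rewrite opprK; apply: eq_bigr => l _; rewrite !mxE coefCM.
Qed.

(** Descending induction in place of a degree estimate for cofactors: the coefficients vanish from
    some degree on, and [adj_coefP] carries this down to [n], because [char_poly A] has no
    coefficients above degree [n]. *)
Lemma adj_coef_big k : (n <= k)%N -> adj_coef k = 0.
Proof.
have [K HK] : exists K, forall k, (K <= k)%N -> adj_coef k = 0.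
  exists (\max_i \max_j size (\adj (char_poly_mx A) i j)) => l Kl.
  apply/matrixP => i j; rewrite mxE [RHS]mxE nth_default //; apply: leq_trans Kl.
  by move: (leqnn (\max_i \max_j size (\adj (char_poly_mx A) i j))) => /bigmax_leqP /(_ i isT) /bigmax_leqP; apply.
have step d : forall l, (n <= l)%N -> (K <= l + d)%N -> adj_coef l = 0.
  elim: d => [|d IH] l nl Kl; first by apply: HK; rewrite addn0 in Kl.
  rewrite adj_coefP IH ?mulmx0 ?add0r; last by rewrite addSnnS.
    by rewrite nth_default ?size_char_poly // raddf0.
  exact: leqW.
by move=> nk; apply: (step K) => //; rewrite leq_addl.
Qed.

Lemma mxtrace_adj_coef k : \tr (adj_coef k) = (char_poly A)`_k.+1 *+ k.+1.
Proof.
rewrite -coef_deriv deriv_char_poly /mxtrace coef_sum.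
by apply: eq_bigr => i _; rewrite mxE.
Qed.

(** Taking traces in [adj_coefP] and computing the trace of the adjugate as the derivative of the
    characteristic polynomial gives two expressions for the same number. This is why the division in
    [faddeev] is exact. *)
Lemma mxtrace_mul_adj_coef k : (k <= n)%N ->
  \tr (A *m adj_coef k) = - ((char_poly A)`_k *+ (n - k)).
Proof.
case: k => [|k] kn.
  by rewrite adj_coef0 raddfN /= mxtrace_scalar subn0.
have := mxtrace_adj_coef k; rewrite adj_coefP mxtraceD mxtrace_scalar => /eqP.
rewrite eq_sym -subr_eq => /eqP <-; apply/eqP.
by rewrite subr_eq addrC -mulrnBr ?leq_subr // subKn.
Qed.

End coefficients.

Fixpoint faddeev n (A : 'M[int]_n) k : 'M[int]_n * int :=
  if k is k'.+1 then
    let M := A *m (faddeev A k').1 + (faddeev A k').2%:M in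
    (M, ((- \tr (A *m M)) %/ k%:Z)%Z)
  else (0, 1).

Lemma faddeevE n (A : 'M[int]_n) k : (k <= n)%N ->
  faddeev A k = (if k is 0 then 0 else adj_coef A (n - k), (char_poly A)`_(n - k)).
Proof.
elim: k => [|k IH] kn.
  rewrite /= subn0; congr (_, _); have /monicP := char_poly_monic A.
  by rewrite /lead_coef size_char_poly.
have E : A *m (faddeev A k).1 + (faddeev A k).2%:M = adj_coef A (n - k.+1).
  rewrite IH ?(ltnW kn) //= [RHS]adj_coefP subnSK //; congr (_ *m _ + _).
  (* In the first round the start value 0 is indeed the coefficient of degree [n] of the
     adjugate. *)
  by case: k {IH} kn => // _; rewrite subn0 adj_coef_big.
rewrite /= E mxtrace_mul_adj_coef ?leq_subr // subKn // opprK -mulr_natl.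
by rewrite natz mulKz.
Qed.

(** Up to the factor [- (faddeev A n).2], the last matrix is the inverse of [A]. *)
Lemma faddeev_solve n (A : 'M[int]_n) : (0 < n)%N ->
  A *m (faddeev A n).1 = - (faddeev A n).2%:M.
Proof. by case: n A => // n A _; rewrite faddeevE // subnn adj_coef0. Qed.

Lemma faddeev_det n (A : 'M[int]_n) : (faddeev A n).2 = (-1) ^+ n * \det A.
Proof. by rewrite faddeevE // subnn -char_poly_det. Qed.

(** * Hitting values of a Markov chain *)

Section backward.
Variables (T : finType) (e : rel T) (X : {set T}).

Definition backward_step (S : {set T}) : {set T} :=
  X :|: [set s | [exists t in S, e s t]]%SET.

(** The states with a path into [X]. Over ['I_n] the least fixed point unfolds to [n] iterations
    from the empty set, which is exactly what [CIter] executes. *)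
Definition backward : {set T} := fixset backward_step.

Lemma backward_step_mono : {homo backward_step : A B / A \subset B}.
Proof.
move=> A B AB; apply: finset.setUS; apply/fintype.subsetP => s.
rewrite !inE => /existsP[t /andP[tA est]]; apply/existsP; exists t.
by rewrite est (fintype.subsetP AB).
Qed.

Lemma backwardE : backward = backward_step backward.
Proof. by rewrite /backward fixsetK //; exact: backward_step_mono. Qed.

Lemma sub_backward s : s \in X -> s \in backward.
Proof. by move=> sX; rewrite backwardE inE sX. Qed.

Lemma backward_pred s t : e s t -> t \in backward -> s \in backward.
Proof.
move=> est tB; rewrite backwardE inE; apply/orP; right; rewrite inE.
by apply/existsP; exists t; rewrite tB.
Qed.

Lemma backward_ind (Q : T -> Prop) : (forall s, s \in X -> Q s) ->
  (forall s t, e s t -> t \in backward -> Q t -> Q s) ->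
  forall s, s \in backward -> Q s.
Proof.
move=> QX Qe; suff H k s : s \in iter k backward_step finset.set0 -> Q s by move=> s; apply: H.
elim: k s => [|k IH] s; first by rewrite inE.
rewrite iterS inE => /orP[/QX//|]; rewrite inE => /existsP[t /andP[tk est]].
apply: (Qe _ _ est); last exact: IH.
exact: (fintype.subsetP (iter_sub_fix backward_step_mono k)).
Qed.

End backward.

Section chain.
Variables (R : realFieldType) (n : nat) (P : 'M[R]_n).
Hypothesis P_ge0 : forall s t, 0 <= P s t.
Hypothesis P_sum : forall s, \sum_t P s t <= 1.

Definition edge : rel 'I_n := fun s t => 0 < P s t.

Definition avg (v : 'I_n -> R) s : R := \sum_t P s t * v t.

Lemma avg_ge0 v s : (forall t, 0 <= v t) -> 0 <= avg v s.
Proof. by move=> v0; apply: sumr_ge0 => t _; rewrite mulr_ge0. Qed.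

Lemma ler_avg v w s : (forall t, v t <= w t) -> avg v s <= avg w s.
Proof. by move=> vw; apply: ler_sum => t _; rewrite ler_wpM2l. Qed.

Lemma avg_le1 v s : (forall t, v t <= 1) -> avg v s <= 1.
Proof.
move=> v1; apply: le_trans (P_sum s); apply: ler_sum => t _.
by rewrite ler_piMr.
Qed.

Lemma avg_lin (c d : R) v w s : avg (fun t => c * v t - d * w t) s = c * avg v s - d * avg w s.
Proof. by rewrite /avg !mulr_sumr -sumrB; apply: eq_bigr => t _; ring. Qed.

Lemma avgB v w s : avg (fun t => v t - w t) s = avg v s - avg w s.
Proof. by rewrite /avg -sumrB; apply: eq_bigr => t _; ring. Qed.

Lemma avg_zero v s : (forall t, edge s t -> v t = 0) -> avg v s = 0.
Proof.
move=> H; apply: big1 => t _; have := P_ge0 s t; rewrite le_eqVlt => /orP[/eqP<-|/H->].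
  by rewrite mul0r.
by rewrite mulr0.
Qed.

(** At a state with positive maximal value, subharmonicity forces every successor to be maximal too.
    The maximum would thus travel along a path into [E], where [f] is not positive. *)
Lemma max_principle (E : {set 'I_n}) (f : 'I_n -> R) :
  (forall s, s \in E -> f s <= 0) ->
  (forall s, f s <= 0 \/ s \in backward edge E /\ f s <= avg f s) ->
  forall s, f s <= 0.
Proof.
move=> fE fP s0; case: (@arg_maxP _ _ _ s0 xpredT f isT) => s _ fmax'.
have fmax t : f t <= f s by exact: fmax'.
suff fs : f s <= 0 by apply: le_trans (fmax s0) fs.
case: (fP s) => [//|[sE _]]; rewrite leNgt; apply/negP => fs0.
have H : forall s', s' \in backward edge E -> f s' <> f s.
  apply: backward_ind => [s' /fE le0 eq_s|s' t est _ Ht eq_s].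
    by rewrite eq_s leNgt fs0 in le0.
  case: (fP s'); rewrite eq_s; first by rewrite leNgt fs0.
  move=> [_]; apply/negP; rewrite -ltNge.
  have ft : f t < f s by rewrite lt_neqAle; apply/andP; split; [apply/eqP|exact: fmax].
  apply: (@lt_le_trans _ _ (\sum_t' P s' t' * f s)).
    rewrite /avg (bigD1 t) //= [ltRHS](bigD1 t) //=; apply: ltr_leD.
      by rewrite ltr_pM2l.
    by apply: ler_sum => t' _; rewrite ler_wpM2l // fmax.
  by rewrite -mulr_suml ler_piMl // ltW.
exact: (H s sE).
Qed.

(* [v s] is the expectation of [f] at the first visit of [X] from [s], counting [0]
   on the paths that never visit [X]. *)
Definition is_hit (X : {set 'I_n}) (f v : 'I_n -> R) : Prop :=
  [/\ forall s, s \in X -> v s = f s,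
      forall s, s \notin X -> v s = avg v s &
      forall s, s \notin backward edge X -> v s = 0].

(** The vanishing clause of [is_hit] is decisive: on a closed class avoiding [X] whose rows sum to
    1, every constant is harmonic. *)
Lemma is_hit_unique X f v w : is_hit X f v -> is_hit X f w -> v =1 w.
Proof.
suff H v' w' : is_hit X f v' -> is_hit X f w' -> forall s, v' s - w' s <= 0.
  move=> hv hw s; apply: le_anti.
  by rewrite -subr_le0 (H _ _ hv hw) -subr_le0 (H _ _ hw hv).
move=> [vX vP v0] [wX wP w0]; apply: (max_principle (E := X)) => s.
  by move=> sX; rewrite vX // wX // subrr.
have [sX|sX] := boolP (s \in X); first by left; rewrite vX // wX // subrr.
have [sB|sB] := boolP (s \in backward edge X); last by left; rewrite v0 // w0 // subrr.
by right; split => //; rewrite vP // wP // avgB.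
Qed.

Lemma is_hit_lin X c d f g v w : is_hit X f v -> is_hit X g w ->
  is_hit X (fun s => c * f s - d * g s) (fun s => c * v s - d * w s).
Proof.
move=> [vX vP v0] [wX wP w0]; split => s.
- by move=> sX; rewrite vX ?wX.
- by move=> sX; rewrite avg_lin -vP -?wP.
- by move=> sB; rewrite v0 ?w0 // !mulr0 subrr.
Qed.

(* Truncation of [is_hit] to [k] steps; the reward may depend on the number of
   steps left. *)
Fixpoint hit_upto (X : {set 'I_n}) (f : nat -> 'I_n -> R) (k : nat) (s : 'I_n) : R :=
  if s \in X then f k s else if k is k'.+1 then avg (hit_upto X f k') s else 0.

Lemma hit_upto_in (X : {set 'I_n}) f k s : s \in X -> hit_upto X f k s = f k s.
Proof. by case: k => [|k] /= ->. Qed.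

Lemma hit_uptoS (X : {set 'I_n}) f k s :
  s \notin X -> hit_upto X f k.+1 s = avg (hit_upto X f k) s.
Proof. by move=> /= /negbTE->. Qed.

Lemma hit_upto_backward (X : {set 'I_n}) f k s :
  s \notin backward edge X -> hit_upto X f k s = 0.
Proof.
elim: k s => [|k IH] s sB /=.
  by case: ifP => // /(sub_backward edge); rewrite (negbTE sB).
case: ifP => [/(sub_backward edge)|_]; first by rewrite (negbTE sB).
apply: avg_zero => t est; apply: IH.
by apply: contra sB => tB; apply: backward_pred est tB.
Qed.

Section bounded_reward.
Variables (X : {set 'I_n}) (f : nat -> 'I_n -> R).
Hypothesis f_ge0 : forall k s, 0 <= f k s.

Lemma hit_upto_ge0 k s : 0 <= hit_upto X f k s.
Proof.
by elim: k s => [|k IH] s /=; case: ifP => // _; apply: avg_ge0.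
Qed.

Lemma hit_upto_le1 : (forall k s, f k s <= 1) -> forall k s, hit_upto X f k s <= 1.
Proof.
by move=> f1; elim=> [|k IH] s /=; case: ifP => // _; apply: avg_le1.
Qed.

Lemma hit_upto_homo : (forall k s, f k s <= f k.+1 s) ->
  forall s, {homo (hit_upto X f)^~ s : k l / (k <= l)%N >-> k <= l}.
Proof.
move=> fS s; apply: homo_leq => [x|y x z xy|k]; [exact: lexx|exact: le_trans|].
elim: k s => [|k IH] s; rewrite /=; case: ifP => // sX.
  by apply: avg_ge0 => t; case: ifP.
by apply: ler_avg => t; exact: IH.
Qed.

End bounded_reward.

Lemma ler_hit_upto (X : {set 'I_n}) f g k s : (forall k s, f k s <= g k s) ->
  hit_upto X f k s <= hit_upto X g k s.
Proof.
move=> fg; elim: k s => [|k IH] s /=; case: ifP => // _; exact: ler_avg.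
Qed.

End chain.

(** * Optimal stopping *)

Section optimal_cause.
Variables (R : realFieldType) (n : nat) (P : 'M[R]_n).
Hypothesis P_ge0 : forall s t, 0 <= P s t.
Hypothesis P_sum : forall s, \sum_t P s t <= 1.
Variables (E : {set 'I_n}) (i0 : 'I_n) (h : 'I_n -> R) (a b : {set 'I_n} -> 'I_n -> R).
Hypothesis E_terminal : forall s t, s \in E -> P s t = 0.
Hypothesis h_hit : is_hit P E (fun=> 1) h.
Hypothesis h_init : 0 < h i0.

Definition candidates : {set 'I_n} := [set c | (c \notin E) && (h i0 < h c)]%SET.
Let C := candidates.

Hypothesis a_hit : forall X : {set 'I_n}, X \subset C -> is_hit P X h (a X).
Hypothesis b_hit : forall X : {set 'I_n}, X \subset C -> is_hit P X (fun=> 1) (b X).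
Hypothesis b_ge0 : forall (X : {set 'I_n}) s, X \subset C -> 0 <= b X s.
Hypothesis b_le1 : forall (X : {set 'I_n}) s, X \subset C -> b X s <= 1.

Let B := backward (edge P) E.

(* Dinkelbach's parametrisation: [F X <= l] iff [V l X i0 <= l * h i0]. *)
Let F (X : {set 'I_n}) : R := 2 * a X i0 / (b X i0 + h i0).
Let V (l : R) (X : {set 'I_n}) (s : 'I_n) : R := 2 * a X s - l * b X s.
(** The factor 1 keeps the shape produced by [is_hit_lin]. *)
Let g (l : R) (s : 'I_n) : R := 2 * h s - l * 1.

Let V_hit l (X : {set 'I_n}) : X \subset C -> is_hit P X (g l) (V l X).
Proof. by move=> XC; apply: is_hit_lin; [exact: a_hit|exact: b_hit]. Qed.

Let C_backward s : s \in C -> s \in B.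
Proof.
rewrite inE => /andP[_ hs]; apply/negPn/negP => sB; have [_ _ h0] := h_hit.
by move: hs; rewrite (h0 _ sB) ltNge ltW.
Qed.

Let backward_sub (X : {set 'I_n}) s : X \subset C -> s \in backward (edge P) X -> s \in B.
Proof.
move=> XC; move: s; apply: backward_ind => [s sX|s t est _ tB].
  by apply: C_backward; apply: (fintype.subsetP XC).
exact: backward_pred est tB.
Qed.

Let V_out l (X : {set 'I_n}) s : X \subset C -> s \notin B -> V l X s = 0.
Proof.
move=> XC sB; have [_ _ ->] := V_hit l XC => //.
by apply: contra sB; apply: backward_sub.
Qed.

Let V_E l (X : {set 'I_n}) s : X \subset C -> s \in E -> V l X s = 0.
Proof.
move=> XC sE; have [_ H _] := V_hit l XC; rewrite H.
  by apply: big1 => t _; rewrite E_terminal // mul0r.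
by apply/negP => /(fintype.subsetP XC); rewrite inE sE.
Qed.

(* Optional stopping: a superharmonic majorant of the reward on [Z] bounds the
   expected reward of stopping at [Z]. *)
Let V_le l (Z : {set 'I_n}) (u : 'I_n -> R) : Z \subset C ->
  (forall s, s \in E -> 0 <= u s) -> (forall s, s \notin B -> 0 <= u s) ->
  (forall s, s \in Z -> g l s <= u s) ->
  (forall s, s \notin E -> s \notin Z -> avg P u s <= u s) ->
  forall s, V l Z s <= u s.
Proof.
move=> ZC uE uB uZ uP s; rewrite -subr_le0; move: s.
have [VZ VP _] := V_hit l ZC.
apply: (max_principle P_ge0 P_sum (E := E)) => s.
  by move=> sE; rewrite V_E // sub0r oppr_le0 uE.
have [sE|sE] := boolP (s \in E); first by left; rewrite V_E // sub0r oppr_le0 uE.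
have [sZ|sZ] := boolP (s \in Z); first by left; rewrite VZ // subr_le0 uZ.
have [sB|sB] := boolP (s \in B); last by left; rewrite V_out // sub0r oppr_le0 uB.
by right; split => //; rewrite avgB -VP // lerB // uP.
Qed.

(** Policy improvement: [Y] maximises the sum of its values over all states. If one of the two
    inequalities failed at [c], removing or adding [c] would lower no value and raise the one at
    [c]. *)
Let exists_optimal_stopping l : exists Y : {set 'I_n}, [/\ Y \subset C,
  forall s, avg P (V l Y) s <= V l Y s & forall s, s \in C -> g l s <= V l Y s].
Proof.
pose phi (Y : {set 'I_n}) := \sum_s V l Y s.
have sub0 : (finset.set0 : {set 'I_n}) \subset C by exact: finset.sub0set.
case: (@arg_maxP _ _ _ finset.set0 (fun Y : {set 'I_n} => Y \subset C) phi sub0) => Y YC Ymax.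
have no_better (Y' : {set 'I_n}) c : Y' \subset C -> (forall s, V l Y s <= V l Y' s) -> ~ V l Y c < V l Y' c.
  move=> YC' le lt; have : phi Y' <= phi Y by exact: Ymax.
  rewrite leNgt => /negP; apply.
  rewrite /phi (bigD1 c) //= [ltRHS](bigD1 c) //=; apply: ltr_leD => //.
  by apply: ler_sum.
have [YV YP Y0] := V_hit l YC.
exists Y; split => // c.
(* If going on from [c] beats stopping there, [V l Y] is subharmonic off the smaller set, so the
   maximum principle makes that set at least as good everywhere. *)
- have [cY|cY] := boolP (c \in Y); last by rewrite -YP.
  rewrite leNgt; apply/negP => lt; pose Y' := (Y :\ c)%SET.
  have YC' : Y' \subset C by apply: fintype.subset_trans (finset.subsetDl _ _) YC.
  have [YV' YP' _] := V_hit l YC'.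
  have cY' : c \notin Y' by rewrite !inE eqxx.
  have le s : V l Y s <= V l Y' s.
    rewrite -subr_le0; move: s; apply: (max_principle P_ge0 P_sum (E := E)) => s.
      by move=> sE; rewrite !V_E // subrr.
    have [sB|sB] := boolP (s \in B); last by left; rewrite !V_out // subrr.
    have [sY'|sY'] := boolP (s \in Y').
      by left; rewrite YV' // YV ?subrr //; move: sY'; rewrite inE => /andP[].
    right; split => //; rewrite avgB -YP' // lerB //.
    have [->|sc] := eqVneq s c; first exact: ltW.
    by rewrite -YP //; apply: contra sY' => sY; rewrite !inE sc.
  by apply: (no_better Y' c) => //; rewrite (YP' c) //; apply: lt_le_trans lt _; apply: ler_avg.
(* If stopping at [c] beats the present value, enlarging the set raises the value at [c] and, again
   by the maximum principle, lowers none. *)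
- move=> cC; have [cY|cY] := boolP (c \in Y); first by rewrite YV.
  rewrite leNgt; apply/negP => lt; pose Y' := (c |: Y)%SET.
  have YC' : Y' \subset C by rewrite finset.subUset finset.sub1set cC.
  have [YV' YP' _] := V_hit l YC'.
  have cY' : c \in Y' by rewrite !inE eqxx.
  have le s : V l Y s <= V l Y' s.
    rewrite -subr_le0; move: s; apply: (max_principle P_ge0 P_sum (E := E)) => s.
      by move=> sE; rewrite !V_E // subrr.
    have [sB|sB] := boolP (s \in B); last by left; rewrite !V_out // subrr.
    have [->|sc] := eqVneq s c; first by left; rewrite YV' // subr_le0 ltW.
    have [sY|sY] := boolP (s \in Y).
      by left; rewrite YV' ?YV ?subrr // !inE sY orbT.
    by right; split => //; rewrite avgB -YP' -?YP // !inE negb_or sc.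
  by apply: (no_better Y' c) => //; rewrite YV'.
Qed.

(* One round of pruning: drop the states where going on to the next visit of [X]
   beats stopping, for the multiplier [l = F X]. *)
Definition prune (X : {set 'I_n}) : {set 'I_n} :=
  [set c in X | a X i0 * (1 - avg P (b X) c)
                <= (h c - avg P (a X) c) * (b X i0 + h i0)]%SET.

Let den_gt0 (X : {set 'I_n}) : X \subset C -> 0 < b X i0 + h i0.
Proof. by move=> XC; apply: ltr_wpDl => //; apply: b_ge0. Qed.

(** The test of [prune] is the comparison of going on with stopping, multiplied by the positive
    denominator of [F X]; in that form it can be decided without divisions. *)
Let pruneP (X : {set 'I_n}) c : X \subset C ->
  (a X i0 * (1 - avg P (b X) c) <= (h c - avg P (a X) c) * (b X i0 + h i0)) =
  (avg P (V (F X) X) c <= g (F X) c).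
Proof.
move=> XC; have d0 := den_gt0 XC; rewrite avg_lin /g mulr1 -subr_ge0 -[RHS]subr_ge0.
rewrite -[RHS](pmulr_lge0 _ d0) -[RHS](pmulr_lge0 _ (ltr0Sn R 1)) -[LHS](pmulr_lge0 _ (ltr0Sn R 1)).
rewrite -[LHS](pmulr_lge0 _ (ltr0Sn R 1)).
congr (0 <= _); have Fd : F X * (b X i0 + h i0) = 2 * a X i0 by rewrite /F divfK // gt_eqF.
have -> : (2 * h c - F X - (2 * avg P (a X) c - F X * avg P (b X) c)) * (b X i0 + h i0) =
   2 * (h c - avg P (a X) c) * (b X i0 + h i0) - (F X * (b X i0 + h i0)) * (1 - avg P (b X) c) by ring.
rewrite Fd; ring.
Qed.

Lemma prune_sub (X : {set 'I_n}) : prune X \subset X.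
Proof. by apply/fintype.subsetP => c; rewrite inE => /andP[]. Qed.

Lemma iter_prune_sub k : iter k prune C \subset C.
Proof.
by elim: k => [|k IH] //=; apply: fintype.subset_trans (prune_sub _) IH.
Qed.

(** A round that changes the set loses a state: after [n] rounds the set is either stable or empty,
    and the empty set is stable. *)
Lemma iter_prune_fix : prune (iter n prune C) = iter n prune C.
Proof.
have H k : (#|iter k prune C| + k <= n)%N \/ prune (iter k prune C) = iter k prune C.
  elim: k => [|k [IH|IH]]; first by left; rewrite addn0 -[leqRHS](card_ord n) max_card.
    have [eq|ne] := eqVneq (prune (iter k prune C)) (iter k prune C).
      by right; rewrite iterS eq.
    left; rewrite iterS addnS; apply: leq_trans IH; rewrite ltn_add2r.
    by apply: proper_card; rewrite finset.properEneq ne prune_sub.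
  by right; rewrite iterS IH.
case: (H n) => // le; have : #|iter n prune C| == 0%N by rewrite -leqn0 -(leq_add2r n) add0n.
rewrite finset.cards_eq0 => /eqP ->; apply/eqP; rewrite -finset.subset0; exact: prune_sub.
Qed.

Let F_le l (X : {set 'I_n}) : X \subset C -> (F X <= l) = (V l X i0 <= l * h i0).
Proof.
by move=> XC; rewrite /F ler_pdivrMr ?den_gt0 // mulrDr -lerBlDl.
Qed.

Let F_ge l (X : {set 'I_n}) : X \subset C -> (l <= F X) = (l * h i0 <= V l X i0).
Proof.
by move=> XC; rewrite /F ler_pdivlMr ?den_gt0 // mulrDr -lerBrDl.
Qed.

Let V_F (X : {set 'I_n}) : X \subset C -> V (F X) X i0 = F X * h i0.
Proof.
move=> XC; have : F X * (b X i0 + h i0) = 2 * a X i0 by rewrite /F divfK // gt_eqF ?den_gt0.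
by rewrite mulrDr /V => <-; ring.
Qed.

Theorem iter_prune_optimal (Y : {set 'I_n}) : Y \subset C ->
  2 * a Y i0 / (b Y i0 + h i0) <=
  2 * a (iter n prune C) i0 / (b (iter n prune C) i0 + h i0).
Proof.
have sub0 : (finset.set0 : {set 'I_n}) \subset C by exact: finset.sub0set.
case: (@arg_maxP _ _ _ finset.set0 (fun Y : {set 'I_n} => Y \subset C) F sub0) => Z ZC Zmax YC.
rewrite -/(F Y) -/(F _); apply: le_trans (Zmax Y YC) _.
pose l := F Z; have [S [SC Ssup Sg]] := exists_optimal_stopping l.
have V_le_S (X : {set 'I_n}) s : X \subset C -> V l X s <= V l S s.
  move=> XC; apply: V_le => // [t tE|t tB|t tX].
  - by rewrite V_E.
  - by rewrite V_out.
  - by apply: Sg; apply: (fintype.subsetP XC).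
(* At [c] in [S], going on to [X] is no better than stopping for the multiplier [l]. Since
   [F X <= l] and [avg P (b X) c <= 1], lowering the multiplier to [F X] raises the reward of
   stopping at least as much as the value of going on, so [c] passes the test. *)
have S_sub k : S \subset iter k prune C.
  elim: k => // k IH; set X := iter k prune C in IH *; have XC := iter_prune_sub k.
  rewrite iterS; apply/fintype.subsetP => c cS; rewrite inE (fintype.subsetP IH) //= pruneP // -/X.
  have FX : F X <= l by exact: Zmax.
  have : V l S c = g l c by have [-> //] := V_hit l SC.
  have : avg P (V l X) c <= V l S c.
    by apply: le_trans (Ssup c); apply: ler_avg => // t; apply: V_le_S.
  have b1 : avg P (b X) c <= 1 by apply: avg_le1 => // t; apply: b_le1.
  rewrite /V !avg_lin /g !mulr1 => H1 H2.
  have : F X * (1 - avg P (b X) c) <= l * (1 - avg P (b X) c) by rewrite ler_wpM2r // subr_ge0.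
  move: H1; rewrite H2; lra.
(* [S] is at least as good as [Z] for the parametrised reward, and the value of [Z] equals
   [l * h i0] by the choice of [l]. *)
have FS : l <= F S by rewrite F_ge //; apply: le_trans (V_le_S Z i0 ZC); rewrite V_F.
apply: le_trans FS _; set X := iter n prune C; have XC : X \subset C := iter_prune_sub n.
have [VX VP _] := V_hit (F X) XC.
(* For the multiplier [F X], the value of [X] equals the reward on [S], as [S] is contained in [X].
   It is superharmonic: by harmonicity off [X], and on [X] because [X] is stable under pruning. *)
rewrite F_le // -V_F //; apply: V_le => // [t tE|t tB|t tS|t tE tS].
- by rewrite V_E.
- by rewrite V_out.
- by rewrite VX //; apply: (fintype.subsetP (S_sub n)).
- have [tX|tX] := boolP (t \in X); last by rewrite -VP.
  have : t \in prune X by rewrite (iter_prune_fix : prune X = X).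
  by rewrite inE VX // -pruneP // => /andP[].
Qed.

End optimal_cause.

(* The states reachable from [i0] along paths that meet [X] at most at their end. *)
Definition frontier (R : realFieldType) n (P : 'M[R]_n) (X : {set 'I_n}) (i0 : 'I_n) : {set 'I_n} :=
  backward (fun t s => edge P s t && (s \notin X)) [set i0]%SET.

(** * Hitting values as limits of truncations *)

Section hitting_limits.
Variables (R : realType) (n : nat) (P : 'M[R]_n).
Hypothesis P_ge0 : forall s t, 0 <= P s t.
Hypothesis P_sum : forall s, \sum_t P s t <= 1.
Local Open Scope classical_set_scope.

Lemma cvg_avg (u : nat -> 'I_n -> R) (l : 'I_n -> R) s :
  (forall t, u ^~ t @ \oo --> l t) -> (fun k => avg P (u k) s) @ \oo --> avg P l s.
Proof.
move=> ul; rewrite /avg; elim: index_enum => [|t r IH].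
  rewrite big_nil (_ : (fun _ => _) = fun=> 0); first exact: cvg_cst.
  by apply/funext => k; rewrite big_nil.
rewrite big_cons (_ : (fun _ => _) = (fun k => P s t * u k t + \sum_(j <- r) P s j * u k j)).
  by apply: cvgD => //; apply: cvgMr.
by apply/funext => k; rewrite big_cons.
Qed.

Section reward.
Variables (X : {set 'I_n}) (f : nat -> 'I_n -> R).
Hypotheses (f_ge0 : forall k s, 0 <= f k s) (f_le1 : forall k s, f k s <= 1).
Hypothesis f_homo : forall k s, f k s <= f k.+1 s.

Lemma hit_upto_is_cvg s : cvgn (fun k => hit_upto P X f k s).
Proof.
apply: nondecreasing_is_cvgn; first by apply: hit_upto_homo.
by exists 1 => _ [k _ <-]; apply: hit_upto_le1.
Qed.

(** Monotone convergence. Rewards that vary with the steps left are needed for the joint event of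
    cause and effect, where the reward is the probability of reaching the effect within the
    remaining steps. *)
Lemma lim_hit_upto g : (forall s, f ^~ s @ \oo --> g s) ->
  is_hit P X g (fun s => limn (fun k => hit_upto P X f k s)).
Proof.
move=> fg; split => s sX.
- apply/cvg_lim => //; rewrite (_ : (fun _ => _) = f ^~ s) //.
  by apply/funext => k; rewrite hit_upto_in.
- apply/cvg_lim => //; rewrite -cvg_shiftS.
  rewrite (_ : (fun _ => _) = (fun k => avg P (hit_upto P X f k) s)).
    by apply: cvg_avg => t; apply: hit_upto_is_cvg.
  by apply/funext => k; rewrite hit_uptoS.
- apply/cvg_lim => //; rewrite (_ : (fun _ => _) = fun=> 0); first exact: cvg_cst.
  by apply/funext => k; rewrite hit_upto_backward.
Qed.

Lemma cvg_hit_upto g v s : (forall s, f ^~ s @ \oo --> g s) -> is_hit P X g v ->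
  (fun k => hit_upto P X f k s) @ \oo --> v s.
Proof.
move=> fg vh; rewrite (is_hit_unique P_ge0 P_sum vh (lim_hit_upto fg)).
exact: hit_upto_is_cvg.
Qed.

End reward.

Definition hit (X : {set 'I_n}) (g : 'I_n -> R) (s : 'I_n) : R :=
  limn (fun k => hit_upto P X (fun=> g) k s).

Section constant_reward.
Variables (X : {set 'I_n}) (g : 'I_n -> R).
Hypotheses (g_ge0 : forall s, 0 <= g s) (g_le1 : forall s, g s <= 1).

Lemma hitP : is_hit P X g (hit X g).
Proof. by apply: lim_hit_upto => // s; exact: cvg_cst. Qed.

Lemma hit_ge0 s : 0 <= hit X g s.
Proof.
apply: limr_ge; first exact: hit_upto_is_cvg.
by apply: nearW => k; apply: hit_upto_ge0.
Qed.

Lemma hit_le1 s : hit X g s <= 1.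
Proof.
apply: limr_le; first exact: hit_upto_is_cvg.
by apply: nearW => k; apply: hit_upto_le1.
Qed.

(** From a frontier state outside [X], every step of positive probability stays in the frontier, so
    the first visit of [X] always happens at a frontier state. *)
Lemma hit_frontier i0 : hit (X :&: frontier P X i0)%SET g i0 = hit X g i0.
Proof.
have H k : forall s, s \in frontier P X i0 ->
    hit_upto P (X :&: frontier P X i0)%SET (fun=> g) k s = hit_upto P X (fun=> g) k s.
  elim: k => [|k IH] s sF /=; rewrite inE sF andbT //.
  case: (boolP (s \in X)) => // sX; apply: eq_bigr => t _.
  have := P_ge0 s t; rewrite le_eqVlt => /orP[/eqP<-|st]; first by rewrite !mul0r.
  by rewrite IH //; apply: (@backward_pred _ _ _ t s) => //; rewrite /edge st.
rewrite /hit; congr (limn _); apply/funext => k; apply: H.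
by apply: sub_backward; rewrite inE.
Qed.

End constant_reward.

Lemma ler_hit (X : {set 'I_n}) f g s : (forall s, 0 <= f s) -> (forall s, g s <= 1) -> (forall s, f s <= g s) ->
  hit X f s <= hit X g s.
Proof.
move=> f0 g1 fg.
have g0 t : 0 <= g t := le_trans (f0 t) (fg t).
have f1 t : f t <= 1 := le_trans (fg t) (g1 t).
apply: ler_lim; [exact: hit_upto_is_cvg|exact: hit_upto_is_cvg|].
by apply: nearW => k; apply: ler_hit_upto.
Qed.

(** Positivity is transported backwards along a path from [i0] to [c] that meets [X] only at its
    end. *)
Lemma hit_frontier_gt0 (X : {set 'I_n}) i0 c : c \in X -> c \in frontier P X i0 ->
  0 < hit X (fun s => (s == c)%:R) i0.
Proof.
move=> cX cF.
have g0 s : 0 <= (s == c)%:R :> R by rewrite ler0n.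
have g1 s : (s == c)%:R <= 1 :> R by rewrite lern1 leq_b1.
have [HX HP _] := hitP X g0 g1.
suff H s : s \in frontier P X i0 -> 0 < hit X (fun s => (s == c)%:R) s ->
    0 < hit X (fun s => (s == c)%:R) i0.
  by apply: (H c cF); rewrite HX // eqxx.
move: s; apply: backward_ind => [s|s t /andP[ts tX] _ IH s0].
  by rewrite inE => /eqP->.
apply: IH; rewrite HP //; apply: lt_le_trans (_ : P t s * hit X (fun s => (s == c)%:R) s <= _).
  by rewrite mulr_gt0.
rewrite /avg (bigD1 s) //= lerDl; apply: sumr_ge0 => t' _.
by rewrite mulr_ge0 // hit_ge0.
Qed.

End hitting_limits.

(** * Path probabilities *)

Section path_measure.
Local Open Scope classical_set_scope.
Variables (R : realType) (n : nat) (M : markov_chain n).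

Let mu := path_measure R M.

Lemma measurable_cylinder u : measurable (cylinder u : set (path_space n)).
Proof. by apply: sub_sigma_algebra; exists u. Qed.

Lemma cylinder_rcons (u : seq (option 'I_n)) :
  cylinder u = \bigcup_y cylinder (rcons u y) :> set (path_space n).
Proof.
apply/seteqP; split => [w|w [y _]]; rewrite /cylinder /=.
  by move=> wu; exists (w (size u)); rewrite //= size_rcons mkseqS wu.
by rewrite size_rcons mkseqS => /rcons_inj[].
Qed.

Lemma cylinder_at u (w : nat -> option 'I_n) k : cylinder u w -> (k < size u)%N -> w k = nth None u k.
Proof. by move=> wu ku; rewrite -[in RHS]wu nth_mkseq. Qed.

Lemma measurable_at k (Q : option 'I_n -> Prop) :
  measurable ([set w | Q (w k)] : set (path_space n)).
Proof.
rewrite (_ : [set w | _] = \bigcup_(u in [set u : k.+1.-tuple (option 'I_n) | Q (nth None u k)])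
   (cylinder (tval u) : set (path_space n))).
  by apply: fin_bigcup_measurable => [|u _]; [exact: finite_finset|exact: measurable_cylinder].
apply/seteqP; split => [w Qw|w [u Qu /cylinder_at wu]] /=.
  exists (@Tuple _ _ (mkseq w k.+1) (introT eqP (size_mkseq _ _))) => /=; first by rewrite nth_mkseq.
  by rewrite /cylinder /= size_map size_iota.
by rewrite wu // size_tuple.
Qed.

Lemma path_weight_rcons x (u : seq (option 'I_n)) y :
  path_weight M x (rcons u y) = path_weight M x u * path_step M (last x u) y.
Proof. by elim: u x => [|z u IH] x /=; rewrite ?mulr1 ?mul1r // IH mulrA. Qed.

Lemma mu_cylinder_sum u (A : set (path_space n)) : measurable A ->
  mu (cylinder u `&` A) = (\sum_(y : option 'I_n) mu (cylinder (rcons u y) `&` A))%E.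
Proof.
move=> mA; rewrite cylinder_rcons setI_bigcupl measure_fin_bigcup //; last first.
- by move=> y _; apply: measurableI => //; exact: measurable_cylinder.
- move=> y z _ _ [w [[+ _] [+ _]]]; rewrite /cylinder /= !size_rcons !mkseqS.
  by move=> /rcons_inj[_ <-] /rcons_inj[_ <-].
- exact: finite_finset.
rewrite [RHS]fsbig_seq ?index_enum_uniq // (_ : [set` index_enum _] = setT) //.
by apply/seteqP; split => // y _; rewrite /= mem_index_enum.
Qed.

Definition option_in (X : {set 'I_n}) (x : option 'I_n) : bool :=
  if x is Some s then s \in X else false.

(** Whether [X] is visited at one of the positions [m, ..., m + k] and the first such visit lies in
    [Z]. Taking [Z] equal to [X] yields [eventually], and a singleton yields [not_until]. *)
Fixpoint visits (X Z : {set 'I_n}) (k m : nat) (w : nat -> option 'I_n) : bool :=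
  if option_in X (w m) then option_in Z (w m)
  else if k is k'.+1 then visits X Z k' m.+1 w else false.

Lemma measurable_visits X Z k m : measurable ([set w | visits X Z k m w] : set (path_space n)).
Proof.
elim: k m => [|k IH] m; first exact: (measurable_at m (fun x => if option_in X x then option_in Z x else false)).
rewrite (_ : [set w | _] = [set w | option_in X (w m) && option_in Z (w m)] `|`
   ([set w | ~~ option_in X (w m)] `&` [set w | visits X Z k m.+1 w])).
  apply: measurableU; first exact: (measurable_at m (fun x => option_in X x && option_in Z x)).
  by apply: measurableI => //; exact: (measurable_at m (fun x => ~~ option_in X x)).
apply/seteqP; split => w /=; case: (option_in X (w m)) => /=.
- by left.
- by right.
- by case=> [|[]].
- by case=> [|[]].
Qed.

Lemma visitsS X Z k m w : visits X Z k m w -> visits X Z k.+1 m w.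
Proof.
elim: k m => [|k IH] m; rewrite /=; case: ifP => // _; exact: IH.
Qed.

Lemma visits_homo X Z m w k l : (k <= l)%N -> visits X Z k m w -> visits X Z l m w.
Proof. by move=> /subnK<-; elim: (l - k)%N => //= d IH /IH; apply: visitsS. Qed.

Let P : 'M[R]_n := map_mx ratr (trans M).
Let prefix_weight (u : seq (option 'I_n)) : R := ratr (path_weight M (Some (init M)) u).

Definition on_states (f : 'I_n -> R) (x : option 'I_n) : R := if x is Some s then f s else 0.

Lemma sum_path_step (f : 'I_n -> R) x :
  \sum_y ratr (path_step M x y) * on_states f y = on_states (avg P f) x.
Proof.
rewrite (bigD1 None) //= mulr0 add0r (reindex_omap Some id) /=; last by case.
rewrite (eq_bigl xpredT); last by move=> s; rewrite /= eqxx.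
case: x => [s|] /=; first by apply: eq_bigr => t _; rewrite mxE.
by apply: big1 => t _; rewrite rmorph0 mul0r.
Qed.

Lemma mu_cylinder_step u (A : set (path_space n)) f : measurable A ->
  (forall y, mu (cylinder (Some (init M) :: rcons u y) `&` A) =
             (prefix_weight (rcons u y) * on_states f y)%:E) ->
  mu (cylinder (Some (init M) :: u) `&` A) =
  (prefix_weight u * on_states (avg P f) (last (Some (init M)) u))%:E.
Proof.
move=> mA H; rewrite mu_cylinder_sum // (eq_bigr _ (fun y _ => H y)) sumEFin.
rewrite -sum_path_step mulr_sumr; congr (_%:E); apply: eq_bigr => y _.
by rewrite /prefix_weight path_weight_rcons rmorphM /= -mulrA.
Qed.

Lemma cylinder_last x (u : seq (option 'I_n)) w :
  cylinder (x :: u) w -> w (size u) = last x u.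
Proof. by move=> /cylinder_at/(_ (ltnSn _))->; rewrite nth_last. Qed.

Lemma mu_cylinder u : mu (cylinder (Some (init M) :: u)) = (prefix_weight u)%:E.
Proof. exact: path_measureP. Qed.

Lemma mu_visits X Z k u :
  mu (cylinder (Some (init M) :: u) `&` [set w | visits X Z k (size u) w]) =
  (prefix_weight u * on_states (hit_upto P X (fun _ s => (s \in Z)%:R) k)
                       (last (Some (init M)) u))%:E.
Proof.
elim: k u => [|k IH] u; set c := cylinder _; set x := last _ _;
  have xE w : c w -> w (size u) = x by [apply: cylinder_last];
  have [xX|xX] := boolP (option_in X x).
- have -> : on_states (hit_upto P X (fun _ s => (s \in Z)%:R) 0) x = (option_in Z x)%:R.
    by case: x xX {xE} => //= s ->.
  have vE w : c w -> visits X Z 0 (size u) w = option_in Z x by move=> /xE ww; rewrite /= ww xX.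
  case: (option_in Z x) vE => vE; rewrite ?mulr1 ?mulr0.
    by rewrite (_ : _ `&` _ = c) ?mu_cylinder //; apply/seteqP; split => [w []|w cw] //; split => //; exact: vE.
  by rewrite (_ : _ `&` _ = set0) ?measure0 //; apply/seteqP; split => w // [cw]; rewrite /mkset (vE w cw).
- rewrite (_ : on_states _ _ = 0) ?mulr0; last by case: x xX {xE} => //= s /negbTE->.
  rewrite (_ : _ `&` _ = set0) ?measure0 //; apply/seteqP; split => [w []|w] //= /xE ->.
  by rewrite (negbTE xX).
- have -> : on_states (hit_upto P X (fun _ s => (s \in Z)%:R) k.+1) x = (option_in Z x)%:R.
    by case: x xX {xE} => //= s ->.
  have vE w : c w -> visits X Z k.+1 (size u) w = option_in Z x by move=> /xE ww; rewrite /= ww xX.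
  case: (option_in Z x) vE => vE; rewrite ?mulr1 ?mulr0.
    by rewrite (_ : _ `&` _ = c) ?mu_cylinder //; apply/seteqP; split => [w []|w cw] //; split => //; exact: vE.
  by rewrite (_ : _ `&` _ = set0) ?measure0 //; apply/seteqP; split => w // [cw]; rewrite /mkset (vE w cw).
- rewrite (_ : _ `&` _ = c `&` [set w | visits X Z k (size u).+1 w]); last first.
    by apply/seteqP; split => w [cw] /=; rewrite (xE w cw) (negbTE xX).
  rewrite (_ : on_states _ _ = on_states (avg P (hit_upto P X (fun _ s => (s \in Z)%:R) k)) x).
    by apply: mu_cylinder_step => [|y]; [exact: measurable_visits|rewrite -(size_rcons u y) IH last_rcons].
  by case: (x) xX => //= s /negbTE->.
Qed.

(** At the first visit of [X] the reward is the chance of reaching [E] in the steps left. No path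
    meets [E] before [X] with positive probability, because [E] is terminal and disjoint from
    [X]. *)
Lemma mu_visits2 (X Z E : {set 'I_n}) k u :
  (forall s, s \in X -> s \notin E) -> (forall s t, s \in E -> trans M s t = 0) ->
  mu (cylinder (Some (init M) :: u) `&`
      ([set w | visits X Z k (size u) w] `&` [set w | visits E E k (size u) w])) =
  (prefix_weight u * on_states (hit_upto P X
      (fun k s => (s \in Z)%:R * hit_upto P E (fun _ s => (s \in E)%:R) k s) k)
      (last (Some (init M)) u))%:E.
Proof.
move=> XE Et.
pose f (k : nat) (s : 'I_n) : R := (s \in Z)%:R * hit_upto P E (fun _ s => (s \in E)%:R) k s.
rewrite -/f.
have avgE g s : s \in E -> avg P g s = 0.
  by move=> sE; apply: big1 => t _; rewrite mxE Et // rmorph0 mul0r.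
have stopped l v : option_in X (last (Some (init M)) v) ->
    mu (cylinder (Some (init M) :: v) `&`
      ([set w | visits X Z l (size v) w] `&` [set w | visits E E l (size v) w])) =
    (prefix_weight v * on_states (hit_upto P X f l) (last (Some (init M)) v))%:E.
  set c := cylinder _; set x := last _ _ => xX.
  have xE w : c w -> w (size v) = x by apply: cylinder_last.
  have vE w : c w -> visits X Z l (size v) w = option_in Z x.
    by move=> /xE ww; case: (l) => [|l'] /=; rewrite ww xX.
  have -> : on_states (hit_upto P X f l) x = (option_in Z x)%:R *
      on_states (hit_upto P E (fun _ s => (s \in E)%:R) l) x.
    by case: x xX {xE vE} => //= s sX; rewrite hit_upto_in.
  case: (option_in Z x) vE => vE.
    rewrite mul1r -mu_visits; congr (mu _); apply/seteqP; split => [w [cw [_ +]]|w [cw +]] //.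
    by move=> H; split => //; split => //=; rewrite vE.
  rewrite mul0r mulr0 (_ : _ `&` _ = set0) ?measure0 //.
  by apply/seteqP; split => w // [cw []]; rewrite /mkset (vE w cw).
elim: k u => [|k IH] u; have [xX|xX] := boolP (option_in X (last (Some (init M)) u));
  try exact: stopped.
- rewrite (_ : on_states _ _ = 0) ?mulr0; last by case: (last _ _) xX => //= s /negbTE->.
  rewrite (_ : _ `&` _ = set0) ?measure0 //; apply/seteqP; split => [w [/cylinder_last xE []]|w] //=.
  by rewrite xE (negbTE xX).
set c := cylinder _; set x := last _ _ in xX *.
have xE w : c w -> w (size u) = x by apply: cylinder_last.
have -> : on_states (hit_upto P X f k.+1) x = on_states (avg P (hit_upto P X f k)) x.
  by case: (x) xX => //= s /negbTE->.
have [xEff|xEff] := boolP (option_in E x).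
  rewrite (_ : on_states _ _ = 0); last by case: (x) xEff => //= s sE; rewrite avgE.
  (* [E] is already reached here, so only the event for [X] remains; it has probability 0 from a
     terminal state outside [X]. Writing this 0 as a hitting value makes [mu_visits] applicable. *)
  have <- : on_states (hit_upto P X (fun _ s => (s \in Z)%:R) k.+1) x = 0.
    by case: (x) xEff xX => //= s sE /negbTE->; rewrite avgE.
  rewrite -mu_visits; congr (mu _); apply/seteqP; split => [w [cw []]|w [cw H]] //.
  by split => //; split => //=; rewrite xE // xEff.
rewrite (_ : _ `&` _ = c `&` ([set w | visits X Z k (size u).+1 w] `&` [set w | visits E E k (size u).+1 w])).
  apply: mu_cylinder_step => [|y].
    by apply: measurableI; exact: measurable_visits.
  by rewrite -(size_rcons u y) IH last_rcons.
by apply/seteqP; split => w [cw] /=; rewrite (xE w cw) (negbTE xX) (negbTE xEff).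
Qed.

(** The cylinder of the initial state has weight 1, so all other sequences form a null set. *)
Lemma mu_init (A : set (path_space n)) : measurable A ->
  mu A = mu (cylinder [:: Some (init M)] `&` A).
Proof.
move=> mA; have mC := measurable_cylinder [:: Some (init M)].
have C1 : mu (cylinder [:: Some (init M)]) = 1%E.
  by rewrite mu_cylinder /prefix_weight /= rmorph1.
rewrite -[in LHS](setIT A) -(setUv (cylinder [:: Some (init M)])) setIUr measureU //.
- rewrite setIC [X in (_ + X)%E](_ : _ = 0%E) ?adde0 //.
  apply: (@subset_measure0 _ _ _ mu _ (~` cylinder [:: Some (init M)])) => //.
  + by apply: measurableI => //; apply: measurableC.
  + exact: measurableC.
  + by apply: (etrans (probability_setC mu mC)); rewrite C1 subee.
- exact: measurableI.
- by apply: measurableI => //; apply: measurableC.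
- by apply/seteqP; split => // w [[_ ?] [_ ?]].
Qed.

Lemma Pr_bigcup (A : nat -> set (path_space n)) (f : nat -> 'I_n -> R) (v : R) :
  (forall k, measurable (A k)) -> (forall k, A k `<=` A k.+1) ->
  (forall k, mu (cylinder [:: Some (init M)] `&` A k) = (prefix_weight [::] * on_states (f k) (Some (init M)))%:E) ->
  (fun k => f k (init M)) @ \oo --> v ->
  Pr R M (\bigcup_k A k) = v.
Proof.
move=> mA sA muA fv; rewrite /Pr -/mu.
have hA : {homo A : k l / (k <= l)%N >-> (k <= l)%O}.
  move=> k l /subnK <-; elim: (l - k)%N => [|d IH]; first exact: lexx.
  by apply: le_trans IH _; rewrite addSn; apply/subsetPset.
have mU : measurable (\bigcup_k A k) by apply: bigcupT_measurable.
have cv := nondecreasing_cvg_mu (mu := mu) mA mU hA.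
have E k : (mu \o A) k = (f k (init M))%:E.
  by rewrite /= mu_init // muA /prefix_weight /= rmorph1 mul1r.
have cv' : (fun k => (f k (init M))%:E) @ \oo --> mu (\bigcup_k A k).
  by rewrite (_ : (fun k => _) = mu \o A) //; apply/funext => k; rewrite E.
have cv2 : (fun k => (f k (init M))%:E) @ \oo --> v%:E by apply: cvg_EFin => //; exact: nearW.
by rewrite (cvg_unique _ cv' cv2).
Qed.

End path_measure.

Lemma is_hit_ext (R : realFieldType) n (P : 'M[R]_n) (X : {set 'I_n}) f g v :
  (forall s, s \in X -> f s = g s) -> is_hit P X f v -> is_hit P X g v.
Proof. by move=> fg [vX vP v0]; split => // s sX; rewrite vX // fg. Qed.

(** * Events as increasing unions of truncated visits *)

Section visits.
Local Open Scope classical_set_scope.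
Variable n : nat.
Implicit Types (X Z : {set 'I_n}) (w : nat -> option 'I_n).

Lemma visitsP X Z k m w : reflect
  (exists j, [/\ (j <= k)%N, option_in X (w (m + j)%N), option_in Z (w (m + j)%N) &
     forall i, (i < j)%N -> ~~ option_in X (w (m + i)%N)])
  (visits X Z k m w).
Proof.
elim: k m => [|k IH] m /=; case: ifP => wX.
- apply: (iffP idP) => [wZ|[j [+ _ wZ _]]]; first by exists 0%N; rewrite addn0.
  by rewrite leqn0 => /eqP j0; rewrite j0 addn0 in wZ.
- by constructor => -[j []]; rewrite leqn0 => /eqP->; rewrite addn0 wX.
- apply: (iffP idP) => [wZ|[j [_ jX wZ jl]]]; first by exists 0%N; rewrite addn0.
  case: j jX wZ jl => [|j]; first by rewrite addn0.
  by move=> _ _ /(_ 0%N isT); rewrite addn0 wX.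
- apply: (iffP (IH m.+1)) => [[j [jk jX jZ jl]]|[j [jk jX jZ jl]]].
    exists j.+1; rewrite addnS -addSn; split => // -[|i]; first by rewrite addn0 wX.
    by rewrite addnS -addSn; exact: jl.
  case: j jk jX jZ jl => [|j] jk jX jZ jl; first by rewrite addn0 wX in jX.
  exists j; rewrite addSn -addnS; split => // i ij; rewrite addSn -addnS.
  by apply: jl.
Qed.

Lemma visits_cup_homo X Z : forall k,
  [set w | visits X Z k 0 w] `<=` [set w | visits X Z k.+1 0 w].
Proof. by move=> k w; exact: visitsS. Qed.

Lemma eventuallyE X : Defs.eventually X = \bigcup_k [set w | visits X X k 0 w].
Proof.
apply/seteqP; split => [w [k [s ws sX]]|w [k _ /visitsP[j [_ + _ _]]]].
  have ex : exists k, option_in X (w k) by exists k; rewrite ws.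
  case: (ex_minnP ex) => m wm mmin; exists m => //; apply/visitsP.
  exists m; rewrite add0n; split => // i im; rewrite add0n.
  by apply/negP => /mmin; rewrite leqNgt im.
by rewrite add0n; case E : (w j) => [s|] //= sX; exists j, s.
Qed.

Lemma not_untilE X c : c \in X ->
  not_until X c = \bigcup_k [set w | visits X [set c]%SET k 0 w].
Proof.
move=> cX; apply/seteqP; split => [w [k wk kmin]|w [k _ /visitsP[j [_ _ + jl]]]].
  exists k => //; apply/visitsP; exists k; rewrite add0n wk /= inE; split => // i ik.
  by rewrite add0n; case E : (w i) => [s|] //=; exact: kmin E.
rewrite add0n; case E : (w j) => [s|] //=; rewrite inE => /eqP sc; exists j; first by rewrite E sc.
by move=> i s' ij Ei; have := jl i ij; rewrite add0n Ei.
Qed.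

Lemma bigcup_visitsI X Z X' Z' :
  (\bigcup_k [set w | visits X Z k 0 w]) `&` (\bigcup_k [set w | visits X' Z' k 0 w]) =
  \bigcup_k ([set w | visits X Z k 0 w] `&` [set w | visits X' Z' k 0 w]).
Proof.
apply/seteqP; split => [w [[k _ vk] [l _ vl]]|w [k _ [vk vl]]]; last by split; exists k.
exists (maxn k l) => //; split.
  by apply: visits_homo vk; exact: leq_maxl.
by apply: visits_homo vl; exact: leq_maxr.
Qed.

End visits.

(** * Probabilities of events as hitting values *)

Section probabilities.
Local Open Scope classical_set_scope.
Variables (R : realType) (n : nat) (M : markov_chain n) (E : {set 'I_n}).

Definition real_trans : 'M[R]_n := map_mx ratr (trans M).
Let P := real_trans.

Lemma real_trans_ge0 s t : 0 <= P s t.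
Proof. by rewrite mxE ler0q trans_ge0. Qed.

Lemma real_trans_sum s : \sum_t P s t <= 1.
Proof.
under eq_bigr do rewrite mxE; rewrite -rmorph_sum.
by case: (trans_sum M s) => ->; rewrite ?rmorph0 ?rmorph1.
Qed.

Let P_ge0 := real_trans_ge0.
Let P_sum := real_trans_sum.

Lemma Pr_visits (X Z : {set 'I_n}) v : is_hit P X (fun s => (s \in Z)%:R) v ->
  Pr R M (\bigcup_k [set w | visits X Z k 0 w]) = v (init M).
Proof.
move=> vh; apply: (Pr_bigcup (f := hit_upto P X (fun _ s => (s \in Z)%:R))).
- by move=> k; exact: measurable_visits.
- exact: visits_cup_homo.
- by move=> k; exact: (mu_visits R M X Z k [::]).
- apply: (cvg_hit_upto P_ge0 P_sum _ _ _ (g := fun s => (s \in Z)%:R)) => //.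
  + by move=> k s; rewrite lern1 leq_b1.
  + by move=> s; exact: cvg_cst.
Qed.

Lemma Pr_eventually (X : {set 'I_n}) v : is_hit P X (fun=> 1) v ->
  Pr R M (Defs.eventually X) = v (init M).
Proof.
by move=> vh; rewrite eventuallyE; apply: Pr_visits; apply: is_hit_ext vh => s ->.
Qed.

Lemma Pr_not_until (X : {set 'I_n}) c v : c \in X -> is_hit P X (fun s => (s == c)%:R) v ->
  Pr R M (not_until X c) = v (init M).
Proof.
by move=> cX vh; rewrite not_untilE //; apply: Pr_visits; apply: is_hit_ext vh => s _; rewrite inE.
Qed.

Hypothesis E_terminal : forall s t, s \in E -> trans M s t = 0.
Variable h : 'I_n -> R.
Hypothesis h_hit : is_hit P E (fun=> 1) h.

Lemma Pr_visits2 (X Z : {set 'I_n}) v : (forall s, s \in X -> s \notin E) ->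
  is_hit P X (fun s => (s \in Z)%:R * h s) v ->
  Pr R M (\bigcup_k ([set w | visits X Z k 0 w] `&` [set w | visits E E k 0 w])) = v (init M).
Proof.
move=> XE vh; pose hE := hit_upto P E (fun _ s => (s \in E)%:R).
have e0 (k : nat) s : 0 <= (s \in E)%:R :> R by rewrite ler0n.
have e1 (k : nat) s : (s \in E)%:R <= 1 :> R by rewrite lern1 leq_b1.
have hE0 k s : 0 <= hE k s by exact: hit_upto_ge0.
have hE1 k s : hE k s <= 1 by exact: hit_upto_le1.
apply: (Pr_bigcup (f := hit_upto P X (fun k s => (s \in Z)%:R * hE k s))).
- by move=> k; apply: measurableI; exact: measurable_visits.
- by move=> k w [vX vE]; split; exact: visitsS.
- by move=> k; exact: (mu_visits2 R Z k [::] XE E_terminal).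
- apply: (cvg_hit_upto P_ge0 P_sum _ _ _ (g := fun s => (s \in Z)%:R * h s)) => //.
  + by move=> k s; rewrite mulr_ge0.
  + by move=> k s; apply: mulr_ile1; rewrite // ?ler0n // lern1 leq_b1.
  + move=> k s; apply: ler_wpM2l; first by rewrite ler0n.
    by exact: hit_upto_homo.
  + move=> s; apply: cvgMr; apply: (cvg_hit_upto P_ge0 P_sum _ _ _ (g := fun s => (s \in E)%:R)) => //.
      by move=> t; exact: cvg_cst.
    by apply: is_hit_ext h_hit => t ->.
Qed.

Lemma Pr_eventuallyI (X : {set 'I_n}) v : (forall s, s \in X -> s \notin E) ->
  is_hit P X h v -> Pr R M (Defs.eventually X `&` Defs.eventually E) = v (init M).
Proof.
move=> XE vh; rewrite !eventuallyE bigcup_visitsI; apply: Pr_visits2 => //.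
by apply: is_hit_ext vh => s ->; rewrite mul1r.
Qed.

Lemma Pr_not_untilI (X : {set 'I_n}) c v : c \in X -> (forall s, s \in X -> s \notin E) ->
  is_hit P X (fun s => (s == c)%:R) v ->
  Pr R M (not_until X c `&` Defs.eventually E) = h c * v (init M).
Proof.
move=> cX XE vh; rewrite not_untilE // eventuallyE bigcup_visitsI.
rewrite (Pr_visits2 (v := fun s => h c * v s - 0 * v s)) ?mul0r ?subr0 //.
apply: is_hit_ext (is_hit_lin (h c) 0 vh vh) => s _; rewrite inE mul0r subr0.
by case: eqP => [->|]; rewrite ?mulr1 ?mul1r ?mulr0 ?mul0r.
Qed.

Lemma measurable_eventually X : measurable (Defs.eventually X : set (path_space n)).
Proof. by rewrite eventuallyE; apply: bigcupT_measurable => k; exact: measurable_visits. Qed.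

Lemma Pr_setD (A B : set (path_space n)) : measurable A -> measurable B ->
  Pr R M (A `&` ~` B) = Pr R M A - Pr R M (A `&` B).
Proof.
move=> mA mB; rewrite /Pr -setDE measureD //; last first.
  by rewrite ltey_eq fin_num_measure.
by rewrite fineB // fin_num_measure //; exact: measurableI.
Qed.

(** The denominator [2 * tp + fp + fn] is the probability of visiting the cause plus that of
    reaching the effect. *)
Lemma fscoreE (X : {set 'I_n}) a b : (forall s, s \in X -> s \notin E) ->
  is_hit P X h a -> is_hit P X (fun=> 1) b ->
  fscore R M E X = 2 * a (init M) / (b (init M) + h (init M)).
Proof.
move=> XE ha hb; have mX := measurable_eventually X; have mE := measurable_eventually E.
rewrite /fscore /tp /fp /fn setIC (setIC (~` _)) !Pr_setD // (setIC (Defs.eventually E)).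
rewrite (Pr_eventuallyI XE ha) (Pr_eventually hb) (Pr_eventually h_hit).
by congr (_ / _); ring.
Qed.

End probabilities.

(** * The pruned set yields an f-score-optimal SPR cause *)

Section optimal_SPR_cause.
Variables (R : realType) (n : nat) (M : markov_chain n) (E : {set 'I_n}).
Hypothesis E_terminal : forall s t, s \in E -> trans M s t = 0.

Let P := real_trans R M.
Let P_ge0 := real_trans_ge0 R M.
Let P_sum := real_trans_sum R M.
Let i0 := init M.

Definition eff_prob : 'I_n -> R := hit P E (fun=> 1).
Definition cause_eff_prob (X : {set 'I_n}) : 'I_n -> R := hit P X eff_prob.
Definition cause_prob (X : {set 'I_n}) : 'I_n -> R := hit P X (fun=> 1).

Let h := eff_prob.
Let one_ge0 (s : 'I_n) : 0 <= (1 : R). Proof. by []. Qed.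
Let one_le1 (s : 'I_n) : (1 : R) <= 1. Proof. by []. Qed.
Let h_ge0 s : 0 <= h s := hit_ge0 P_ge0 P_sum E one_ge0 one_le1 s.
Let h_le1 s : h s <= 1 := hit_le1 P_ge0 P_sum E one_ge0 one_le1 s.
Let h_hit : is_hit P E (fun=> 1) h := hitP P_ge0 P_sum E one_ge0 one_le1.
Let a_hit X : is_hit P X h (cause_eff_prob X) := hitP P_ge0 P_sum X h_ge0 h_le1.
Let b_hit X : is_hit P X (fun=> 1) (cause_prob X) := hitP P_ge0 P_sum X one_ge0 one_le1.
Let c_hit X c : is_hit P X (fun s => (s == c)%:R) (hit P X (fun s => (s == c)%:R)).
Proof.
by apply: hitP => // s; rewrite ?ler0n // lern1 leq_b1.
Qed.

(** The conditional probability is a quotient of [h c] times a hitting value by that value, so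
    raising the probability of the effect is a property of [c] alone. The other states of [X] matter
    only for whether [c] can be visited first. *)
Lemma SPR_causeP X : SPR_cause R M E X <->
  (exists c, c \in X) /\ forall c, c \in X ->
    [/\ c \notin E, 0 < hit P X (fun s => (s == c)%:R) i0 & h i0 < h c].
Proof.
split=> [[X0 XE XP]|[X0 XP]]; split => //.
- move=> c cX; have [p0 lt] := XP c cX.
  rewrite (Pr_not_until cX (c_hit X c)) in p0; split => //; first exact: XE.
  move: lt; rewrite /condPr setIC (Pr_not_untilI E_terminal h_hit cX XE (c_hit X c)).
  rewrite (Pr_not_until cX (c_hit X c)) (Pr_eventually h_hit).
  by rewrite mulfK // gt_eqF.
- by move=> c /XP[].
- move=> c cX; have [cE p0 lt] := XP c cX.
  have XE s : s \in X -> s \notin E by move=> /XP[].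
  rewrite (Pr_not_until cX (c_hit X c)); split => //.
  rewrite /condPr setIC (Pr_not_untilI E_terminal h_hit cX XE (c_hit X c)).
  rewrite (Pr_not_until cX (c_hit X c)) (Pr_eventually h_hit).
  by rewrite mulfK // gt_eqF.
Qed.

Definition prune_all : {set 'I_n} :=
  iter n (prune P i0 h cause_eff_prob cause_prob) (candidates E i0 h).

Theorem prune_all_optimal : (exists Y, SPR_cause R M E Y) ->
  fscore_optimal R M E (prune_all :&: frontier P prune_all i0)%SET.
Proof.
move=> [Y0 SY0].
have fsE Y : SPR_cause R M E Y ->
    fscore R M E Y = 2 * cause_eff_prob Y i0 / (cause_prob Y i0 + h i0).
  move=> /SPR_causeP[_ H]; apply: (fscoreE E_terminal h_hit _ (a_hit Y) (b_hit Y)).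
  by move=> s /H[].
(* Any [c] in [Y] is visited first with positive probability and [h c] is positive, so [Y] has true
   positives. *)
have a_gt0 Y : SPR_cause R M E Y -> 0 < cause_eff_prob Y i0.
  move=> /SPR_causeP[[c cY] /(_ c cY)[_ p0 lt]].
  have hc : 0 < h c by apply: le_lt_trans lt.
  apply: (@lt_le_trans _ _ (h c * hit P Y (fun s => (s == c)%:R) i0)); first exact: mulr_gt0.
  have <- : hit P Y (fun s => h c * (s == c)%:R) i0 = h c * hit P Y (fun s => (s == c)%:R) i0.
    have := is_hit_lin (h c) 0 (c_hit Y c) (c_hit Y c).
    move=> /(is_hit_ext (g := fun s => h c * (s == c)%:R)) H.
    rewrite (is_hit_unique P_ge0 P_sum (hitP P_ge0 P_sum Y _ _) (H _)) ?mul0r ?subr0 //.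
    - by move=> s; rewrite mulr_ge0.
    - by move=> s; apply: mulr_ile1; rewrite // ?ler0n // lern1 leq_b1.
    - by move=> s _; rewrite mul0r subr0.
  apply: ler_hit => // s; first by rewrite mulr_ge0.
  by case: eqP => [->|]; rewrite ?mulr1 ?mulr0.
have sub_C Y : SPR_cause R M E Y -> Y \subset candidates E i0 h.
  move=> /SPR_causeP[_ H]; apply/fintype.subsetP => c /H[cE _ lt].
  by rewrite inE cE lt.
(* The true positives of the given cause [Y0] are contained in the event of reaching the effect. *)
have h0 : 0 < h i0.
  apply: lt_le_trans (a_gt0 _ SY0) _.
  have YE s : s \in Y0 -> s \notin E by case: SY0 => _ + _; apply.
  rewrite -(Pr_eventuallyI E_terminal h_hit YE (a_hit Y0)) -(Pr_eventually h_hit).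
  have mI := measurable_eventually Y0; have mE := measurable_eventually E.
  apply: fine_le; try by apply: fin_num_measure => //; exact: measurableI.
  exact: measureIr.
set X := prune_all; set Z := (X :&: _)%SET.
have XC : X \subset candidates E i0 h by apply: iter_prune_sub.
have X_opt (Y : {set 'I_n}) : Y \subset candidates E i0 h ->
    2 * cause_eff_prob Y i0 / (cause_prob Y i0 + h i0) <=
    2 * cause_eff_prob X i0 / (cause_prob X i0 + h i0).
  apply: (iter_prune_optimal P_ge0 P_sum) => //.
  - by move=> s t sE; rewrite mxE E_terminal // rmorph0.
  - by move=> Y' s _; apply: hit_ge0.
  - by move=> Y' s _; apply: hit_le1.
have aZ : cause_eff_prob Z i0 = cause_eff_prob X i0 by apply: hit_frontier.
have bZ : cause_prob Z i0 = cause_prob X i0 by apply: hit_frontier.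
have SZ : SPR_cause R M E Z.
  apply/SPR_causeP; split.
    (* An empty set would have value 0, below the positive f-score of the given cause [Y0]. *)
    apply/set0Pn/negP => /eqP Z0; have := X_opt _ (sub_C _ SY0).
    have [_ _ Ha] := a_hit Z; rewrite -aZ Ha ?mulr0 ?mul0r.
      rewrite leNgt divr_gt0 // ?mulr_gt0 ?a_gt0 //.
      by apply: ltr_wpDl => //; apply: hit_ge0.
    apply/negP; rewrite Z0; move: (i0); apply: backward_ind => // s.
    by rewrite inE.
  move=> c; rewrite inE => /andP[cX cF].
  move/fintype.subsetP: XC => /(_ c cX); rewrite inE => /andP[cE lt]; split => //.
  rewrite hit_frontier //; first exact: hit_frontier_gt0.
split => // Y SY; rewrite !fsE // aZ bZ; apply: X_opt; exact: sub_C.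
Qed.

End optimal_SPR_cause.

(** * The program *)

Local Notation "a +! b" := (EOp Defs.Add a b) (at level 50, left associativity).
Local Notation "a -! b" := (EOp Defs.Sub a b) (at level 50, left associativity).
Local Notation "a *! b" := (EOp Defs.Mul a b) (at level 40, left associativity).
Local Notation "a /! b" := (EOp Defs.Div a b) (at level 40, left associativity).
Local Notation "c1 ;; c2" := (CSeq c1 c2) (at level 90, right associativity).
Local Notation esum := (EBig false) (only parsing).
Local Notation eprod := (EBig true) (only parsing).
Local Notation e0 := (ECst 0) (only parsing).
Local Notation e1 := (ECst 1) (only parsing).

(* Vectors are stored as matrices with constant rows, scalars as constant
   matrices; both are read on the diagonal. *)
Local Notation evec k x := (ERead k x x) (only parsing).

(** The only test is positivity, and [1 - (x - y)^2] is positive exactly for equal integers. *)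
Definition edelta (x y : nat) (a : expr) : expr :=
  EIf (e1 -! (EIdx x -! EIdx y) *! (EIdx x -! EIdx y)) a e0.

(** [aX], [aE], [aI] are indicators of the current set, the effects and the initial state; [aN] and
    [aD] hold [D P] and [D]; [aR] is a reachability set; [aA], [aM], [aU], [aC], [aK] belong to the
    linear solver; [aP] over [aQ] is [h]; [aF] and [aG] are [a_X] and [b_X] times a common positive
    factor; [aT] is scratch. *)
Local Notation aX := 0%N (only parsing).
Local Notation aN := 1%N (only parsing).
Local Notation aD := 2%N (only parsing).
Local Notation aR := 3%N (only parsing).
Local Notation aA := 4%N (only parsing).
Local Notation aM := 5%N (only parsing).
Local Notation aU := 6%N (only parsing).
Local Notation aC := 7%N (only parsing).
Local Notation aK := 8%N (only parsing).
Local Notation aT := 9%N (only parsing).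
Local Notation aE := 10%N (only parsing).
Local Notation aI := 11%N (only parsing).
Local Notation aP := 12%N (only parsing).
Local Notation aQ := 13%N (only parsing).
Local Notation aF := 14%N (only parsing).
Local Notation aG := 15%N (only parsing).

(** The detour through [aT] is needed because an assignment must not read its own target. *)
Definition reach_body (be ee : expr) : cmd :=
  CSet aT (EIf (be +! esum (ee *! evec aR 2)) e1 e0) ;; CSet aR (ERead aT 0 1).

Definition reach_cmd (be ee : expr) : cmd := CSet aR e0 ;; CIter (reach_body be ee).

(** [aU] keeps the product of [aA] and [aM]: it serves the trace of this round and the matrix of the
    next one. *)
Definition faddeev_body : cmd :=
  CSet aM (ERead aU 0 1 +! edelta 0 1 (evec aC 0)) ;;
  CSet aU (esum (ERead aA 0 2 *! ERead aM 2 1)) ;;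
  CSet aT (evec aK 0 +! e1) ;;
  CSet aK (ERead aT 0 1) ;;
  CSet aC ((e0 -! esum (evec aU 2)) /! evec aK 0).

Definition faddeev_cmd : cmd :=
  CSet aU e0 ;; CSet aC e1 ;; CSet aK e0 ;; CIter faddeev_body.

Definition hit_cmd : cmd :=
  reach_cmd (evec aX 0) (ERead aN 0 2) ;;
  CSet aA (edelta 0 1 (evec aD 0) -! EIf (evec aX 0) e0 (EIf (evec aR 0) (ERead aN 0 1) e0)) ;;
  faddeev_cmd.

Definition num_iexp (x y : nat) : iexp :=
  IAdd (ICst 2) (IMul (ICst 2) (IAdd (IMul (IVar x) IDim) (IVar y))).
Definition den_iexp (x y : nat) : iexp := IAdd (ICst 1) (num_iexp x y).
Definition eff_iexp (x : nat) : iexp :=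
  IAdd (ICst 2) (IAdd (IMul (ICst 2) (IMul IDim IDim)) (IVar x)).

(** The common denominator is the product of all denominators: no gcd is required, the divisions are
    exact, and its bit length stays polynomial. *)
Definition load_cmd : cmd :=
  CSet aD (eprod (eprod (EIn (den_iexp 2 3)))) ;;
  CSet aN (EIn (num_iexp 0 1) *! (evec aD 0 /! EIn (den_iexp 0 1))) ;;
  CSet aE (EIn (eff_iexp 0)) ;;
  CSet aI (EIf (e1 -! (EIdx 0 -! EIn (ICst 1)) *! (EIdx 0 -! EIn (ICst 1))) e1 e0).

(** Numerator and denominator are both multiplied by [aC], whose sign is unknown; the common
    denominator [aC * aC] is positive, so probabilities compare like their numerators. *)
Definition eff_cmd : cmd :=
  CSet aX (ERead aE 0 1) ;; hit_cmd ;;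
  CSet aP ((e0 -! evec aC 0) *! esum (ERead aM 0 2 *! evec aD 2 *! evec aE 2)) ;;
  CSet aQ (evec aC 0 *! evec aC 0) ;;
  CSet aX (EIf (evec aE 0) e0 (EIf (evec aP 0 -! esum (evec aI 2 *! evec aP 2)) e1 e0)).

(** The test of [prune], left side minus right side, times the positive factor [D K K] with
    [K = aC * aC * aQ]; a positive value means that the state is dropped. *)
Definition prune_test : expr :=
  esum (evec aI 2 *! evec aF 2)
  *! (evec aD 0 *! (evec aC 0 *! evec aC 0 *! evec aQ 0) -! esum (ERead aN 0 2 *! evec aG 2))
  -! (evec aD 0 *! evec aP 0 *! (evec aC 0 *! evec aC 0) -! esum (ERead aN 0 2 *! evec aF 2))
     *! (esum (evec aI 2 *! evec aG 2)
         +! esum (evec aI 2 *! evec aP 2) *! (evec aC 0 *! evec aC 0)).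

Definition prune_body : cmd :=
  hit_cmd ;;
  CSet aF ((e0 -! evec aC 0) *! esum (ERead aM 0 2 *! evec aD 2 *! evec aX 2 *! evec aP 2)) ;;
  CSet aG ((e0 -! evec aC 0) *! evec aQ 0 *! esum (ERead aM 0 2 *! evec aD 2 *! evec aX 2)) ;;
  CSet aT (EIf (evec aX 0) (EIf prune_test e0 e1) e0) ;;
  CSet aX (ERead aT 0 1).

(** The indices of [aN] are swapped, because [frontier] searches forwards from the initial state;
    edges leaving [aX] are suppressed. *)
Definition frontier_cmd : cmd :=
  reach_cmd (evec aI 0) (EIf (evec aX 2) e0 (ERead aN 2 0)).

Definition optimal_cause_cmd : cmd :=
  load_cmd ;; eff_cmd ;; CIter prune_body ;; frontier_cmd ;;
  CSet aT (EIf (evec aX 0) (EIf (evec aR 0) e1 e0) e0).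

Lemma input_num_iexp x y : input_iexp (num_iexp x y).
Proof.
move=> n v vn; rewrite /input_size /=; have := vn x; have := vn y; nia.
Qed.

Lemma input_den_iexp x y : input_iexp (den_iexp x y).
Proof.
move=> n v vn; rewrite /input_size /=; have := vn x; have := vn y; nia.
Qed.

Lemma input_eff_iexp x : input_iexp (eff_iexp x).
Proof. by move=> n v vn; rewrite /input_size /=; have := vn x; lia. Qed.

Lemma input_init_iexp : input_iexp (ICst 1).
Proof. by move=> n v vn; rewrite /input_size /=; have := vn 0%N; lia. Qed.

Lemma wf_optimal_cause_cmd : wf_cmd optimal_cause_cmd.
Proof.
have H1 := input_num_iexp; have H2 := input_den_iexp; have H3 := input_eff_iexp.
have H4 := input_init_iexp.
by rewrite /=; repeat split => //.
Qed.

Fixpoint writes (c : cmd) : seq nat :=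
  match c with
  | CSet k _ => [:: k]
  | CSeq c1 c2 => writes c1 ++ writes c2
  | CIter c1 => writes c1
  end.

Lemma run_unwritten n inp c (s : store n) k : k \notin writes c -> run inp c s k = s k.
Proof.
elim: c s => [k' e|c1 IH1 c2 IH2|c IH] s /=.
- by rewrite inE /set_array => /negbTE->.
- by rewrite mem_cat negb_or => /andP[k1 k2]; rewrite IH2 ?IH1.
- by move=> kc; elim: (X in iter X) => //= m IHm; rewrite IH.
Qed.

(** * Correctness of the program *)

Section programs.
Variables (n : nat) (inp : nat -> int).
Implicit Types s : store n.

Lemma delta_test (i j : 'I_n) :
  (0 < 1 - ((i : nat)%:Z - (j : nat)%:Z) * ((i : nat)%:Z - (j : nat)%:Z)) = (i == j).
Proof.
have [->|ij] := eqVneq i j; first by rewrite subrr mulr0 subr0.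
have : (i : nat) <> j by move=> /val_inj/eqP; apply/negP.
by move=> ne; apply/negbTE; rewrite -leNgt; nia.
Qed.

Definition ind_mx (S : {set 'I_n}) : 'M[int]_n := \matrix_(i, j) (i \in S)%:Z.

Lemma indE S i j : ind_mx S i j = (i \in S)%:Z. Proof. by rewrite mxE. Qed.

Lemma ind_test (b : bool) : (0 < (b : nat)%:Z) = b. Proof. by case: b. Qed.

Lemma run_reach s be ee (X : {set 'I_n}) (e : rel 'I_n) :
  (forall k, k \in [:: aR; aT] -> (k \notin reads be) && (k \notin reads ee)) ->
  (forall i j, eval inp s (ij_env i j) 2 be = (i \in X)%:Z) ->
  (forall i j k, 0 <= eval inp s (bind (ij_env i j) 2 k) 3 ee) ->
  (forall i j k, (0 < eval inp s (bind (ij_env i j) 2 k) 3 ee) = e i k) ->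
  run inp (reach_cmd be ee) s aR = ind_mx (backward e X).
Proof.
move=> nr beE ee0 eeE; rewrite /= /backward /fixset /= card_ord.
set s0 := set_array s aR _; set body := (X in iter n X s0).
have same m k : k \notin [:: aR; aT] -> iter m body s0 k = s k.
  rewrite !inE negb_or => /andP[kR kT].
  elim: m => [|m IH]; first by rewrite /= /s0 /set_array (negbTE kR).
  by rewrite iterS /body /set_array (negbTE kR) (negbTE kT).
have ext m env d a : (forall k, k \in reads a -> k \notin [:: aR; aT]) ->
    eval inp (iter m body s0) env d a = eval inp s env d a.
  by move=> H; apply: eq_eval_reads => k /H; apply: same.
suff H m : iter m body s0 aR = ind_mx (iter m (backward_step e X) finset.set0) by exact: H.
elim: m => [|m IH].
  by rewrite /= /s0 /set_array /=; apply/matrixP => i j; rewrite !mxE inE.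
rewrite !iterS; set s1 := iter m body s0 in IH *; set S := iter m (backward_step e X) finset.set0 in IH *.
rewrite {1}/body /set_array /=; apply/matrixP => i j; rewrite !mxE /= !mxE /=.
rewrite ext; last by move=> k kb; apply/negP => /nr; rewrite kb.
rewrite beE; set Sum := \sum_(v < n) _.
have SumE : Sum = \sum_k eval inp s (bind (ij_env i j) 2 k) 3 ee * (k \in S)%:Z.
  apply: eq_bigr => k _; rewrite ext; first by rewrite /= IH indE.
  by move=> k' kb; apply/negP => /nr; rewrite kb andbF.
rewrite SumE; have S0 : 0 <= \sum_k eval inp s (bind (ij_env i j) 2 k) 3 ee * (k \in S)%:Z.
  by apply: sumr_ge0 => k _; rewrite mulr_ge0 // ler0n.
rewrite inE inE; case: (i \in X) => /=; first by rewrite ltr_pwDl.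
(* A sum of nonnegative terms is positive as soon as one term is; so the sum expresses the
   existential quantifier of [backward_step]. *)
rewrite add0r lt_neqAle S0 andbT eq_sym psumr_neq0; last first.
  by move=> k _; rewrite mulr_ge0 // ler0n.
have -> : has (fun k => true && (0 < eval inp s (bind (ij_env i j) 2 k) 3 ee * (k \in S)%:Z))
   (index_enum _) = [exists t, (t \in S) && e i t].
  apply/hasP/existsP => [[k _ /=]|[k /andP[kS ik]]].
    case kS : (k \in S); last by rewrite mulr0.
    by rewrite mulr1 (eeE i j) => ik; exists k; rewrite kS.
  by exists k; rewrite ?mem_index_enum // kS mulr1 (eeE i j).
by case: ifP.
Qed.

(* The matrix [D (I - Q)], where [Q] is the transition matrix without the rows of
   [X] and of the states that cannot reach [X], and [D] clears denominators. *)
Definition system_mx (N : 'M[int]_n) (D : int) (X : {set 'I_n}) : 'M[int]_n :=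
  \matrix_(i, j) ((if i == j then D else 0) -
    (if i \in X then 0 else if i \in backward (fun u v => 0 < N u v) X then N i j else 0)).

(** [aM] is not initialised, hence its clause starts with the first round, whereas the initial 0 in
    [aU] already is the product with the zero start matrix. *)
Lemma iter_faddeev s m (s0 := run inp (CSet aU e0;; CSet aC e1;; CSet aK e0) s)
    (sm := iter m (run inp faddeev_body) s0) (A := s aA) :
  [/\ sm aA = A, sm aU = A *m (faddeev A m).1, sm aC = const_mx (faddeev A m).2,
      sm aK = const_mx m%:Z & (0 < m)%N -> sm aM = (faddeev A m).1].
Proof.
rewrite /sm {sm}; elim: m => [|m IH] /=.
  split => //; rewrite /s0 /= /set_array /=; apply/matrixP => i j; rewrite !mxE //=.
  by rewrite big1 // => k _; rewrite mxE mulr0.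
move: IH; set sm := iter m _ s0; move=> /= [HA HU HC HK _].
set M := A *m (faddeev A m).1 + (faddeev A m).2%:M.
have EM : eval_mx inp sm (ERead aU 0 1 +! edelta 0 1 (evec aC 0)) = M.
  apply/matrixP => i j; rewrite !mxE /= HU HC delta_test !mxE; congr (_ + _).
  by case: eqP.
set s1 := set_array sm aM _.
have EU : eval_mx inp s1 (esum (ERead aA 0 2 *! ERead aM 2 1)) = A *m M.
  by apply/matrixP => i j; rewrite mxE /= /s1 /set_array /= EM HA !mxE.
rewrite EU; set s2 := set_array s1 aU _.
set s3 := set_array s2 aT _.
have ET : s3 aT = const_mx m.+1%:Z.
  apply/matrixP => i j; rewrite /s3 /set_array /= !mxE /= /s2 /s1 /set_array /= HK mxE.
  by rewrite -addn1 PoszD.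
set s4 := set_array s3 aK _.
have EK : s4 aK = const_mx m.+1%:Z.
  by apply/matrixP => i j; rewrite /s4 /set_array /= mxE /= ET !mxE.
split.
- by rewrite /set_array /=.
- by rewrite /set_array /=.
- apply/matrixP => i j; rewrite /set_array /= mxE /= EK !mxE sub0r; congr (- _ %/ _)%Z.
- by rewrite /set_array /= EK.
- by move=> _; rewrite -EM.
Qed.

Lemma run_faddeev s : (0 < n)%N ->
  run inp faddeev_cmd s aM = (faddeev (s aA) n).1 /\
  run inp faddeev_cmd s aC = const_mx (faddeev (s aA) n).2.
Proof. by move=> n0; have [_ _ HC _ HM] := iter_faddeev s n; split; [exact: HM|]. Qed.

Lemma run_hit s (N : 'M[int]_n) D X (A := system_mx N D X) : (0 < n)%N ->
  s aX = ind_mx X -> s aN = N -> s aD = const_mx D -> (forall i j, 0 <= N i j) ->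
  run inp hit_cmd s aM = (faddeev A n).1 /\ run inp hit_cmd s aC = const_mx (faddeev A n).2.
Proof.
move=> n0 sX sN sD N0; rewrite /hit_cmd.
set rc := reach_cmd _ _; set ca := CSet aA _.
have -> : run inp (rc;; ca;; faddeev_cmd) s = run inp faddeev_cmd (run inp ca (run inp rc s)) by [].
have EA : run inp ca (run inp rc s) aA = A.
  have RE : run inp rc s aR = ind_mx (backward (fun u v => 0 < N u v) X).
    apply: run_reach => [k|i j|i j k|i j k] /=.
    - by rewrite !inE => /orP[] /eqP->.
    - by rewrite sX indE.
    - by rewrite sN.
    - by rewrite sN.
  have same k : k \notin [:: aR; aT] -> run inp rc s k = s k.
    by rewrite !inE negb_or => /andP[kR kT]; apply: run_unwritten; rewrite /= !inE !negb_or kR kT.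
  move: RE same; move: (run inp rc s) => s1 RE same.
  rewrite /ca /= /set_array /=; apply/matrixP => i j.
  rewrite mxE /= RE !same // sX sN sD !mxE delta_test !ind_test.
  by case: (i \in X).
by have [HM HC] := run_faddeev (run inp ca (run inp rc s)) n0; rewrite EA in HM HC.
Qed.

End programs.

(** * Hitting values from integer linear systems *)

Section linear_system.
Variables (R : realFieldType) (n : nat) (P : 'M[R]_n).
Hypothesis P_ge0 : forall s t, 0 <= P s t.
Hypothesis P_sum : forall s, \sum_t P s t <= 1.
Variables (N : 'M[int]_n) (D : int).
Hypothesis D_gt0 : 0 < D.
Hypothesis NE : forall i j, (N i j)%:~R = D%:~R * P i j.

Let DR_gt0 : 0 < D%:~R :> R. Proof. by rewrite ltr0z. Qed.

Lemma scaled_edge : (fun u v => 0 < N u v) = edge P.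
Proof.
apply/funext => u; apply/funext => v.
by rewrite /edge -(pmulr_rgt0 _ DR_gt0) -NE ltr0z.
Qed.

Variable X : {set 'I_n}.
Let A := system_mx N D X.

Lemma system_mx_apply (z : 'I_n -> R) i :
  \sum_j (A i j)%:~R * z j =
  D%:~R * (z i - (if i \in X then 0 else if i \in backward (edge P) X then avg P z i else 0)).
Proof.
under eq_bigr => j _ do rewrite mxE intrB mulrBl scaled_edge.
rewrite sumrB mulrBr; congr (_ - _).
  rewrite (bigD1 i) //= eqxx big1 ?addr0 // => j ji.
  by rewrite eq_sym (negbTE ji) mul0r.
case: ifP => _; first by rewrite mulr0 big1 // => j _; rewrite mul0r.
case: ifP => _; last by rewrite mulr0 big1 // => j _; rewrite mul0r.
by rewrite mulr_sumr; apply: eq_bigr => j _; rewrite NE mulrA.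
Qed.

Lemma system_mx_hit (f z : 'I_n -> R) :
  (forall i, \sum_j (A i j)%:~R * z j = D%:~R * ((i \in X)%:R * f i)) -> is_hit P X f z.
Proof.
move=> H; have {}H i : z i = (i \in X)%:R * f i +
    (if i \in X then 0 else if i \in backward (edge P) X then avg P z i else 0).
  move: (H i); rewrite system_mx_apply => /(mulfI (lt0r_neq0 DR_gt0)) /eqP.
  by rewrite subr_eq => /eqP.
have z0 i : i \notin backward (edge P) X -> z i = 0.
  move=> iB; have iX : i \notin X by apply: contra iB; exact: sub_backward.
  by rewrite H (negbTE iX) (negbTE iB) mul0r addr0.
split => // i iX; first by rewrite H iX mul1r addr0.
have [iB|iB] := boolP (i \in backward (edge P) X); first by rewrite H (negbTE iX) iB mul0r add0r.
rewrite z0 // avg_zero // => t it; apply: z0.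
by apply: contra iB; exact: backward_pred.
Qed.

(** A kernel vector would be a hitting value for the reward 0, hence zero by uniqueness. Dropping
    the rows of the states that cannot reach [X] is what makes every solution vanish there. *)
Lemma faddeev_system_neq0 : (faddeev A n).2 != 0.
Proof.
rewrite faddeev_det mulf_eq0 negb_or signr_eq0 /=.
apply/negP => /eqP detA.
have /eqP/det0P[v v0 vA] : \det (map_mx intr A)^T = 0 :> R.
  by rewrite det_tr det_map_mx detA rmorph0.
have vh : is_hit P X (fun=> 0) (fun j => v 0 j).
  apply: system_mx_hit => i; rewrite !mulr0.
  have := congr1 (fun B : 'rV_n => B 0 i) vA; rewrite !mxE => H; rewrite -[RHS]H.
  by apply: eq_bigr => j _; rewrite [in RHS]mxE [in RHS]mxE mulrC.
have zh : is_hit P X (fun=> 0) (fun=> 0).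
  by split => // s _; rewrite avg_zero.
move/negP: v0; apply; apply/eqP/rowP => j.
by rewrite (is_hit_unique P_ge0 P_sum vh zh j) mxE.
Qed.

(** The inverse of the system matrix, which is [- (faddeev A n).1] divided by [(faddeev A n).2], is
    applied to [D] times the reward restricted to [X]. *)
Lemma faddeev_system_hit (f : 'I_n -> R) : (0 < n)%N -> is_hit P X f
  (fun i => - (\sum_k ((faddeev A n).1 i k)%:~R * D%:~R * (k \in X)%:R * f k) /
            (faddeev A n).2%:~R).
Proof.
move=> n0; set B := (faddeev A n).1; set c := (faddeev A n).2.
have c0 : c%:~R != 0 :> R by rewrite intr_eq0 faddeev_system_neq0.
apply: system_mx_hit => i.
under eq_bigr => j _ do rewrite mulNr mulrN mulrA mulr_sumr.
rewrite sumrN -mulr_suml exchange_big /=.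
have E k : \sum_j (A i j)%:~R * (B j k)%:~R = - c%:~R * (i == k)%:R :> R.
  have -> : - c%:~R * (i == k)%:R = ((A *m B) i k)%:~R :> R.
    by rewrite faddeev_solve // !mxE; case: eqP; rewrite ?mulr1 ?mulr0 ?mulr1n ?mulr0n ?oppr0 ?rmorph0 ?rmorphN.
  by rewrite mxE rmorph_sum; apply: eq_bigr => j _; rewrite rmorphM.
have E2 k : \sum_j (A i j)%:~R * (B j k)%:~R * (D%:~R * (k \in X)%:R * f k) =
    - c%:~R * (i == k)%:R * (D%:~R * (k \in X)%:R * f k) by rewrite -mulr_suml E.
transitivity (- (\sum_k \sum_j (A i j)%:~R * (B j k)%:~R * (D%:~R * (k \in X)%:R * f k) / c%:~R)).
  congr (- _); rewrite mulr_suml; apply: eq_bigr => k _; rewrite mulr_suml; apply: eq_bigr => j _; ring.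
under eq_bigr => k _ do rewrite -mulr_suml E2.
rewrite (bigD1 i) //= eqxx big1 ?addr0 => [|k ki]; last by rewrite eq_sym (negbTE ki) mulr0 !mul0r.
by rewrite /= mulr1; field.
Qed.

End linear_system.

Lemma size_flatten_blocks (T : eqType) k (ss : seq (seq T)) :
  (forall s, s \in ss -> size s = k) -> size (flatten ss) = (size ss * k)%N.
Proof.
elim: ss => //= s ss IH H; rewrite size_cat IH => [|s' s's]; last by apply: H; rewrite inE s's orbT.
by rewrite H ?mulSn ?mem_head.
Qed.

Lemma nth_flatten_blocks (T : eqType) (x0 : T) k (ss : seq (seq T)) i j :
  (forall s, s \in ss -> size s = k) -> (j < k)%N ->
  nth x0 (flatten ss) (i * k + j) = nth x0 (nth [::] ss i) j.
Proof.
move=> + jk; elim: ss i => [|s ss IH] i H /=; first by rewrite !nth_nil.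
have sk : size s = k by rewrite H ?mem_head.
rewrite nth_cat sk; case: i => [|i]; first by rewrite mul0n add0n jk.
rewrite mulSn -addnA ltnNge leq_addr /= addKn IH // => s' s's.
by apply: H; rewrite inE s's orbT.
Qed.

(** * Addresses in the encoded instance *)

Section encoding.
Variables (n : nat) (M : markov_chain n) (Eff : {set 'I_n}).
Let inp := nth 0 (encode_instance M Eff).

Let entries := [seq [:: numq (trans M s t); denq (trans M s t)] | s <- enum 'I_n, t <- enum 'I_n].

Let size_row s : s \in [seq [seq [:: numq (trans M s t); denq (trans M s t)] | t <- enum 'I_n]
   | s <- enum 'I_n] -> size s = n.
Proof. by move=> /mapP[i _ ->]; rewrite size_map size_enum_ord. Qed.

Let size_entry s : s \in entries -> size s = 2.
Proof. by move=> /allpairsP[p [_ _ ->]]. Qed.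

Let size_entries : size entries = (n * n)%N.
Proof. by rewrite /entries size_allpairs size_enum_ord. Qed.

Let nth_entries (i j : 'I_n) :
  nth [::] entries (i * n + j) = [:: numq (trans M i j); denq (trans M i j)].
Proof.
rewrite /entries (nth_flatten_blocks [::] i (j := j) (@size_row)) // (nth_map i) ?size_enum_ord //.
by rewrite (nth_map j) ?size_enum_ord // !nth_ord_enum.
Qed.

Lemma size_encode_instance : size (encode_instance M Eff) = input_size n.
Proof.
rewrite /encode_instance /= size_cat (size_flatten_blocks (@size_entry)) size_entries.
by rewrite size_map size_enum_ord /input_size; lia.
Qed.

Let nth_entry (i j : 'I_n) b : (b < 2)%N ->
  inp (2 + (2 * (i * n + j) + b))%N = nth 0 [:: numq (trans M i j); denq (trans M i j)] b.
Proof.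
move=> b2; rewrite /inp /encode_instance addnC !addn2 /= -/entries nth_cat.
rewrite (size_flatten_blocks (@size_entry)) size_entries ifT; last first.
  have := ltn_ord i; have := ltn_ord j; nia.
by rewrite mulnC (nth_flatten_blocks _ _ (@size_entry)) // nth_entries.
Qed.

Lemma encode_num (i j : 'I_n) : inp (2 + 2 * (i * n + j))%N = numq (trans M i j).
Proof. by rewrite -[(2 * _)%N]addn0 nth_entry. Qed.

Lemma encode_den (i j : 'I_n) : inp (1 + (2 + 2 * (i * n + j)))%N = denq (trans M i j).
Proof. by rewrite addnC -addnA nth_entry. Qed.

Lemma encode_eff (i : 'I_n) : inp (2 + (2 * (n * n) + i))%N = (i \in Eff)%:Z.
Proof.
rewrite /inp /encode_instance addnC !addn2 /= -/entries nth_cat.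
rewrite (size_flatten_blocks (@size_entry)) size_entries mulnC ifF; last first.
  by apply/negbTE; rewrite -leqNgt leq_addr.
by rewrite addKn /encode_set (nth_map i) ?size_enum_ord // nth_ord_enum.
Qed.

End encoding.

(** * The stages of the program on an encoded chain *)

Section correctness.
Variables (R : realType) (n : nat) (M : markov_chain n) (Eff : {set 'I_n}).
Let inp := nth 0 (encode_instance M Eff).
Let P := real_trans R M.
Let P_ge0 := real_trans_ge0 R M.
Let P_sum := real_trans_sum R M.
Let i0 := init M.
Let h := eff_prob R M Eff.
Let a := cause_eff_prob R M Eff.
Let b := @cause_prob R n M.
Let n_gt0 : (0 < n)%N. Proof. exact: leq_ltn_trans (ltn_ord (init M)). Qed.

Definition denom : int := \prod_k \prod_l denq (trans M k l).
Definition scaled_trans : 'M[int]_n :=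
  \matrix_(i, j) (numq (trans M i j) * (denom %/ denq (trans M i j))%Z).

Lemma denom_gt0 : 0 < denom.
Proof. by apply: prodr_gt0 => k _; apply: prodr_gt0 => l _; exact: denq_gt0. Qed.

Lemma scaled_transE i j : (scaled_trans i j)%:~R = denom%:~R * P i j :> R.
Proof.
have [d Dd] : exists d, denom = d * denq (trans M i j).
  exists ((\prod_(k | k != i) \prod_l denq (trans M k l)) * \prod_(l | l != j) denq (trans M i l)).
  by rewrite /denom (bigD1 i) //= (bigD1 j) //=; ring.
rewrite !mxE Dd mulzK ?denq_eq0 // !rmorphM /= /ratr.
field; by rewrite intr_eq0 denq_eq0.
Qed.

Lemma scaled_trans_ge0 i j : 0 <= scaled_trans i j.
Proof. by rewrite -(ler0z R) scaled_transE mulr_ge0 // ler0z ltW // denom_gt0. Qed.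

Let D := denom.
Let N := scaled_trans.
Let D_gt0 : 0 < D := denom_gt0.
Let NE := scaled_transE.

Definition loaded (s : store n) : Prop :=
  [/\ s aN = N, s aD = const_mx D, s aE = ind_mx Eff & s aI = ind_mx [set i0]%SET].

Lemma run_load s : loaded (run inp load_cmd s).
Proof.
have ED : eval_mx inp s (eprod (eprod (EIn (den_iexp 2 3)))) = const_mx D.
  apply/matrixP => i j; rewrite !mxE; apply: eq_bigr => k _; apply: eq_bigr => l _ /=.
  exact: encode_den.
rewrite /loaded /load_cmd /= ED /set_array /=; split => //; apply/matrixP => i j; rewrite !mxE //=.
- by rewrite /set_array /= mxE -(encode_num M Eff) -(encode_den M Eff).
- exact: encode_eff.
- rewrite -[inp 1]/((init M : nat)%:Z) delta_test inE.
  by case: eqP.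
Qed.

Lemma loaded_run c s : (forall k, k \in [:: aN; aD; aE; aI] -> k \notin writes c) ->
  loaded s -> loaded (run inp c s).
Proof.
by move=> H [sN sD sE sI]; split; rewrite run_unwritten ?H.
Qed.

Lemma sum_init s k : s aI = ind_mx [set i0]%SET ->
  \sum_v s aI v v * s k v v = s k i0 i0.
Proof.
move=> sI; rewrite (bigD1 i0) //= big1 => [|v vi]; last by rewrite sI indE inE (negbTE vi) mul0r.
by rewrite sI indE inE eqxx mul1r addr0.
Qed.

Definition eff_known (s : store n) : Prop :=
  exists u q, [/\ s aP = \matrix_(i, j) u i, s aQ = const_mx q, 0 < q &
    forall i, h i = (u i)%:~R / q%:~R].

Lemma run_eff s : loaded s ->
  eff_known (run inp eff_cmd s) /\ run inp eff_cmd s aX = ind_mx (candidates Eff i0 h).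
Proof.
move=> Ls; have [sN sD sE sI] := Ls; rewrite /eff_cmd.
set s1 := set_array s aX (eval_mx inp s (ERead aE 0 1)).
have s1X : s1 aX = ind_mx Eff.
  by apply/matrixP => i j; rewrite /s1 /set_array /= mxE /= sE !mxE.
have [HM HC] := run_hit inp n_gt0 s1X sN sD scaled_trans_ge0.
set s2 := run inp hit_cmd s1 in HM HC.
have s2L : loaded s2 by apply: loaded_run => // k; rewrite !inE => /or4P[] /eqP->.
have [s2N s2D s2E s2I] := s2L.
set B := (faddeev _ n).1 in HM; set c := (faddeev _ n).2 in HC.
pose u i := (0 - c) * \sum_k B i k * D * (k \in Eff)%:Z.
pose q := c * c.
have c0 : c != 0 by exact: (faddeev_system_neq0 P_ge0 P_sum D_gt0 NE).
have hu i : h i = (u i)%:~R / q%:~R.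
  have hh : is_hit P Eff (fun=> 1) h by apply: hitP.
  have := is_hit_unique P_ge0 P_sum hh (faddeev_system_hit P_ge0 P_sum D_gt0 NE Eff (fun=> 1) n_gt0) i.
  move=> ->; rewrite -/B -/c /u /q sub0r !rmorphM rmorphN rmorph_sum /=.
  have cR : c%:~R != 0 :> R by rewrite intr_eq0.
  rewrite (eq_bigr (fun k => (B i k)%:~R * D%:~R * (k \in Eff)%:R)); last by move=> k _; rewrite mulr1.
  rewrite [in RHS](eq_bigr (fun k => (B i k)%:~R * D%:~R * (k \in Eff)%:R)); last first.
    by move=> k _; rewrite !rmorphM.
  by field.
have q0 : 0 < q by rewrite /q -expr2 exprn_even_gt0.
set tail := (X in hit_cmd;; X).
have -> : run inp (CSet aX (ERead aE 0 1);; hit_cmd;; tail) s = run inp tail s2 by [].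
move: HM HC s2N s2D s2E s2I; move: (s2) => {s2L} t tM tC tN tD tE tI.
have EP : eval_mx inp t ((e0 -! evec aC 0) *! esum (ERead aM 0 2 *! evec aD 2 *! evec aE 2)) =
    \matrix_(i, j) u i.
  apply/matrixP => i j; rewrite !mxE /= tC mxE /u; congr (_ * _).
  by apply: eq_bigr => k _; rewrite tM tD tE !mxE.
rewrite /tail /= EP; set t1 := set_array t aP _.
have EQ : eval_mx inp t1 (evec aC 0 *! evec aC 0) = const_mx q.
  by apply/matrixP => i j; rewrite !mxE /= /t1 /set_array /= tC mxE.
rewrite EQ; set t2 := set_array t1 aQ _; split.
  by exists u, q; split; rewrite // /t2 /t1 /set_array /=.
rewrite {1}/set_array /=; apply/matrixP => i j; rewrite mxE /= (sum_init aP) //.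
rewrite /t2 /t1 /set_array /= tE !mxE inE ind_test.
case: (i \in Eff) => //=; rewrite !hu subr_gt0.
rewrite ltr_pM2r ?invr_gt0 ?ltr0z // ltr_int.
by case: ifP.
Qed.

Definition prune_ready (X : {set 'I_n}) (s : store n) : Prop :=
  [/\ loaded s, eff_known s & s aX = ind_mx X].

Lemma run_prune (X : {set 'I_n}) s : X \subset candidates Eff i0 h -> prune_ready X s ->
  prune_ready (prune P i0 h a b X) (run inp prune_body s).
Proof.
move=> XC [Ls [u [q [sP sQ q0 hu]]] sX]; have [sN sD sE sI] := Ls.
have [HM HC] := run_hit inp n_gt0 sX sN sD scaled_trans_ge0.
set B := (faddeev _ n).1 in HM; set c := (faddeev _ n).2 in HC.
have c0 : c != 0 by exact: (faddeev_system_neq0 P_ge0 P_sum D_gt0 NE).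
have cR : c%:~R != 0 :> R by rewrite intr_eq0.
have qR : q%:~R != 0 :> R by rewrite intr_eq0 gt_eqF.
pose F i := (0 - c) * \sum_k B i k * D * (k \in X)%:Z * u k.
pose G i := (0 - c) * q * \sum_k B i k * D * (k \in X)%:Z.
(* One factor [c] clears the division of the solver, the other makes the sign positive, and [q]
   clears the denominator of [h] in [a X]; [b X] receives [q] as well so that both share the
   scale. *)
pose K := c * c * q.
have K0 : 0 < K by rewrite mulr_gt0 // -expr2 exprn_even_gt0.
have KR : 0 < K%:~R :> R by rewrite ltr0z.
have KE : K%:~R = c%:~R * c%:~R * q%:~R :> R by rewrite !rmorphM.
have h_hit f : (forall s, 0 <= f s) -> (forall s, f s <= 1) ->
    is_hit P X f (hit P X f) by move=> f0 f1; apply: hitP.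
have h0 t : 0 <= h t by apply: hit_ge0.
have h1 t : h t <= 1 by apply: hit_le1.
have aE' i : (F i)%:~R = K%:~R * a X i.
  rewrite /a /cause_eff_prob.
  rewrite (is_hit_unique P_ge0 P_sum (h_hit h h0 h1) (faddeev_system_hit P_ge0 P_sum D_gt0 NE X h n_gt0) i).
  rewrite -/B -/c /F sub0r KE rmorphM rmorphN rmorph_sum /=.
  rewrite [in RHS](eq_bigr (fun k => (B i k * D * (k \in X)%:Z * u k)%:~R / q%:~R)); last first.
    by move=> k _; rewrite hu !rmorphM mulrA.
  by rewrite -mulr_suml; field; rewrite cR qR.
have bE' i : (G i)%:~R = K%:~R * b X i.
  rewrite /b /cause_prob.
  rewrite (is_hit_unique P_ge0 P_sum (h_hit (fun=> 1) _ _) (faddeev_system_hit P_ge0 P_sum D_gt0 NE X (fun=> 1) n_gt0) i) //.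
  rewrite -/B -/c /G sub0r KE !rmorphM rmorphN rmorph_sum /=.
  rewrite [in RHS](eq_bigr (fun k => (B i k * D * (k \in X)%:Z)%:~R)); last first.
    by move=> k _; rewrite !rmorphM mulr1.
  by field; rewrite cR.
set s2 := run inp hit_cmd s in HM HC.
have s2L : loaded s2 by apply: loaded_run => // k; rewrite !inE => /or4P[] /eqP->.
have [s2N s2D s2E s2I] := s2L.
have s2X : s2 aX = ind_mx X by rewrite /s2 run_unwritten.
have s2P : s2 aP = \matrix_(i, j) u i by rewrite /s2 run_unwritten.
have s2Q : s2 aQ = const_mx q by rewrite /s2 run_unwritten.
have L' : loaded (run inp prune_body s) by apply: loaded_run => // k; rewrite !inE => /or4P[] /eqP->.
split => //; first by exists u, q; rewrite !run_unwritten.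
rewrite /prune_body; set tail := (X in hit_cmd;; X).
have -> : run inp (hit_cmd;; tail) s = run inp tail s2 by [].
move: HM HC s2N s2D s2E s2I s2X s2P s2Q; move: (s2) => {s2L L'} t tM tC tN tD tE tI tX tP tQ.
have EF : eval_mx inp t ((e0 -! evec aC 0) *! esum (ERead aM 0 2 *! evec aD 2 *! evec aX 2 *! evec aP 2)) =
    \matrix_(i, j) F i.
  apply/matrixP => i j; rewrite !mxE /= tC mxE /F; congr (_ * _).
  by apply: eq_bigr => k _; rewrite tM tD tX tP !mxE.
rewrite /tail /= EF; set t1 := set_array t aF _.
have EG : eval_mx inp t1 ((e0 -! evec aC 0) *! evec aQ 0 *! esum (ERead aM 0 2 *! evec aD 2 *! evec aX 2)) =
    \matrix_(i, j) G i.
  apply/matrixP => i j; rewrite !mxE /= /t1 /set_array /= tC tQ !mxE /G; congr (_ * _).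
  by apply: eq_bigr => k _; rewrite tM tD tX !mxE.
rewrite EG; set t2 := set_array t1 aG _.
have t2I : t2 aI = ind_mx [set i0]%SET by [].
rewrite {1}/set_array /=; apply/matrixP => i j; rewrite mxE /= {1}/set_array /= mxE /=.
rewrite !(sum_init _ t2I) /t2 /t1 /set_array /= tX tD tC tQ tP tN !indE !mxE ind_test.
rewrite inE; case: (i \in X) => //=.
set S1 := \sum_(v < n) _; set S2 := \sum_(v < n) _; set T := (X in 0 < X).
have avgE W w : (forall k, (W k)%:~R = K%:~R * w k) ->
    (\sum_k N i k * W k)%:~R = D%:~R * K%:~R * avg P w i :> R.
  move=> Ww; rewrite rmorph_sum /= mulr_sumr; apply: eq_bigr => k _.
  by rewrite rmorphM /= (NE i k) Ww; ring.
have S1E : S1%:~R = D%:~R * K%:~R * avg P (b X) i :> R.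
  by rewrite -(avgE G) //; congr (_%:~R); apply: eq_bigr => k _; rewrite !mxE.
have S2E : S2%:~R = D%:~R * K%:~R * avg P (a X) i :> R.
  by rewrite -(avgE F) //; congr (_%:~R); apply: eq_bigr => k _; rewrite !mxE.
have uE k : (u k)%:~R = q%:~R * h k by rewrite hu mulrC divfK.
have TE : T%:~R = D%:~R * K%:~R * K%:~R * (a X i0 * (1 - avg P (b X) i) -
    (h i - avg P (a X) i) * (b X i0 + h i0)) :> R.
  rewrite /T; move: (F i0) (G i0) (aE' i0) (bE' i0) => F0 G0 F0E G0E.
  rewrite !(rmorphB, rmorphM, rmorphD) /= S1E S2E F0E G0E !uE KE; ring.
rewrite -(ltr0z R) TE pmulr_rgt0; last by rewrite !mulr_gt0 // ltr0z.
by rewrite subr_gt0 ltNge; case: (_ <= _).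
Qed.

Lemma run_optimal_cause s i : run inp optimal_cause_cmd s aT i i =
  (i \in prune_all R M Eff :&: frontier P (prune_all R M Eff) i0)%SET%:Z.
Proof.
rewrite /optimal_cause_cmd.
set s1 := run inp load_cmd s; have L1 : loaded s1 by exact: run_load.
set s2 := run inp eff_cmd s1; have [K2 X2] : eff_known s2 /\ s2 aX = ind_mx (candidates Eff i0 h).
  exact: run_eff.
have L2 : loaded s2 by apply: loaded_run => // k; rewrite !inE => /or4P[] /eqP->.
set s3 := run inp (CIter prune_body) s2.
have [L3 _ X3] : prune_ready (prune_all R M Eff) s3.
  suff H m : prune_ready (iter m (prune P i0 h a b) (candidates Eff i0 h))
      (iter m (run inp prune_body) s2) by exact: H.
  elim: m => [|m IH]; first by split.
  by rewrite !iterS; apply: run_prune => //; apply: iter_prune_sub.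
set X := prune_all R M Eff in X3 *; have [N3 D3 E3 I3] := L3.
set out := CSet aT _.
have -> : run inp (load_cmd;; eff_cmd;; CIter prune_body;; frontier_cmd;; out) s =
  run inp out (run inp frontier_cmd s3) by [].
have FR : run inp frontier_cmd s3 aR = ind_mx (frontier P X i0).
  apply: run_reach => [k|j j'|j j' k|j j' k] /=.
  - by rewrite !inE => /orP[] /eqP->.
  - by rewrite I3 indE.
  - by rewrite X3 indE ind_test N3; case: ifP => // _; exact: scaled_trans_ge0.
  - rewrite X3 indE ind_test N3 -(congr1 (fun e => e k j) (scaled_edge D_gt0 NE)) /bind /=.
    by case: (k \in X) => //=; rewrite ?andbT ?andbF.
have FX : run inp frontier_cmd s3 aX = ind_mx X by rewrite run_unwritten.
move: FR FX; move: (run inp frontier_cmd s3) => t tR tX.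
rewrite /out /= /set_array /= mxE /= tR tX !indE !ind_test inE.
by case: (i \in X); case: (i \in _).
Qed.

End correctness.

(** * Running time of the program *)

Lemma small_sum n (G : 'I_n -> int) m : (forall i, small m (G i)) -> small (m + n) (\sum_i G i).
Proof.
elim: n G => [|n IH] G Gm; first by rewrite big_ord0 /small expn_gt0.
rewrite big_ord_recr /= addnS; have := small_add (IH _ (fun i => Gm (widen_ord (leqnSn n) i))) (Gm ord_max).
by rewrite (maxn_idPl _) // leq_addr.
Qed.

(** A round multiplies by [A] twice, once for the matrix and once for the trace, at [al + n] bits
    each; summing the diagonal costs [n] more, and adding the scalar matrix one. The division adds
    nothing. *)
Lemma small_faddeev n (A : 'M[int]_n) al k (be := (2 * al + 3 * n + 2)%N) :
  (forall i j, small al (A i j)) ->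
  (forall i j, small (k * be).+1 ((faddeev A k).1 i j)) /\ small (k * be).+1 (faddeev A k).2.
Proof.
move=> Aal; have mulA (B : 'M[int]_n) m : (forall i j, small m (B i j)) ->
    forall i j, small (al + m + n) ((A *m B) i j).
  by move=> Bm i j; rewrite mxE; apply: small_sum => l; apply: small_mul.
elim: k => [|k [IHM IHc]].
  by split => [i j|] //=; rewrite mxE.
have HM i j : small (al + (k * be).+1 + n).+1 ((A *m (faddeev A k).1 + (faddeev A k).2%:M) i j).
  rewrite mxE; apply: small_leq (small_add (mulA _ _ IHM i j) (_ : small (k * be).+1 _)).
    by rewrite ltnS geq_max leqnn /=; lia.
  by rewrite mxE; case: eqP => _; rewrite ?mulr1n ?mulr0n // /small expn_gt0.
split => [i j|] /=; first by apply: small_leq (HM i j); rewrite /be; lia.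
apply: small_div; rewrite /small abszN.
apply: (@small_leq _ _ (\tr _) _ (small_sum (fun i => mulA _ _ HM i i))).
by rewrite /be; lia.
Qed.

Section families.
Variable F : family.
Implicit Type s : forall x : idx F, store (dim x).

Lemma poly_bits_const m (A : forall x : idx F, 'M[int]_(dim x)) :
  (forall x i j, small m (A x i j)) -> poly_bits F A.
Proof. by move=> H; exists (fun=> m) => //; exact: poly_bounded_const. Qed.

Lemma poly_bits_reindex J (f : J -> idx F) (A : forall x : idx F, 'M[int]_(dim x)) :
  poly_bits F A -> poly_bits (reindex_family f) (fun y => A (f y)).
Proof. by move=> [g [k gk] H]; exists (fun y => g (f y)) => //; exists k. Qed.

Lemma poly_bits_iter s c k : k \notin writes c -> poly_bits F (fun x => s x k) ->
  poly_bits (iter_family F)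
    (fun y => iter (projT2 y) (run (input (projT1 y)) c) (s (projT1 y)) k).
Proof.
move=> kc /(poly_bits_reindex (fun y : {x : idx F & 'I_(dim x)} => projT1 y)) [f pf H].
exists f => // -[x m] i j /=.
have -> : iter m (run (input x) c) (s x) k = s x k.
  by elim: (m : nat) => //= l IH; rewrite run_unwritten.
exact: (H (existT _ x m)).
Qed.

Lemma poly_bits_run s c k : k \notin writes c -> poly_bits F (fun x => s x k) ->
  poly_bits F (fun x => run (input x) c (s x) k).
Proof. by move=> kc [f pf H]; exists f => // x i j; rewrite run_unwritten. Qed.

Fixpoint all_poly_bits s (ks : seq nat) : Prop :=
  if ks is k :: ks' then poly_bits F (fun x => s x k) /\ all_poly_bits s ks' else True.

Lemma all_poly_bitsP s ks k : all_poly_bits s ks -> k \in ks -> poly_bits F (fun x => s x k).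
Proof.
by elim: ks => //= k' ks IH [H1 H2]; rewrite inE => /predU1P[->|/(IH H2)].
Qed.

Lemma poly_eval s e : wf 2 e -> all_poly_bits s (reads e) ->
  poly_bits F (fun x => eval_mx (input x) (s x) e).
Proof. by move=> we H; apply: poly_bits_eval => // k; apply: all_poly_bitsP. Qed.

Lemma poly_set s k e : all_poly_bits s (reads e) -> poly_cost_run F (CSet k e) s.
Proof. by move=> H; apply: poly_cost_set => k'; apply: all_poly_bitsP. Qed.

Lemma poly_set_seq s k e c : all_poly_bits s (reads e) ->
  poly_cost_run F c (fun x => set_array (s x) k (eval_mx (input x) (s x) e)) ->
  poly_cost_run F (CSet k e;; c) s.
Proof. by move=> H1 H2; apply: poly_cost_seq => //; exact: poly_set. Qed.

End families.

Ltac bits := rewrite /=; repeat split; assumption.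

(** * Bit lengths and costs of the stages *)

Section reach.
Variable F : family.
Variables (s : forall x : idx F, store (dim x)) (be ee : expr).
Hypothesis not_read : forall k, k \in reads be ++ reads ee -> k \notin [:: aR; aT].
Hypothesis read_bits : forall k, k \in reads be ++ reads ee -> poly_bits F (fun x => s x k).
Hypotheses (wf_be : wf 2 be) (wf_ee : wf 3 ee).

Let s0 (x : idx F) := run (input x) (CSet aR e0) (s x).

Let small_iter_reach x m i j :
  small 1 (iter m (run (input x) (reach_body be ee)) (s0 x) aR i j).
Proof.
case: m => [|m] /=; first by rewrite /s0 /= /set_array /= mxE.
by rewrite /set_array /= mxE /= mxE /=; case: ifP.
Qed.

Lemma poly_bits_reach : poly_bits F (fun x => run (input x) (reach_cmd be ee) (s x) aR).
Proof. by apply: (poly_bits_const (m := 1)) => x i j; exact: small_iter_reach. Qed.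

Lemma poly_cost_reach : poly_cost_run F (reach_cmd be ee) s.
Proof.
apply: poly_set_seq => //; apply: poly_cost_iter.
have bR : poly_bits (iter_family F) (fun y => iter (projT2 y)
    (run (input (projT1 y)) (reach_body be ee)) (s0 (projT1 y)) aR).
  by apply: (poly_bits_const (m := 1)) => y i j; exact: small_iter_reach.
have wfb : wf 2 (EIf (be +! esum (ee *! evec aR 2)) e1 e0) by [].
set t := fun y => _.
have bt k : k \in reads (EIf (be +! esum (ee *! evec aR 2)) e1 e0) ->
    poly_bits (iter_family F) (fun y => t y k).
  rewrite /= cats0 catA mem_cat => /orP[kr|]; last by rewrite inE => /eqP->.
  apply: (@poly_bits_iter F s0); first by have := not_read kr; rewrite /= !inE orbC.
  have := not_read kr; rewrite !inE negb_or /s0 /= /set_array => /andP[/negbTE-> _].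
  exact: read_bits.
apply: poly_cost_seq; first exact: poly_cost_set.
apply: poly_set => /=; split => //.
rewrite /set_array /=; exact: poly_bits_eval.
Qed.

End reach.

Section faddeev.
Variable F : family.
Variable s : forall x : idx F, store (dim x).
Hypothesis bA : poly_bits F (fun x => s x aA).

Lemma poly_bits_faddeev :
  poly_bits F (fun x => run (input x) faddeev_cmd (s x) aM) /\
  poly_bits F (fun x => run (input x) faddeev_cmd (s x) aC).
Proof.
have [f pf H] := bA.
pose g x := (weight x * (2 * f x + 3 * weight x + 2)).+1%N.
have pg : poly_bounded (@weight F) g by rewrite /g; poly.
have fg x m : (m <= weight x)%N -> ((m * (2 * f x + 3 * dim x + 2)).+1 <= g x)%N.
  move=> mw; rewrite ltnS leq_mul // leq_add2r leq_add2l leq_mul2l dim_weight.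
  by rewrite orbT.
split; exists g => // x i j;
  have [HM HC] := run_faddeev (input x) (s x) (leq_ltn_trans (leq0n _) (ltn_ord i));
  have [BM BC] := small_faddeev (dim x) (H x).
  by rewrite HM; apply: small_leq (BM i j); apply: fg; exact: dim_weight.
by rewrite HC mxE; apply: small_leq BC; apply: fg; exact: dim_weight.
Qed.

Lemma poly_cost_faddeev : poly_cost_run F faddeev_cmd s.
Proof.
have [f pf H] := bA.
apply: poly_set_seq => //; apply: poly_set_seq => //; apply: poly_set_seq => //.
apply: poly_cost_iter; set t := fun y => _.
pose g x := (f x + (weight x * (2 * f x + 3 * weight x + 2)).+1 + weight x)%N.
have pg : poly_bounded (@weight F) g by rewrite /g; poly.
have pg' := poly_bounded_reindex (fun y : {x : idx F & 'I_(dim x)} => projT1 y) pg.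
have le (y : {x : idx F & 'I_(dim x)}) (x := projT1 y) (m := projT2 y) :
    ((m * (2 * f x + 3 * dim x + 2)).+1 <= (weight x * (2 * f x + 3 * weight x + 2)).+1)%N.
  rewrite ltnS leq_mul //; first by apply: ltnW; apply: leq_trans (ltn_ord _) (dim_weight _).
  by rewrite leq_add2r leq_add2l leq_mul2l dim_weight orbT.
have bAt : poly_bits (iter_family F) (fun y => t y aA).
  exists (fun y => f (projT1 y)) => [|y i j]; first exact: poly_bounded_reindex.
  by have [E _ _ _ _] := iter_faddeev (input (projT1 y)) (s (projT1 y)) (projT2 y); rewrite (E : t y aA = _) {E}; exact: H.
have bUt : poly_bits (iter_family F) (fun y => t y aU).
  exists (fun y => g (projT1 y)) => [|y i j]; first exact: pg'.
  have [_ E _ _ _] := iter_faddeev (input (projT1 y)) (s (projT1 y)) (projT2 y); rewrite (E : t y aU = _) {E}.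
  have [BM _] := small_faddeev (projT2 y) (H (projT1 y)).
  rewrite mxE; apply: small_leq (small_sum (fun l => small_mul (H (projT1 y) i l) (BM l j))).
  by rewrite /g; apply: leq_add (dim_weight _); rewrite leq_add2l; exact: le.
have bCt : poly_bits (iter_family F) (fun y => t y aC).
  exists (fun y => g (projT1 y)) => [|y i j]; first exact: pg'.
  have [_ _ E _ _] := iter_faddeev (input (projT1 y)) (s (projT1 y)) (projT2 y); rewrite (E : t y aC = _) {E}.
  have [_ BC] := small_faddeev (projT2 y) (H (projT1 y)).
  rewrite mxE; apply: small_leq BC; apply: leq_trans (le y) _.
  by rewrite /g; lia.
have bKt : poly_bits (iter_family F) (fun y => t y aK).
  exists (fun y => weight (projT1 y)) => [|y i j]; first exact: poly_bounded_weight.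
  have [_ _ _ E _] := iter_faddeev (input (projT1 y)) (s (projT1 y)) (projT2 y); rewrite (E : t y aK = _) {E}.
  rewrite mxE; apply: small_nat; apply: ltnW.
  exact: leq_trans (ltn_ord _) (dim_weight _).
(* From here on only the bit lengths at the beginning of the round matter. *)
clearbody t.
apply: poly_set_seq; first by bits.
set t1 := fun x => set_array _ aM _.
have b1M : poly_bits (iter_family F) (fun y => t1 y aM) by apply: poly_eval; [|bits].
apply: poly_set_seq; first by bits.
set t2 := fun x => set_array _ aU _.
have b2U : poly_bits (iter_family F) (fun y => t2 y aU) by apply: poly_eval; [|bits].
apply: poly_set_seq; first by bits.
set t3 := fun x => set_array _ aT _.
have b3T : poly_bits (iter_family F) (fun y => t3 y aT) by apply: poly_eval; [|bits].
apply: poly_set_seq; first by bits.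
set t4 := fun x => set_array _ aK _.
have b4K : poly_bits (iter_family F) (fun y => t4 y aK) by apply: poly_eval; [|bits].
by apply: poly_set; bits.
Qed.

End faddeev.

Lemma poly_hit (F : family) (s : forall x : idx F, store (dim x)) :
  all_poly_bits s [:: aX; aN; aD] ->
  poly_cost_run F hit_cmd s /\ all_poly_bits (fun x => run (input x) hit_cmd (s x)) [:: aM; aC].
Proof.
move=> [bX [bN [bD _]]].
pose rc := reach_cmd (evec aX 0) (ERead aN 0 2).
pose ca := CSet aA (edelta 0 1 (evec aD 0) -! EIf (evec aX 0) e0 (EIf (evec aR 0) (ERead aN 0 1) e0)).
have nr k : k \in reads (evec aX 0) ++ reads (ERead aN 0 2) -> k \notin [:: aR; aT].
  by rewrite /= !inE => /orP[] /eqP->.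
have rb k : k \in reads (evec aX 0) ++ reads (ERead aN 0 2) -> poly_bits F (fun x => s x k).
  by rewrite /= !inE => /orP[] /eqP->.
have cr : poly_cost_run F rc s by exact: poly_cost_reach.
have bR : poly_bits F (fun x => run (input x) rc (s x) aR) by exact: poly_bits_reach.
pose s1 := fun x : idx F => run (input x) rc (s x).
have b1X : poly_bits F (fun x => s1 x aX) by exact: poly_bits_run.
have b1N : poly_bits F (fun x => s1 x aN) by exact: poly_bits_run.
have b1D : poly_bits F (fun x => s1 x aD) by exact: poly_bits_run.
have b1R : poly_bits F (fun x => s1 x aR) by exact: bR.
pose s2 := fun x : idx F => run (input x) ca (s1 x).
have b2A : poly_bits F (fun x => s2 x aA) by apply: poly_eval; [|bits].
split.
  apply: (poly_cost_seq cr); apply: (@poly_cost_seq _ s1); first by apply: poly_set; bits.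
  exact: (@poly_cost_faddeev _ s2).
have [bM bC] := @poly_bits_faddeev _ s2 b2A; split; [exact: bM|split => //; exact: bC].
Qed.

Lemma small_if01 n inp (t : store n) a b i j :
  small 1 (eval_mx inp t (EIf a (EIf b e0 e1) e0) i j) /\
  small 1 (eval_mx inp t (EIf a e0 (EIf b e1 e0)) i j).
Proof. by rewrite !mxE /=; split; do 2?case: ifP. Qed.

(** Whatever is computed in a round, the set that it leaves behind is stored as zeros and ones, so
    bit lengths do not accumulate over the rounds. *)
Lemma small_prune_body n inp (t : store n) i j : small 1 (run inp prune_body t aX i j).
Proof.
rewrite /prune_body; set cF := CSet aF _; set cG := CSet aG _; set eT := EIf _ _ _.
have -> : run inp (hit_cmd;; cF;; cG;; CSet aT eT;; CSet aX (ERead aT 0 1)) t =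
  run inp (CSet aT eT;; CSet aX (ERead aT 0 1)) (run inp cG (run inp cF (run inp hit_cmd t))) by [].
move: (run inp cG _) => t'.
suff -> : run inp (CSet aT eT;; CSet aX (ERead aT 0 1)) t' aX = eval_mx inp t' eT.
  by have [] := small_if01 inp t' (evec aX 0) prune_test i j.
by apply/matrixP => i' j'; rewrite [LHS]mxE.
Qed.

Lemma poly_load (F : family) (s : forall x : idx F, store (dim x)) :
  poly_cost_run F load_cmd s /\
  all_poly_bits (fun x => run (input x) load_cmd (s x)) [:: aN; aD; aE; aI].
Proof.
have H1 := input_num_iexp; have H2 := input_den_iexp; have H3 := input_eff_iexp.
have H4 := input_init_iexp.
rewrite /load_cmd; set eD := eprod _; set eN := EIn _ *! _; set eE := EIn _; set eI := EIf _ _ _.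
pose s1 (x : idx F) := set_array (s x) aD (eval_mx (input x) (s x) eD).
pose s2 (x : idx F) := set_array (s1 x) aN (eval_mx (input x) (s1 x) eN).
pose s3 (x : idx F) := set_array (s2 x) aE (eval_mx (input x) (s2 x) eE).
have b1D : poly_bits F (fun x => s1 x aD) by apply: poly_eval => //=; split => //; exact: H2.
have b2N : poly_bits F (fun x => s2 x aN).
  by apply: poly_eval => //=; repeat split => //.
have b3E : poly_bits F (fun x => s3 x aE) by apply: poly_eval => //=; split => //; exact: H3.
have b4I : poly_bits F (fun x => eval_mx (input x) (s3 x) eI).
  by apply: poly_eval => //=; repeat split => //; exact: H4.
split; last by bits.
apply: poly_set_seq => //; apply: (@poly_set_seq _ s1); first by bits.
by apply: (@poly_set_seq _ s2) => //; apply: (@poly_set _ s3).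
Qed.

Lemma poly_eff (F : family) (s : forall x : idx F, store (dim x)) :
  all_poly_bits s [:: aN; aD; aE; aI] ->
  [/\ poly_cost_run F eff_cmd s,
      all_poly_bits (fun x => run (input x) eff_cmd (s x)) [:: aN; aD; aE; aI; aP; aQ] &
      forall x i j, small 1 (run (input x) eff_cmd (s x) aX i j)].
Proof.
move=> [bN [bD [bE [bI _]]]].
pose s1 (x : idx F) := set_array (s x) aX (eval_mx (input x) (s x) (ERead aE 0 1)).
have b1X : poly_bits F (fun x => s1 x aX) by apply: poly_eval; [|bits].
have [hc [b2M [b2C _]]] := @poly_hit F s1 (ltac:(bits)).
pose s2 (x : idx F) := run (input x) hit_cmd (s1 x).
have b2N : poly_bits F (fun x => s2 x aN) by exact: (@poly_bits_run _ s1).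
have b2D : poly_bits F (fun x => s2 x aD) by exact: (@poly_bits_run _ s1).
have b2E : poly_bits F (fun x => s2 x aE) by exact: (@poly_bits_run _ s1).
have b2I : poly_bits F (fun x => s2 x aI) by exact: (@poly_bits_run _ s1).
rewrite /eff_cmd.
set eP := _ *! esum _; set eQ := evec aC 0 *! _; set eX := EIf _ _ _.
pose s3 (x : idx F) := set_array (s2 x) aP (eval_mx (input x) (s2 x) eP).
pose s4 (x : idx F) := set_array (s3 x) aQ (eval_mx (input x) (s3 x) eQ).
have b3P : poly_bits F (fun x => s3 x aP) by apply: poly_eval; [|bits].
have b4Q : poly_bits F (fun x => s4 x aQ) by apply: poly_eval; [|bits].
split.
- apply: poly_set_seq; first by bits.
  apply: (@poly_cost_seq _ s1) => //; apply: (@poly_set_seq _ s2); first by bits.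
  by apply: (@poly_set_seq _ s3); [bits|apply: (@poly_set _ s4); bits].
- by bits.
- move=> x i j; set cP := CSet aP _; set cQ := CSet aQ _.
  have -> : run (input x) (CSet aX (ERead aE 0 1);; hit_cmd;; cP;; cQ;; CSet aX eX) (s x) =
    run (input x) (CSet aX eX) (run (input x) cQ (run (input x) cP (s2 x))) by [].
  move: (run (input x) cQ _) => t.
  by have [_] := small_if01 (input x) t (evec aE 0) (evec aP 0 -! esum (evec aI 2 *! evec aP 2)) i j.
Qed.

(** A round depends on its predecessors only through [aX], which is 0 or 1; the other arrays it
    reads are never written in the loop or are recomputed first. *)
Lemma poly_prune (F : family) (s : forall x : idx F, store (dim x)) :
  all_poly_bits s [:: aN; aD; aE; aI; aP; aQ] -> (forall x i j, small 1 (s x aX i j)) ->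
  poly_cost_run F (CIter prune_body) s /\
  poly_bits F (fun x => run (input x) (CIter prune_body) (s x) aX).
Proof.
move=> [bN [bD [bE [bI [bP [bQ _]]]]]] bX.
have X1 x m i j : small 1 (iter m (run (input x) prune_body) (s x) aX i j).
  case: m => [|m]; first exact: bX.
  exact: small_prune_body.
split; last by apply: (poly_bits_const (m := 1)) => x i j; exact: X1.
apply: poly_cost_iter.
pose F' := iter_family F; set t := fun y => _.
have tX : poly_bits F' (fun y => t y aX) by apply: (poly_bits_const (m := 1)) => y i j; exact: X1.
have tN : poly_bits F' (fun y => t y aN) by exact: poly_bits_iter.
have tD : poly_bits F' (fun y => t y aD) by exact: poly_bits_iter.
have tI : poly_bits F' (fun y => t y aI) by exact: poly_bits_iter.
have tP : poly_bits F' (fun y => t y aP) by exact: poly_bits_iter.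
have tQ : poly_bits F' (fun y => t y aQ) by exact: poly_bits_iter.
clearbody t.
have [hc [b2M [b2C _]]] := @poly_hit F' t (ltac:(bits)).
pose s2 (x : idx F') := run (input x) hit_cmd (t x).
have b2X : poly_bits F' (fun x => s2 x aX) by exact: poly_bits_run.
have b2N : poly_bits F' (fun x => s2 x aN) by exact: poly_bits_run.
have b2D : poly_bits F' (fun x => s2 x aD) by exact: poly_bits_run.
have b2I : poly_bits F' (fun x => s2 x aI) by exact: poly_bits_run.
have b2P : poly_bits F' (fun x => s2 x aP) by exact: poly_bits_run.
have b2Q : poly_bits F' (fun x => s2 x aQ) by exact: poly_bits_run.
rewrite /prune_body.
set eF := (X in CSet aF X); set eG := (X in CSet aG X); set eT := EIf _ _ _.
pose s3 (x : idx F') := set_array (s2 x) aF (eval_mx (input x) (s2 x) eF).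
pose s4 (x : idx F') := set_array (s3 x) aG (eval_mx (input x) (s3 x) eG).
pose s5 (x : idx F') := set_array (s4 x) aT (eval_mx (input x) (s4 x) eT).
have b3F : poly_bits F' (fun x => s3 x aF) by apply: poly_eval; [|bits].
have b4G : poly_bits F' (fun x => s4 x aG) by apply: poly_eval; [|bits].
have b5T : poly_bits F' (fun x => s5 x aT) by apply: poly_eval; [|bits].
apply: poly_cost_seq => //; apply: (@poly_set_seq _ s2); first by bits.
apply: (@poly_set_seq _ s3); first by bits.
apply: (@poly_set_seq _ s4); first by bits.
by apply: (@poly_set _ s5); bits.
Qed.

Lemma poly_optimal_cause (F : family) (s : forall x : idx F, store (dim x)) :
  poly_cost_run F optimal_cause_cmd s /\
  poly_bits F (fun x => run (input x) optimal_cause_cmd (s x) aT).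
Proof.
have [c1 b1] := poly_load s.
pose s1 (x : idx F) := run (input x) load_cmd (s x).
have [c2 [b2N [b2D [b2E [b2I b2']]]] X2] := @poly_eff F s1 b1.
pose s2 (x : idx F) := run (input x) eff_cmd (s1 x).
have [c3 b3X] := @poly_prune F s2 (conj b2N (conj b2D (conj b2E (conj b2I b2')))) X2.
pose s3 (x : idx F) := run (input x) (CIter prune_body) (s2 x).
have b3N : poly_bits F (fun x => s3 x aN) by exact: (@poly_bits_run _ s2).
have b3I : poly_bits F (fun x => s3 x aI) by exact: (@poly_bits_run _ s2).
pose be := evec aI 0; pose ee := EIf (evec aX 2) e0 (ERead aN 2 0).
have nr k : k \in reads be ++ reads ee -> k \notin [:: aR; aT].
  by rewrite /= !inE => /or3P[] /eqP->.
have rb k : k \in reads be ++ reads ee -> poly_bits F (fun x => s3 x k).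
  by rewrite /= !inE => /or3P[] /eqP->.
have c4 : poly_cost_run F frontier_cmd s3 by apply: poly_cost_reach.
pose s4 (x : idx F) := run (input x) frontier_cmd (s3 x).
have b4R : poly_bits F (fun x => s4 x aR) by exact: (@poly_bits_reach _ s3).
have b4X : poly_bits F (fun x => s4 x aX) by exact: (@poly_bits_run _ s3).
split; last by apply: (@poly_eval _ s4); [|bits].
apply: poly_cost_seq => //; apply: (@poly_cost_seq _ s1) => //.
apply: (@poly_cost_seq _ s2) => //; apply: (@poly_cost_seq _ s3) => //.
by apply: (@poly_set _ s4); bits.
Qed.

Lemma bit_length_word_size (x : seq int) z : z \in x -> (bit_length z <= word_size x)%N.
Proof. by move=> zx; rewrite /word_size (big_rem z) //= leq_addr. Qed.

Lemma size_word_size (x : seq int) : (size x <= word_size x)%N.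
Proof. by rewrite /word_size -sum1_size; apply: leq_sum. Qed.

Section instances.

Definition instance : Type := {n : nat & (markov_chain n * {set 'I_n})%type}.
Let encode (x : instance) : seq int := encode_instance (projT2 x).1 (projT2 x).2.

Let weight_gt0 x : (0 < word_size (encode x))%N.
Proof. exact: leq_trans (size_word_size _). Qed.

Let dim_weight x : (projT1 x <= word_size (encode x))%N.
Proof.
(* Every cell counts for at least one bit, and the indicator of the effects alone takes [n]
   cells. *)
apply: leq_trans (size_word_size _); rewrite size_encode_instance /input_size.
by rewrite leq_addl.
Qed.

Let input_small x a : small (word_size (encode x)) (nth 0 (encode x) a).
Proof.
case: (ltnP a (size (encode x))) => al; last by rewrite nth_default // /small expn_gt0.
by apply: small_leq (bit_length_small _); apply: bit_length_word_size; exact: mem_nth.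
Qed.

Definition instances : family :=
  @Family instance (fun x => word_size (encode x)) (@projT1 _ _) (fun x => nth 0 (encode x))
    weight_gt0 dim_weight (fun x a _ => input_small x a).

Lemma optimal_cause_poly : exists q : {poly nat}, forall n (M : markov_chain n) (Eff : {set 'I_n}),
  let x := encode_instance M Eff in
  runs (ram_program optimal_cause_cmd aT) (initial_state x)
    (fun st => forall i : 'I_n, memory st i = run (nth 0 x) optimal_cause_cmd (fun=> 0) aT i i)
    q.[word_size x].
Proof.
have [pc pb] := @poly_optimal_cause instances (fun x _ => 0).
have [||||||q H] := @ram_program_poly instances encode optimal_cause_cmd aT _ _ _ _ _ _ pc pb.
- by [].
- exact: input_small.
- by [].
- by move=> x; exact: size_encode_instance.
- exact: wf_optimal_cause_cmd.
- by [].
by exists q => n M Eff; exact: (H (existT _ n (M, Eff))).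
Qed.

End instances.

Theorem theorem5p13 :
  exists (p : program) (q : {poly nat}),
    forall (R : realType) (n : nat) (M : markov_chain n) (Eff : {set 'I_n}),
      (forall s : 'I_n, reachable M s) ->
      (exists e : 'I_n, e \in Eff) ->
      (forall e : 'I_n, e \in Eff -> terminal M e /\ e != init M) ->
      (exists Cause : {set 'I_n}, SPR_cause R M Eff Cause) ->
      exists Cause : {set 'I_n},
        fscore_optimal R M Eff Cause /\
        computes_within p (encode_instance M Eff) (encode_set Cause)
          q.[word_size (encode_instance M Eff)].
Proof.
have [q H] := optimal_cause_poly.
(* Program and polynomial are fixed before [R]; the real numbers serve only to identify the set that
   the run computes. *)
exists (ram_program optimal_cause_cmd aT), q => R n M Eff _ _ terminal_Eff SPR_ex.
have Et s t : s \in Eff -> trans M s t = 0.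
  by move=> /terminal_Eff[/forallP/(_ t)/eqP].
exists (prune_all R M Eff :&: frontier (real_trans R M) (prune_all R M Eff) (init M))%SET.
split; first exact: prune_all_optimal.
have [st [c [E cq memE]]] := H n M Eff; exists st, c; split => // i.
rewrite /encode_set size_map size_enum_ord => lt.
rewrite (nth_map (Ordinal lt)) ?size_enum_ord // (nth_ord_enum _ (Ordinal lt)).
by rewrite (memE (Ordinal lt)) (run_optimal_cause R).
Qed.
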